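(* Let $\lambda$ be an infinite cardinal with $\lambda=\lambda^{<\lambda}$, and assume $\diamondsuit_S$ where $S=\{\delta<\lambda^+:\mathrm{cf}(\delta)=\lambda\}$. Then for any model $M$ of PA there is a $\lambda$-saturated model $N$ of $\mathrm{Th}(M)$ of cardinality $\lambda^+$ such that $E^5_N\subseteq E^4_N$.
   Context: Models of PA are in the vocabulary $\{0,1,<,+,\times\}$ and ordinary, i.e. $\mathbb N$ is an initial segment. On $N\setminus\mathbb N$: $a\,E^4_N\,b$ iff there is $n\in\mathbb N$ with $a<_N b^n$ and $b<_N a^n$; $a\,E^5_N\,b$ iff some automorphism of the linear order $(N,<_N)$ maps $a$ to $b$. *)

(* Defs.v *)
From mathcomp Require Import all_boot all_order.
From mathcomp Require Import boolp classical_sets functions cardinality wochoice.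

Set Implicit Arguments.
Unset Strict Implicit.
Unset Printing Implicit Defensive.

Local Open Scope classical_set_scope.
Local Open Scope card_scope.
Local Open Scope order_scope.

(** * First-order logic in the vocabulary {0, 1, <, +, *} *)

(* Free variables are indexed by an arbitrary type V; a quantifier binds [None].
   Hence [form void] is the type of sentences, and [form (option A)] is the type
   of formulas in one free variable [None] with parameters from A. *)

Inductive term (V : Type) : Type :=
| Var of V
| Zero
| One
| Add of term V & term V
| Mul of term V & term V.

Arguments Zero {V}.
Arguments One {V}.

Inductive form (V : Type) : Type :=
| Equal of term V & term V
| Less of term V & term V
| Bot
| Imp of form V & form V
| All of form (option V).

Arguments Bot {V}.

Definition Neg (V : Type) (p : form V) : form V := Imp p Bot.
Definition And (V : Type) (p q : form V) : form V := Neg (Imp p (Neg q)).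
Definition Iff (V : Type) (p q : form V) : form V := And (Imp p q) (Imp q p).
Definition Ex (V : Type) (p : form (option V)) : form V := Neg (All (Neg p)).

Fixpoint tsubst (V W : Type) (s : V -> term W) (t : term V) : term W :=
  match t with
  | Var v => s v
  | Zero => Zero
  | One => One
  | Add t1 t2 => Add (tsubst s t1) (tsubst s t2)
  | Mul t1 t2 => Mul (tsubst s t1) (tsubst s t2)
  end.

Definition up_subst (V W : Type) (s : V -> term W) (v : option V) : term (option W) :=
  if v is Some w then tsubst (fun u => Var (Some u)) (s w) else Var None.

Fixpoint fsubst (V : Type) (p : form V) :
    forall W : Type, (V -> term W) -> form W :=
  match p with
  | Equal t1 t2 => fun W s => Equal (tsubst s t1) (tsubst s t2)
  | Less t1 t2 => fun W s => Less (tsubst s t1) (tsubst s t2)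
  | Bot => fun W s => Bot
  | Imp p1 p2 => fun W s => Imp (fsubst p1 s) (fsubst p2 s)
  | All p1 => fun W s => All (fsubst p1 (up_subst s))
  end.

Record structure := Structure {
  carrier :> Type;
  zero : carrier;
  one : carrier;
  add : carrier -> carrier -> carrier;
  mul : carrier -> carrier -> carrier;
  less : carrier -> carrier -> Prop
}.

Arguments zero {s}.
Arguments one {s}.

Fixpoint teval (M : structure) (V : Type) (v : V -> M) (t : term V) : M :=
  match t with
  | Var x => v x
  | Zero => zero
  | One => one
  | Add t1 t2 => add (teval v t1) (teval v t2)
  | Mul t1 t2 => mul (teval v t1) (teval v t2)
  end.

Definition extend (T V : Type) (v : V -> T) (a : T) (x : option V) : T :=
  if x is Some y then v y else a.

Fixpoint holds (M : structure) (V : Type) (p : form V) : (V -> M) -> Prop :=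
  match p with
  | Equal t1 t2 => fun v => teval v t1 = teval v t2
  | Less t1 t2 => fun v => less (teval v t1) (teval v t2)
  | Bot => fun v => False
  | Imp p1 p2 => fun v => holds p1 v -> holds p2 v
  | All p1 => fun v => forall a : M, holds p1 (extend v a)
  end.

Definition Th (M : structure) : set (form void) :=
  [set p | holds p (@of_void M)].

(** * Peano arithmetic *)

(* The axioms are the universal closures of the following formulas. *)
Inductive PA : set (form nat) :=
| PA_succ_neq0 : PA (Neg (Equal (Add (Var 0) One) Zero))
| PA_succ_inj :
    PA (Imp (Equal (Add (Var 0) One) (Add (Var 1) One)) (Equal (Var 0) (Var 1)))
| PA_add0 : PA (Equal (Add (Var 0) Zero) (Var 0))
| PA_addS :
    PA (Equal (Add (Var 0) (Add (Var 1) One)) (Add (Add (Var 0) (Var 1)) One))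
| PA_mul0 : PA (Equal (Mul (Var 0) Zero) Zero)
| PA_mulS :
    PA (Equal (Mul (Var 0) (Add (Var 1) One)) (Add (Mul (Var 0) (Var 1)) (Var 0)))
| PA_lt :
    PA (Iff (Less (Var 0) (Var 1))
            (Ex (Equal (Add (Var (Some 0)) (Add (Var None) One)) (Var (Some 1)))))
| PA_induction (p : form (option nat)) :
    PA (Imp (fsubst p (fun x => if x is Some y then Var y else Zero))
         (Imp (All (Imp p (fsubst p (fun x => if x is Some y then Var (Some y)
                                              else Add (Var None) One))))
              (All p))).

Definition model_of_PA (M : structure) : Prop :=
  forall p, PA p -> forall v : nat -> M, holds p v.

Fixpoint numeral (M : structure) (n : nat) : M :=
  if n is m.+1 then add (numeral M m) one else zero.

(* The standard part of M: the copy of the natural numbers inside M. *)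
Definition standard (M : structure) : set M := range (numeral M).

Fixpoint power (M : structure) (a : M) (n : nat) : M :=
  if n is m.+1 then mul (power a m) a else one.

Definition E4 (N : structure) (a b : N) : Prop :=
  [/\ ~ standard a, ~ standard b &
      exists n : nat, less a (power b n) /\ less b (power a n)].

Definition order_automorphism (N : structure) (f : N -> N) : Prop :=
  bijective f /\ forall x y : N, less x y <-> less (f x) (f y).

Definition E5 (N : structure) (a b : N) : Prop :=
  [/\ ~ standard a, ~ standard b &
      exists2 f : N -> N, order_automorphism f & f a = b].

(** * Cardinals, cofinality and the diamond principle *)

Definition card_lt (T U : Type) (A : set T) (B : set U) : Prop :=
  (A #<= B) /\ ~ (B #<= A).

(* Ordinals are represented by well-ordered types; the elements of such a type
   are the ordinals below it, [below a] being the ordinal a itself. *)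
Definition below d (T : orderType d) (a : T) : set T := [set x | x < a].

Definition is_cardinal d (T : orderType d) : Prop :=
  well_order (<=%O : rel T) /\ forall a : T, card_lt (below a) [set: T].

Definition is_infinite_cardinal d (T : orderType d) : Prop :=
  is_cardinal T /\ infinite_set [set: T].

(* K is the least cardinal greater than L. *)
Definition is_succ_cardinal d (L : orderType d) d' (K : orderType d') : Prop :=
  [/\ is_cardinal K, card_lt [set: L] [set: K] &
      forall a : K, below a #<= [set: L]].

(* The sequences of elements of L whose length is an ordinal below L; their
   number is the cardinal L to the power < L. *)
Definition short_seq d (L : orderType d) : Type :=
  {a : L & {x : L | x < a} -> L}.

Definition cofinal_in d (K : orderType d) (a : K) (C : set K) : Prop :=
  C `<=` below a /\ forall x, x < a -> exists2 c, C c & x <= c.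

(* cf(a) = L, the cofinality being the least cardinality of a cofinal subset. *)
Definition has_cofinality d (K : orderType d) d' (L : orderType d') (a : K) :
    Prop :=
  (exists2 C : set K, cofinal_in a C & C #= [set: L]) /\
  (forall C : set K, cofinal_in a C -> [set: L] #<= C).

Definition club d (K : orderType d) (C : set K) : Prop :=
  (forall x, exists2 c, C c & x < c) /\
  (forall a, below a !=set0 ->
     (forall x, x < a -> exists2 c, C c & x < c < a) -> C a).

Definition stationary d (K : orderType d) (S : set K) : Prop :=
  forall C : set K, club C -> S `&` C !=set0.

Definition diamond d (K : orderType d) (S : set K) : Prop :=
  exists A : K -> set K,
    (forall a, S a -> A a `<=` below a) /\
    forall X : set K, stationary [set a | S a /\ X `&` below a = A a].

(** * Saturation *)

Definition satisfies (N : structure) (A : set N)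
    (p : form (option {x : N | A x})) (b : N) : Prop :=
  holds p (extend (fun a : {x : N | A x} => sval a) b).

(* Sets of formulas in one variable over fewer than L parameters which are
   finitely satisfiable in N are realized in N. *)
Definition saturated d (L : orderType d) (N : structure) : Prop :=
  forall A : set N, card_lt A [set: L] ->
  forall p : set (form (option {x : N | A x})),
    (forall q, q `<=` p -> finite_set q ->
       exists b : N, forall f, q f -> satisfies f b) ->
    exists b : N, forall f, p f -> satisfies f b.

(* Main.v *)
(* Call a cut (A, B) good if for every set d of fewer than lambda elements some
   interval [u, v] with u in A and v in B contains no element definable from d. N is
   the union of an elementary chain of models of cardinality lambda indexed by
   lambda^+, whose steps are ultrapowers restricted to definable functions. Each step
   may add one good cut to a list, and all later steps keep the listed cuts good, so
   that these are filled nowhere in N. The steps realize the types guessed by the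
   diamond, which makes N saturated; the realizations are chosen new, so that the
   interval [0, a) has lambda^+ elements for every nonstandard a.

   If an order automorphism f of N maps b to a and a^n <= b for all n, the diamond
   guesses f restricted to a closed stage c of cofinality lambda. Step c then adds an
   element x inside [0, b), approximated by coded sets that no a^n bounds in size.
   Since f maps [0, b) onto [0, a), the pigeonhole principle makes every relevant
   definable function constant, or at least a, on a smaller such set, and the size of
   [0, a) leaves room to shrink to an interval whose image under f avoids any given
   earlier stage. Hence the image under f of the cut filled by x is good; it is put on
   the list and is never filled, contradicting that f is an automorphism. If a and b
   are not E4-equivalent, this applies to an automorphism or to its inverse. *)

From Stdlib Require List.
From Stdlib Require Import Ring.
From mathcomp Require Import all_boot all_order.
From mathcomp Require Import boolp classical_sets functions cardinality wochoice filter.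
Require Import Defs.

Set Implicit Arguments.
Unset Strict Implicit.
Unset Printing Implicit Defensive.

Local Open Scope classical_set_scope.

(** * Cardinal arithmetic *)

(** Size is measured by standard powers of [a] because every single requirement costs finitely many
    factors of [a]: two for making one function flat, and one more than the number of functions for
    making them avoid an interval. Any finite list of requirements can therefore be met inside a big
    set. Values that are at least [a] may be ignored since the image of the new cut lies below
    [f b = a]; this leaves only [a + 1] values for the pigeonhole. The obstacle is that [f] is not
    definable and that conditions must be shrunk lambda times. Conditions are therefore coded by
    elements, so that a lower bound of fewer than lambda of them realizes a type in the code.
    Saturation is used only in N, and so is the size of [0, a); closure of c brings the witnesses
    back into stage c. This is where cofinality lambda enters: every set of fewer than lambda
    elements of stage c lies in an earlier stage, which is closed off below c. The equation
    lambda^{<lambda} = lambda makes lambda regular and bounds by lambda the number of small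
    parameter sets of a stage, so that one filter of length lambda handles all of them. *)

Definition inj_le (T U : Type) (A : set T) (B : set U) : Prop :=
  exists f : T -> U, (forall x, A x -> B (f x)) /\
    forall x y, A x -> A y -> f x = f y -> x = y.

Lemma inj_leP (T U : Type) (u0 : U) (A : set T) (B : set U) :
  (A #<= B)%card <-> inj_le A B.
Proof.
split=> [/card_leP [f]|[f [fAB fI]]].
- have /injfunPex [g gAB gI] : $|{injfun A >-> B}| by squash (valLR u0 f).
  by exists g; split=> // x y Ax Ay; apply: gI; exact/mem_set.
- have /injfunPex [g] : exists2 f : T -> U, set_fun A B f & set_inj A f.
    by exists f => // x y /set_mem Ax /set_mem Ay; exact: fI.
  exact: inj_card_le.
Qed.

Lemma inj_le_trans (T U V : Type) (A : set T) (B : set U) (C : set V) :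
  inj_le A B -> inj_le B C -> inj_le A C.
Proof.
move=> [f [fAB fI]] [g [gBC gI]]; exists (g \o f); split=> /= [x /fAB/gBC//|].
by move=> x y Ax Ay /gI h; apply: fI => //; apply: h; exact: fAB.
Qed.

Lemma inj_le_sub (T : Type) (A B : set T) : A `<=` B -> inj_le A B.
Proof. by move=> AB; exists id; split. Qed.

Lemma inj_le_surj (T U : Type) (u0 : U) (A : set T) (B : set U) (f : U -> T) :
  (forall x, A x -> exists2 y, B y & f y = x) -> inj_le A B.
Proof.
move=> h; have /choice [g gP] x : exists y, A x -> B y /\ f y = x.
  by case: (pselect (A x)) => [/h [y By fy]|Ax]; [exists y|exists u0].
exists g; split=> [x /gP []//|x y /gP [_ fx] /gP [_ fy] gxy].
by rewrite -fx -fy gxy.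
Qed.

(** * Recursion and collapse in well-ordered types *)

Section WellOrder.
Import Order.TTheory.
Local Open Scope order_scope.
Variables (d : Order.disp_t) (T : orderType d).
Hypothesis wo : well_order (<=%O : rel T).

Lemma wo_least (P : set T) x : P x ->
  exists2 m, P m & forall y, P y -> m <= y.
Proof.
move=> Px.
have [|m [[Pm mle] _]] := wo (A := [pred y | `[< P y >]]).
  by exists x; apply/asboolP.
exists m => [|y Py]; first exact/asboolP.
by apply: mle; apply/asboolP.
Qed.

Lemma wo_wf : well_founded (fun x y : T => x < y).
Proof.
move=> x; apply: contrapT => nx.
have [m nm mle] := wo_least (P := fun y => ~ Acc (fun x y : T => x < y) y) nx.
apply: nm; constructor=> y ym; apply: contrapT => /mle.
by rewrite leNgt ym.
Qed.

(** Well-founded recursion supplies only the values below [a]; they are padded by [s0] to a total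
    function, and the first hypothesis makes [R] insensitive to the padding. *)
Lemma wf_choice (S : Type) (s0 : S) (R : T -> (T -> S) -> S -> Prop) :
  (forall a h h' s, (forall b, b < a -> h b = h' b) -> R a h s -> R a h' s) ->
  (forall a h, (forall b, b < a -> R b h (h b)) -> exists s, R a h s) ->
  exists h, forall a, R a h (h a).
Proof.
move=> ext ex.
pose pick (a : T) (g : T -> S) : S := if pselect (exists s, R a g s) is left e then sval (cid e) else s0.
pose lift (a : T) (rec : forall b : T, b < a -> S) (b : T) :=
  if pselect (b < a) is left p then rec b p else s0.
pose F (a : T) (rec : forall b : T, b < a -> S) := pick a (lift a rec).
pose h := Fix wo_wf (fun=> S) F.
have hE a : h a = pick a (fun b => if pselect (b < a) is left _ then h b else s0).
  have Fe x f g : (forall y (p : y < x), f y p = g y p) -> F x f = F x g.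
    move=> fg; rewrite /F; congr pick; apply: funext => b.
    by rewrite /lift; case: pselect.
  exact: (@Fix_eq _ _ wo_wf (fun=> S) F Fe a).
exists h; apply: (well_founded_ind wo_wf) => a IH.
set g := fun b => if pselect (b < a) is left _ then h b else s0.
have gh b : b < a -> g b = h b by rewrite /g; case: pselect.
have [s Rs] : exists s, R a g s.
  apply: ex => b ba; rewrite gh//; apply: ext (IH b ba) => c cb.
  by rewrite gh// (lt_trans cb).
have : R a g (pick a g).
  by rewrite /pick; case: pselect => [e|[]]; [case: cid|exists s].
by rewrite -hE; apply: ext.
Qed.

Lemma small_image_omits (U : Type) a (f : T -> U) (A : set T) :
  A `<=` below a -> card_lt (below a) [set: T] ->
  forall g : U -> T, exists t, ~ exists2 x, A x & g (f x) = t.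
Proof.
move=> Aa [_ nle] g; apply: contrapT => /forallNP ne; apply: nle.
apply/(inj_leP a); apply: (@inj_le_surj _ _ a _ _ (g \o f)) => t _.
by have /contrapT [x /Aa xa e] := ne t; exists x.
Qed.

Hypothesis card : forall a : T, card_lt (below a) [set: T].

(* The Mostowski collapse of a subset of a cardinal is the whole cardinal or a
   proper initial segment. *)
Lemma collapse (V : set T) :
  inj_le [set: T] V \/ exists a : T, inj_le V (below a).
Proof.
case: (pselect (inj_le [set: T] V)) => nV; [by left|right].
case: (pselect (exists t0 : T, True)) => [[t0 _]|nt]; last first.
  by exfalso; apply: nV; exists id; split=> // x; case: nt; exists x.
have [r rP] : exists r : T -> T, forall x,
    (~ exists2 y, V y /\ y < x & r y = r x) /\
    forall z, z < r x -> exists2 y, V y /\ y < x & r y = z.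
  apply: (wf_choice t0 (R := fun x r s => (~ exists2 y, V y /\ y < x & r y = s) /\
    forall z, z < s -> exists2 y, V y /\ y < x & r y = z)).
    move=> a h h' s hh' [h1 h2]; split=> [[y [Vy ya] e]|z /h2 [y [Vy ya] e]].
      by apply: h1; exists y => //; rewrite hh'.
    by exists y => //; rewrite -hh'.
  move=> a h _.
  have [t tP] := @small_image_omits _ a h (fun y => V y /\ y < a)
    (fun y => @proj2 _ _) (card a) id.
  have [m mP mle] := @wo_least (fun t => ~ exists2 y, V y /\ y < a & h y = t) t tP.
  exists m; split=> // z zm; apply: contrapT => /mle; by rewrite leNgt zm.
have rI x y : V x -> V y -> r x = r y -> x = y.
  move=> Vx Vy rxy; apply/eqP; apply: contrapT => /negP.
  rewrite neq_lt => /orP [xy|yx].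
    by apply: (rP y).1; exists x.
  by apply: (rP x).1; exists y.
have [a aP] : exists a, forall x, V x -> r x <> a.
  apply: contrapT => /forallNP h; apply: nV.
  apply: (@inj_le_surj _ _ t0 _ _ r) => t _; have := h t.
  by move=> /existsNP [x /not_implyP [Vx /contrapT e]]; exists x.
exists a, r; split=> // x Vx; rewrite /below /= ltNge le_eqVlt; apply/negP.
move=> /orP [/eqP e|]; first by case: (aP x).
by move=> /(rP x).2 [y [Vy _] /esym e]; case: (aP y).
Qed.

End WellOrder.

(** * Sets smaller than [L]: regularity and counting *)

Section Small.
Import Order.TTheory.
Local Open Scope order_scope.
Variables (dL : Order.disp_t) (L : orderType dL).

Definition small (T : Type) (d : set T) : Prop := ~ inj_le [set: L] d.

Lemma small_sub (T : Type) (d e : set T) : d `<=` e -> small e -> small d.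
Proof. by move=> de se sd; apply: se; apply: inj_le_trans sd (inj_le_sub de). Qed.

Lemma small_image (T U : Type) (f : T -> U) (d : set T) :
  small d -> small (f @` d).
Proof.
move=> sd [g [gd gI]]; apply: sd.
have /choice [k kP] l : exists t, d t /\ f t = g l.
  by have [t] := gd l I; exists t.
exists k; split=> [x _|x y _ _ kxy]; first by have [] := kP x.
by apply: gI => //; rewrite -(kP x).2 -(kP y).2 kxy.
Qed.

Lemma card_lt_small (T : Type) (d : set T) : card_lt d [set: L] -> small d.
Proof.
move=> [_ h] [g gP]; case: (pselect (exists l : L, True)) => [[l _]|nl].
  by apply: h; apply/(inj_leP (g l)); exists g.
by apply: h; rewrite (_ : [set: L] = set0) ?card_ge0 //; apply/seteqP; split=> // x; case: nl; exists x.
Qed.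

Hypothesis hL : is_infinite_cardinal L.

Lemma small_finite (T : Type) (d : set T) : finite_set d -> small d.
Proof.
move=> fd [g gP]; case: hL => _; apply.
case: (pselect (exists l : L, True)) => [[l _]|nl].
  by apply: (@card_le_finite _ _ _ d) => //; apply/(inj_leP (g l)); exists g.
by rewrite (_ : [set: L] = set0) //; apply/seteqP; split=> // x; case: nl; exists x.
Qed.

Lemma nat_inj_L : exists f : nat -> L, injective f.
Proof.
case: hL => _ /infiniteP.
have [l _] : [set: L] !=set0 by apply: infinite_setN0; case: hL.
by move=> /(inj_leP l) [f [_ fI]]; exists f => x y; exact: fI.
Qed.

(** If [i] were the largest element, sending [i] to the start of a copy of the natural numbers below
    [i] and shifting that copy by one would inject all of [L] into [below i]. *)
Lemma exists_gt (i : L) : exists j, i < j.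
Proof.
apply: contrapT => /forallNP h.
have lei x : x <= i by rewrite leNgt; apply/negP; apply: h.
case: hL => -[_ /(_ i) [_]]; rewrite (inj_leP i) => nle inf; apply: nle.
have ninf : ~ finite_set (below i).
  move=> fi; apply: inf; rewrite (_ : [set: L] = below i `|` [set i]).
    by rewrite finite_setU; split=> //; exact: finite_set1.
  apply/seteqP; split=> // x _; have := lei x; rewrite le_eqVlt => /orP [/eqP->|]; by [right|left].
move/infiniteP: ninf => /(inj_leP i) [n [nb nI]].
have nlt k : n k < i by exact: nb.
pose f x := if pselect (x = i) then n 0 else
  if pselect (exists k, x = n k) is left e then n (sval (cid e)).+1 else x.
exists f; split=> [x _|x y _ _].
  rewrite /f /below /=; case: pselect => [_|xi] /=; first exact: nlt.
  case: pselect => [e|_]; first exact: nlt.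
  by have := lei x; rewrite le_eqVlt => /orP [/eqP/xi|].
have fE1 : f i = n 0 by rewrite /f; case: pselect.
have fE2 k : f (n k) = n k.+1.
  rewrite /f; case: pselect => [e|_] /=; first by have := nlt k; rewrite e ltxx.
  case: pselect => [e|[]]; last by exists k.
  by case: cid => k' /= /nI -> //.
have fE3 z : z <> i -> (forall k, z <> n k) -> f z = z.
  by move=> zi zn; rewrite /f; case: pselect => // _ /=; case: pselect => // e; exfalso; case: e => k /zn.
have cases z : z = i \/ (exists k, z = n k) \/ (z <> i /\ forall k, z <> n k).
  have [|zi] := pselect (z = i); [by left|right].
  have [|zn] := pselect (exists k, z = n k); [by left|right].
  by split=> // k e; apply: zn; exists k.
case: (cases x) => [->|[[k ->]|[xi xn]]]; case: (cases y) => [->|[[k' ->]|[yi yn]]] //;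
  rewrite ?fE1 ?fE2 ?(fE3 x) ?(fE3 y) //.
- by move=> /nI hh; have := hh I I.
- by move=> hh; case: (yn 0).
- by move=> /nI hh; have := hh I I.
- by move=> /nI hh; have [->] := hh I I.
- by move=> hh; case: (yn k.+1).
- by move=> hh; case: (xn 0).
- by move=> hh; case: (xn k'.+1).
Qed.

Hypothesis hpow : ([set: short_seq L] #= [set: L])%card.

Definition seq_value (l0 : L) (t : short_seq L) (j : L) : L :=
  match t with existT a f =>
    if pselect (j < a) is left p then f (exist _ j p) else l0 end.

Lemma short_seq_inj : exists f : short_seq L -> L, injective f.
Proof.
have [n _] := nat_inj_L.
have : ([set: short_seq L] #<= [set: L])%card by have /card_eqPle [] := hpow.
by move=> /(inj_leP (n 0)) [f [_ fI]]; exists f => x y; exact: fI.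
Qed.

(* Regularity of L: an unbounded small set would allow diagonalizing against an
   enumeration of the short sequences in order type L. *)
Lemma small_bounded (V : set L) : small V -> exists b, forall x, V x -> x < b.
Proof.
move=> sV; have [n _] := nat_inj_L; set l0 := n 0.
have [wo card] := hL.1.
have [//|[a [r [ra rI]]]] := collapse wo card V.
apply: contrapT => /forallNP unb.
have unbd i : exists2 x, V x & i < x.
  have [j ij] := exists_gt i; have := unb j => /existsNP [x /not_implyP [Vx xj]].
  by exists x => //; apply: lt_le_trans ij _; rewrite leNgt; exact/negP.
have [f fI] := short_seq_inj.
have /choice [e eP] l : exists t : short_seq L, forall t', f t' = l -> t' = t.
  case: (pselect (exists t, f t = l)) => [[t ft]|nt].
    by exists t => t' ft'; apply: fI; rewrite ft.
  have t0 : short_seq L by exists l0 => _; exact: l0.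
  by exists t0 => t' ft'; case: nt; exists t'.
have /choice [h hP] j : exists x, forall y, V y -> r y = j -> x = y.
  case: (pselect (exists2 y, V y & r y = j)) => [[y Vy ry]|ny].
    by exists y => y' Vy' ry'; apply: rI => //; rewrite ry.
  by exists l0 => y Vy ry; case: ny; exists y.
(* Position [j] belongs to the element [h j] of [V]. The entry [s j] differs from the [j]-th entries
   of all sequences enumerated before [h j]; as [V] is unbounded, the sequence [t] of these entries
   is missed by the enumeration. *)
have /choice [s sP] j : exists t, forall i, i < h j -> seq_value l0 (e i) j <> t.
  have [t tP] := @small_image_omits _ L (short_seq L) (h j) e (below (h j))
    (fun x => id) (card (h j)) (fun t => seq_value l0 t j).
  by exists t => i ih et; apply: tP; exists i.
pose t : short_seq L := existT _ a (fun x => s (sval x)).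
have [x Vx ltx] := unbd (f t).
apply: (sP (r x) (f t)); first by rewrite (hP _ _ Vx erefl).
rewrite -(eP (f t) t erefl) /=; case: pselect => // nra.
by case: nra; exact: ra.
Qed.

(** If [g] injected [L] into the union, the preimage of each [U j] would be bounded by some [B j],
    and the bounds themselves by some [c]; but [g c] lies in one of the [U j]. *)
Lemma small_bigcup (X T : Type) (J : set X) (U : X -> set T) :
  small J -> (forall j, J j -> small (U j)) ->
  small (fun x => exists2 j, J j & U j x).
Proof.
move=> sJ sU [g [gU gI]].
have b j : exists b, J j -> forall l : L, U j (g l) -> l < b.
  case: (pselect (J j)) => [Jj|nJ]; last by have [n _] := nat_inj_L; exists (n 0).
  have [|b bP] := @small_bounded (fun l => U j (g l)); last by exists b.
  move=> [k [kU kI]]; apply: (sU j Jj); exists (g \o k).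
  split=> [x _ /=|x y _ _ /gI h]; first exact: kU.
  by apply: kI => //; exact: h.
have [B BP] := choice b.
have [c cP] := @small_bounded (B @` J) (small_image sJ).
have [j Jj Uj] := gU c I.
have := cP (B j) (ex_intro2 _ _ j Jj erefl); rewrite ltNge => /negP; apply.
by apply: ltW; apply: BP.
Qed.

Lemma small_setU (T : Type) (d e : set T) : small d -> small e -> small (d `|` e).
Proof.
move=> sd se.
apply: (@small_sub _ _ (fun x => exists2 b : bool, [set: bool] b & (if b then d else e) x)).
  by move=> x [dx|ex]; [exists true|exists false].
apply: small_bigcup => [|[] _ //]; apply: small_finite.
exact: finite_finset.
Qed.

Lemma small_set1 (T : Type) (x : T) : small [set x].
Proof. exact/small_finite/finite_set1. Qed.

Lemma small_set0 (T : Type) : small (@set0 T).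
Proof. exact/small_finite/finite_set0. Qed.

(* Finite subsets of a finite set d have the single upper bound d, so that
   this also holds when L is countable. *)
Lemma small_finite_cofinal (T : Type) (d : set T) : small d ->
  exists S : set (set T), [/\ small S,
    (forall s, S s -> finite_set s /\ s `<=` d) &
    forall l : seq T, (forall x, List.In x l -> d x) ->
      exists2 s, S s & forall x, List.In x l -> s x].
Proof.
move=> sd; have [fd|infd] := pselect (finite_set d).
  exists [set d]; split; first exact: small_set1.
    by move=> s ->; split.
  by move=> l ld; exists d.
have [[x0 dx0]|nd] := pselect (exists x, d x); last first.
  by exfalso; apply: infd; rewrite (_ : d = set0) //;
     apply/seteqP; split=> // x dx; case: nd; exists x.
move/infiniteP: infd => /(inj_leP x0) [n [nd nI]].
have snat : small [set: nat].
  move=> [k [_ kI]]; apply: sd; exists (n \o k); split=> [l _|x y _ _ /nI h].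
    exact: nd.
  by apply: kI => //; exact: h.
pose Sn k := [set l : seq T | size l = k /\ forall x, List.In x l -> d x].
have sSn k : small (Sn k).
  elim: k => [|k IH].
    apply: (@small_sub _ _ [set [::]]); last exact: small_set1.
    by move=> [|x l] //= [].
  apply: (@small_sub _ _ (fun l => exists2 x, d x & ((cons x) @` Sn k) l)).
    move=> [|x l] [] //= [sl] ld; exists x; first by apply: ld; left.
    by exists l => //; split=> // y yl; apply: ld; right.
  by apply: small_bigcup => // x dx; exact: small_image.
exists ((fun l => (fun x => List.In x l)) @` (fun l => exists2 k, [set: nat] k & Sn k l)).
split.
- by apply: small_image; apply: small_bigcup.
- move=> _ [l [k _ [_ ld]] <-]; split=> //.
  elim: l {ld} => [|x l IH].
    by rewrite (_ : (fun _ => _) = set0) //; apply/seteqP; split.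
  rewrite (_ : (fun _ => _) = [set x] `|` (fun y => List.In y l)).
    by rewrite finite_setU; split=> //; exact: finite_set1.
  by apply/seteqP; split=> y /= [->|h]; [left|right|left|right].
- by move=> l ld; eexists; first by exists l; [exists (size l)|reflexivity].
Qed.

(** A pair is coded by a sequence of length [c2] whose entries at [c0] and [c1] are its components;
    there are only [|L|] short sequences. *)
Lemma L_pairing : exists p : L -> L -> L, forall x y x' y',
  p x y = p x' y' -> x = x' /\ y = y'.
Proof.
have [n _] := nat_inj_L; set c0 := n 0.
have [c1 c01] := exists_gt c0; have [c2 c12] := exists_gt c1.
have [f fI] := short_seq_inj.
pose t x y : short_seq L := existT _ c2 (fun j => if sval j == c0 then x else y).
exists (fun x y => f (t x y)) => x y x' y' /fI h.
have h0 := congr1 (seq_value c0 ^~ c0) h.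
have h1 := congr1 (seq_value c0 ^~ c1) h.
move: h0 h1; rewrite /= ; case: pselect => [p|[]]; last exact: lt_trans c12.
case: pselect => [q|[]]; last by [].
by rewrite /= eqxx (gt_eqF c01).
Qed.

(** The collapse [r] turns a small set into a sequence of length [a]. Gaps read [p (n 0) (n 0)],
    which is also the default beyond the length, and elements carry the tag [n 1], so the set can be
    read off its sequence. *)
Lemma small_sets_le (T : Type) (S : set T) : inj_le S [set: L] ->
  inj_le [set d : set T | small d /\ d `<=` S] [set: L].
Proof.
move=> [i [_ iI]]; have [p pI] := L_pairing; have [f fI] := short_seq_inj.
have [wo card] := hL.1; have [n nI] := nat_inj_L.
have n01 : n 0%N <> n 1%N by move=> /nI.
have key d : exists t : short_seq L, small d /\ d `<=` S -> forall x, S x ->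
    (d x <-> exists j, seq_value (p (n 0) (n 0)) t j = p (n 1) (i x)).
  case: (pselect (small d /\ d `<=` S)) => [[sd dS]|nd]; last first.
    by exists (existT _ (n 0) (fun=> n 0)).
  have [|[a [r [ra rI]]]] := collapse wo card (i @` d).
    by move=> /(small_image sd).
  pose t : short_seq L := existT _ a (fun j =>
    if pselect (exists2 x, d x & r (i x) = sval j) is left e
    then p (n 1) (i (sval (cid2 e))) else p (n 0) (n 0)).
  exists t => _ x Sx; split=> [dx|[j]] /=.
    exists (r (i x)); case: pselect => [ax|[]]; last by apply: ra; exists x.
    case: pselect => [e|[]]; last by exists x.
    case: cid2 => y /= dy h; congr p; apply: rI => //; by eexists; eauto.
  case: pselect => [ja|_ /pI [] //]; case: pselect => [e|_ /pI []//].
  case: cid2 => y /= dy _ /pI [_] /iI e'.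
  by rewrite -e' //; exact: dS.
have [t tP] := choice key.
exists (f \o t); split=> // d e [sd dS] [se eS] /fI tde; apply/seteqP; split=> x.
  by move=> dx; apply/(tP e (conj se eS) x (dS _ dx)); rewrite -tde; apply/(tP d (conj sd dS)) => //; exact: dS.
by move=> ex; apply/(tP d (conj sd dS) x (eS _ ex)); rewrite tde; apply/(tP e (conj se eS)) => //; exact: eS.
Qed.

Lemma inj_le_setX (T U : Type) (A : set T) (B : set U) :
  inj_le A [set: L] -> inj_le B [set: L] ->
  inj_le [set x : T * U | A x.1 /\ B x.2] [set: L].
Proof.
move=> [f [_ fI]] [g [_ gI]]; have [p pI] := L_pairing.
exists (fun x => p (f x.1) (g x.2)); split=> // -[x y] [x' y'] /= [Ax By] [Ax' By'].
by move=> /pI [/fI-> // /gI->].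
Qed.

Lemma inj_le_bigcup (X T : Type) (J : set X) (U : X -> set T) :
  inj_le J [set: L] -> (forall j, J j -> inj_le (U j) [set: L]) ->
  inj_le (fun x => exists2 j, J j & U j x) [set: L].
Proof.
move=> [f [_ fI]] h; have [p pI] := L_pairing; have [n _] := nat_inj_L.
case: (pselect (exists j, J j)) => [[j0 Jj0]|nJ]; last first.
  by exists (fun=> n 0); split=> // x y [j Jj]; case: nJ; exists j.
have /choice [g gP] j : exists g : T -> L, J j -> forall x y, U j x -> U j y -> g x = g y -> x = y.
  case: (pselect (J j)) => [/h [g [_ gI]]|nJ]; first by exists g.
  by exists (fun=> n 0).
have /choice [k kP] x : exists j, (exists2 j, J j & U j x) -> J j /\ U j x.
  case: (pselect (exists2 j, J j & U j x)) => [[j Jj Ux]|ne]; first by exists j.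
  by exists j0.
exists (fun x => p (f (k x)) (g (k x) x)); split=> // x y /kP [Jx Ux] /kP [Jy Uy].
move=> /pI [/fI e]; rewrite e // => /(gP _ Jy); apply => //.
by rewrite -e.
Qed.

Lemma inj_le_enum (T : Type) (S : set T) x0 : S x0 -> inj_le S [set: L] ->
  exists E : L -> T, (forall i, S (E i)) /\ forall x, S x -> exists i, E i = x.
Proof.
move=> Sx0 [f [_ fI]].
have /choice [E EP] i : exists x, S x /\ forall y, S y -> f y = i -> x = y.
  case: (pselect (exists2 y, S y & f y = i)) => [[y Sy fy]|ny].
    by exists y; split=> // z Sz fz; apply: fI => //; rewrite fy.
  by exists x0; split=> // y Sy fy; case: ny; exists y.
exists E; split=> [i|x Sx]; first by have [] := EP i.
by exists (f x); apply: (EP (f x)).2.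
Qed.

End Small.

(** * Arithmetic of the successor cardinal [K] *)

Section Successor.
Import Order.TTheory.
Local Open Scope order_scope.
Variables (dL : Order.disp_t) (L : orderType dL).
Variables (dK : Order.disp_t) (K : orderType dK).
Hypothesis hL : is_infinite_cardinal L.
Hypothesis hpow : ([set: short_seq L] #= [set: L])%card.
Hypothesis hK : is_succ_cardinal L K.

Lemma below_le (a : K) : inj_le (below a) [set: L].
Proof.
have [n _] := nat_inj_L hL; have [_ _ h] := hK.
by apply/(inj_leP (n 0)); exact: h.
Qed.

Lemma L_inj_K : exists f : L -> K, injective f.
Proof.
have [_ [le nle] _] := hK; have [n _] := nat_inj_L hL.
have [[k _]|nk] := pselect (exists k : K, True).
  by move/(inj_leP k): le => [f [_ fI]]; exists f => x y; exact: fI.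
exfalso; apply: nle; apply/(inj_leP (n 0)); exists (fun=> n 0).
by split=> // x; case: nk; exists x.
Qed.

Lemma K_not_le : ~ inj_le [set: K] [set: L].
Proof.
have [_ [_ nle] _] := hK; have [n _] := nat_inj_L hL.
by rewrite -(inj_leP (n 0)).
Qed.

(** Regularity of a successor cardinal: otherwise [K] would be the union of the closed initial
    segments up to [w x], which are at most [|L|] sets with at most [|L|] elements each. *)
Lemma K_bound (X : Type) (S : set X) (w : X -> K) : inj_le S [set: L] ->
  exists c, forall x, S x -> w x < c.
Proof.
move=> leS; apply: contrapT => /forallNP unb; apply: K_not_le.
apply: (@inj_le_trans _ _ _ _ (fun y => exists2 x, S x & (below (w x) `|` [set w x]) y)).
  apply: inj_le_sub => y _; have := unb y => /existsNP [x /not_implyP [Sx /negP]].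
  by rewrite -leNgt le_eqVlt => /orP [/eqP ->|h]; exists x => //; [right|left].
apply: (inj_le_bigcup hL hpow leS) => x _.
have [f [_ fI]] := below_le (w x); have [n nI] := nat_inj_L hL.
have [p pI] := L_pairing hL hpow.
exists (fun y => if pselect (y < w x) is left _ then p (n 1) (f y) else p (n 0) (n 0)).
split=> // y z By Bz; case: pselect => yx; case: pselect => zx.
- by move=> /pI [_ /fI]; apply.
- by move=> /pI [/nI].
- by move=> /pI [/nI].
- by case: By => // ->; case: Bz => // ->.
Qed.

(** This leaves room in [K] for the new elements of the next model. If the complement of [U]
    collapsed to a proper initial segment, both halves of [K] would have at most [|L|] elements. *)
Lemma K_compl (U : set K) : inj_le U [set: L] ->
  exists g : L -> K, injective g /\ forall l, ~ U (g l).
Proof.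
move=> [f [_ fI]]; have [[wo card] _ _] := hK.
have [[g [gU gI]]|[a [r [ra rI]]]] := collapse wo card (~` U).
  have [i iI] := L_inj_K; exists (g \o i); split=> [x y /gI h|l].
    by apply: iI; exact: h.
  exact: gU.
exfalso; apply: K_not_le.
have [k [_ kI]] := below_le a; have [n nI] := nat_inj_L hL.
have [p pI] := L_pairing hL hpow.
exists (fun y => if pselect (U y) is left _ then p (n 0) (f y) else p (n 1) (k (r y))).
split=> // x y _ _; case: pselect => Ux; case: pselect => Uy.
- by move=> /pI [_ /fI]; apply.
- by move=> /pI [/nI].
- by move=> /pI [/nI].
- by move=> /pI [_ /kI h]; apply: rI => //; apply: h; exact: ra.
Qed.

(** Each [a] receives its own block [G a] of [|L|] elements, disjoint from the earlier blocks. A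
    pair goes into the block of some [m] above both components, where pairs from [below m] are coded
    by [L_pairing]. *)
Lemma K_pairing : exists p : K -> K -> K, forall x y x' y',
  p x y = p x' y' -> x = x' /\ y = y'.
Proof.
have [[wo card] _ _] := hK; have [i iI] := L_inj_K; have [p pI] := L_pairing hL hpow.
have [n nI] := nat_inj_L hL.
have [G GP] : exists G : K -> L -> K, forall a,
    injective (G a) /\ forall b l l', b < a -> G a l <> G b l'.
  apply: (wf_choice wo i (R := fun a (h : K -> L -> K) g =>
    injective g /\ forall b l l', b < a -> g l <> h b l')).
    by move=> a h h' s hh' [sI sd]; split=> // b l l' ba; rewrite -hh' //; exact: sd.
  move=> a h _.
  have [|g [gI gU]] := @K_compl (fun x => exists2 b, below a b & (h b @` setT) x).
    apply: (inj_le_bigcup hL hpow (below_le a)) => b _.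
    apply: (@inj_le_surj _ _ (n 0) _ _ (h b)) => x [l _ <-]; by exists l.
  exists g; split=> // b l l' ba e; apply: (gU l); exists b => //.
  by exists l'.
have GI a b l l' : G a l = G b l' -> a = b /\ l = l'.
  move=> e; have [ab|ba|ab] := ltgtP a b.
  - by case: ((GP b).2 a l' l ab).
  - by case: ((GP a).2 b l l' ba).
  - by split=> //; apply: (GP a).1; rewrite e ab.
have /choice [m mP] (xy : K * K) : exists m, xy.1 < m /\ xy.2 < m.
  have [|c cP] := @K_bound bool setT (fun b => if b then xy.1 else xy.2).
    exists (fun b : bool => n b); split=> // -[] [] _ _ // /nI //.
  by exists c; split; [exact: (cP true)|exact: (cP false)].
have /choice [k kP] a : exists k : K -> L, forall x y, x < a -> y < a -> k x = k y -> x = y.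
  by have [k [_ kI]] := below_le a; exists k.
exists (fun x y => G (m (x, y)) (p (k (m (x, y)) x) (k (m (x, y)) y))).
move=> x y x' y' /GI [em /pI]; rewrite -em => -[e1 e2].
have [xm ym] := mP (x, y); have [x'm y'm] := mP (x', y').
rewrite -em /= in x'm y'm; rewrite /= in xm ym.
by split; apply: (kP (m (x, y))).
Qed.

(** For unboundedness, iterate from [x] a function [s] with [B b < s a] for all [b <= a]; the least
    upper bound of the countably many iterates is a closure point. *)
Lemma club_closed (B : K -> K) : club [set a | forall b, b < a -> B b < a].
Proof.
have [[wo card] _ _] := hK; have [n nI] := nat_inj_L hL; split; last first.
  move=> a _ h b ba; have [c cB /andP [bc ca]] := h b ba.
  exact: lt_trans (cB b bc) ca.
move=> x.
have /choice [s sP] (a : K) : exists c, a < c /\ forall b, b <= a -> B b < c.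
  have leA : inj_le (below a `|` [set a]) [set: L].
    apply: (@inj_le_trans _ _ _ _ (fun y => exists2 b : bool, setT b & (if b then below a else [set a]) y)).
      by apply: inj_le_sub => y [h|->]; [exists true|exists false].
    apply: (inj_le_bigcup hL hpow).
      by exists (fun b : bool => n b); split=> // -[] [] _ _ // /nI //.
    by move=> [] _; [exact: below_le|exists (fun=> n 0); split=> // y z -> ->].
  have [c cP] := K_bound (fun b => Order.max a (B b)) leA.
  exists c; split=> [|b]; first by have := cP a (or_intror erefl); rewrite gt_max => /andP [].
  rewrite le_eqVlt => /orP [/eqP->|ba].
    by have := cP a (or_intror erefl); rewrite gt_max => /andP [].
  by have := cP b (or_introl ba); rewrite gt_max => /andP [].
pose g k := iter k s x.
have [|c cP] := @K_bound nat setT g; first by exists n; split=> // ? ? _ _ /nI.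
have [m mP mle] := @wo_least _ _ wo (fun c => forall k, g k < c) c (fun k => cP k I).
exists m; last exact: (mP 0).
move=> b bm; have [k gk] : exists k, b <= g k.
  apply: contrapT => /forallNP h; have : m <= b.
    by apply: mle => k; rewrite ltNge; apply/negP; exact: h.
  by rewrite leNgt bm.
by apply: lt_trans (mP k.+1); apply: (sP (g k)).2.
Qed.

End Successor.

(** * Injective codes for formulas *)

Section FormulaCode.
Variables (X : Type) (pr : X -> X -> X) (tg : nat -> X).
Hypothesis prI : forall x y x' y', pr x y = pr x' y' -> x = x' /\ y = y'.
Hypothesis tgI : injective tg.

Fixpoint term_code (V : Type) (c : V -> X) (t : term V) : X :=
  match t with
  | Var v => pr (tg 0) (c v)
  | Zero => pr (tg 1) (tg 0)
  | One => pr (tg 2) (tg 0)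
  | Add t1 t2 => pr (tg 3) (pr (term_code c t1) (term_code c t2))
  | Mul t1 t2 => pr (tg 4) (pr (term_code c t1) (term_code c t2))
  end.

Definition option_code (V : Type) (c : V -> X) (v : option V) : X :=
  if v is Some w then pr (tg 1) (c w) else pr (tg 0) (tg 0).

Fixpoint form_code (V : Type) (p : form V) : (V -> X) -> X :=
  match p with
  | Equal t1 t2 => fun c => pr (tg 0) (pr (term_code c t1) (term_code c t2))
  | Less t1 t2 => fun c => pr (tg 1) (pr (term_code c t1) (term_code c t2))
  | Bot => fun c => pr (tg 2) (tg 0)
  | Imp p1 p2 => fun c => pr (tg 3) (pr (form_code p1 c) (form_code p2 c))
  | All p1 => fun c => pr (tg 4) (form_code p1 (option_code c))
  end.

Lemma term_code_inj (V : Type) (c : V -> X) : injective c -> injective (term_code c).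
Proof.
move=> cI; elim=> [v|||t1 IH1 t2 IH2|t1 IH1 t2 IH2] [w|||u1 u2|u1 u2] //= /prI [/tgI //= _].
- by move=> /cI ->.
- by move=> /prI [/IH1 -> /IH2 ->].
- by move=> /prI [/IH1 -> /IH2 ->].
Qed.

Lemma option_code_inj (V : Type) (c : V -> X) : injective c -> injective (option_code c).
Proof. by move=> cI [v|] [w|] //= /prI [/tgI //= _ /cI ->]. Qed.

Lemma form_code_inj (V : Type) (c : V -> X) : injective c ->
  injective (fun p => form_code p c).
Proof.
move=> cI p; elim: p c cI => {V} V => [t1 t2|t1 t2||p1 IH1 p2 IH2|p1 IH1] c cI
  [u1 u2|u1 u2||q1 q2|q1] //= /prI [/tgI //= _].
- by move=> /prI [/(term_code_inj cI) -> /(term_code_inj cI) ->].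
- by move=> /prI [/(term_code_inj cI) -> /(term_code_inj cI) ->].
- by move=> /prI [/(IH1 _ cI) -> /(IH2 _ cI) ->].
- by move=> /(IH1 _ (option_code_inj cI)) ->.
Qed.

End FormulaCode.

Lemma finite_list (T : Type) (A : set T) : finite_set A ->
  exists l : seq T, forall x, A x -> List.In x l.
Proof.
move=> fA; have /(@finite_seqP {classic T}) [l AE] : finite_set (A : set {classic T}) by [].
exists l => x; rewrite AE /=; elim: (l) => //= y s IH.
by rewrite in_cons => /orP [/eqP ->|/IH]; [left|right].
Qed.

Lemma In_finite (T : Type) (l : seq T) : finite_set (fun x => List.In x l).
Proof.
elim: l => [|x l IH].
  by rewrite (_ : (fun _ => _) = set0) //; apply/seteqP; split.
rewrite (_ : (fun _ => _) = [set x] `|` (fun y => List.In y l)).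
  by rewrite finite_setU; split=> //; exact: finite_set1.
by apply/seteqP; split=> y /= [->|h]; [left|right|left|right].
Qed.

(** * Definable relations *)

Lemma teval_tsubst (M : structure) (V W : Type) (s : V -> term W) (v : W -> M) t :
  teval v (tsubst s t) = teval (fun x => teval v (s x)) t.
Proof. by elim: t => //= t1 -> t2 ->. Qed.

Lemma holds_fsubst (M : structure) (V : Type) (p : form V) : forall (W : Type)
  (s : V -> term W) (v : W -> M),
  holds (fsubst p s) v <-> holds p (fun x => teval v (s x)).
Proof.
elim: p => {V} V => [t1 t2|t1 t2||p1 IH1 p2 IH2|p1 IH1] W s v /=.
- by rewrite !teval_tsubst.
- by rewrite !teval_tsubst.
- by [].
- by rewrite IH1 IH2.
- have e a : (fun x => teval (extend v a) (up_subst s x)) =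
             extend (fun x => teval v (s x)) a.
    apply: funext => -[x|//] /=; by rewrite teval_tsubst.
  by split=> h a; have := h a; rewrite IH1 e.
Qed.

Definition frename (V W : Type) (r : V -> W) (p : form V) : form W :=
  fsubst p (fun x => Var (r x)).

Lemma holds_frename (M : structure) (V W : Type) (r : V -> W) (p : form V) (v : W -> M) :
  holds (frename r p) v <-> holds p (v \o r).
Proof. exact: holds_fsubst. Qed.

Fixpoint term_vars (V : Type) (t : term V) : seq V :=
  match t with
  | Var v => [:: v]
  | Zero | One => [::]
  | Add t1 t2 | Mul t1 t2 => term_vars t1 ++ term_vars t2
  end.

Fixpoint form_vars (V : Type) (p : form V) : seq V :=
  match p with
  | Equal t1 t2 | Less t1 t2 => term_vars t1 ++ term_vars t2
  | Bot => [::]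
  | Imp p1 p2 => form_vars p1 ++ form_vars p2
  | All p1 => pmap id (form_vars p1)
  end.

Lemma In_cat (T : Type) (x : T) s t : List.In x (s ++ t) <-> List.In x s \/ List.In x t.
Proof. by elim: s => [|y s IH] /=; [split=> [|[]]; auto|rewrite IH; tauto]. Qed.

Lemma In_pmap (T : Type) (x : T) s : List.In (Some x) s -> List.In x (pmap id s).
Proof.
by elim: s => [//|[y|] s IH] /= [] //; [case=> ->; left|move=> /IH; right].
Qed.

Lemma teval_vars (M : structure) (V : Type) (t : term V) (v w : V -> M) :
  (forall x, List.In x (term_vars t) -> v x = w x) -> teval v t = teval w t.
Proof.
elim: t => [x|||t1 IH1 t2 IH2|t1 IH1 t2 IH2] //= h; first by apply: h; left.
all: by rewrite IH1 ?IH2 // => x xs; apply: h; rewrite In_cat; auto.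
Qed.

Lemma holds_vars (M : structure) (V : Type) (p : form V) : forall (v w : V -> M),
  (forall x, List.In x (form_vars p) -> v x = w x) -> holds p v <-> holds p w.
Proof.
elim: p => {V} V => [t1 t2|t1 t2||p1 IH1 p2 IH2|p1 IH1] v w //= h.
- by rewrite (@teval_vars _ _ t1 v w) ?(@teval_vars _ _ t2 v w) // => x xs; apply: h; rewrite In_cat; auto.
- by rewrite (@teval_vars _ _ t1 v w) ?(@teval_vars _ _ t2 v w) // => x xs; apply: h; rewrite In_cat; auto.
- by rewrite (IH1 v w) ?(IH2 v w) // => x xs; apply: h; rewrite In_cat; auto.
- split=> H a; [apply/(IH1 (extend v a) (extend w a))|apply/(IH1 (extend v a) (extend w a))] => //.
    by case=> [x|//] xs /=; apply: h; exact: In_pmap.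
  by case=> [x|//] xs /=; apply: h; exact: In_pmap.
Qed.

Section Definable.
Variable M : structure.
Implicit Types (d : set M) (P Q : (nat -> M) -> Prop) (r : nat -> M) (g h : (nat -> M) -> M).

Definition assign d r (x : nat + {x : M | d x}) : M :=
  match x with inl n => r n | inr p => sval p end.

(* P is a relation in finitely many of the variables r 0, r 1, ... definable
   with parameters from d. *)
Definition Def d P : Prop :=
  exists p : form (nat + {x : M | d x}), forall r, P r <-> holds p (@assign d r).

Definition shift r : nat -> M := fun n => r n.+1.

Lemma def_ext d P Q : (forall r, P r <-> Q r) -> Def d P -> Def d Q.
Proof. by move=> PQ [p pP]; exists p => r; rewrite -PQ. Qed.

Lemma def_bot d : Def d (fun=> False). Proof. by exists Bot. Qed.

Lemma def_imp d P Q : Def d P -> Def d Q -> Def d (fun r => P r -> Q r).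
Proof. by move=> [p pP] [q qP]; exists (Imp p q) => r /=; rewrite pP qP. Qed.

Lemma def_not d P : Def d P -> Def d (fun r => ~ P r).
Proof. by move=> dP; apply: def_imp => //; exact: def_bot. Qed.

Lemma def_and d P Q : Def d P -> Def d Q -> Def d (fun r => P r /\ Q r).
Proof.
move=> dP dQ; apply: (@def_ext _ (fun r => ~ (P r -> ~ Q r))).
  by move=> r; split=> [/not_implyP [? /contrapT]|[Pr Qr] h]; [|apply: h].
by apply: def_not; apply: def_imp => //; exact: def_not.
Qed.

Lemma def_or d P Q : Def d P -> Def d Q -> Def d (fun r => P r \/ Q r).
Proof.
move=> dP dQ; apply: (@def_ext _ (fun r => ~ P r -> Q r)).
  move=> r; split=> [h|[] //]; by case: (pselect (P r)) => [|/h]; auto.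
by apply: def_imp => //; exact: def_not.
Qed.

Lemma def_iff d P Q : Def d P -> Def d Q -> Def d (fun r => P r <-> Q r).
Proof. by move=> dP dQ; apply: def_and; apply: def_imp. Qed.

Lemma def_true d : Def d (fun=> True).
Proof. by apply: (@def_ext _ (fun=> False -> False)) => //; apply: def_imp; exact: def_bot. Qed.

Lemma def_rename d (s : nat -> nat) P : Def d P -> Def d (fun r => P (r \o s)).
Proof.
move=> [p pP].
exists (frename (fun x => match x with inl n => inl (s n) | inr a => inr a end) p) => r.
rewrite pP holds_frename; apply: holds_vars.
by case.
Qed.

Lemma def_sub d e P : d `<=` e -> Def d P -> Def e P.
Proof.
move=> de [p pP].
exists (frename (fun x => match x with inl n => inl n
  | inr a => inr (exist _ (sval a) (de _ (proj2_sig a))) end) p) => r.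
by rewrite pP holds_frename; apply: holds_vars; case.
Qed.

Lemma def_all d (P : M -> (nat -> M) -> Prop) :
  Def d (fun r => P (r 0) (shift r)) -> Def d (fun r => forall a, P a r).
Proof.
move=> [p pP].
exists (All (frename (fun x => match x with inl 0 => None | inl n.+1 => Some (inl n)
  | inr a => Some (inr a) end) p)) => r /=.
have e a : P a r <-> holds p (@assign d (fun n => if n is m.+1 then r m else a)).
  by rewrite -pP.
split=> h a; first have := (e a).1 (h a); last apply/e; last have := h a;
  rewrite holds_frename => H; apply/(holds_vars _).1: H; by case=> [[|n]|].
Qed.

Lemma def_ex d (P : M -> (nat -> M) -> Prop) :
  Def d (fun r => P (r 0) (shift r)) -> Def d (fun r => exists a, P a r).
Proof.
move=> dP; apply: (@def_ext _ (fun r => ~ forall a, ~ P a r)).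
  by move=> r; split=> [/existsNP [a /contrapT]|[a Pa] h]; [exists a|apply: (h a)].
by apply: def_not; apply: def_all; exact: def_not.
Qed.

Definition Dfun d g : Prop := Def d (fun r => r 0 = g (shift r)).

Lemma dfun_sub d e g : d `<=` e -> Dfun d g -> Dfun e g.
Proof. exact: def_sub. Qed.

Lemma dfun_var d n : Dfun d (fun r => r n).
Proof. by exists (Equal (Var (inl 0)) (Var (inl n.+1))). Qed.

Lemma dfun_cst d c : d c -> Dfun d (fun=> c).
Proof. by move=> dc; exists (Equal (Var (inl 0)) (Var (inr (exist _ c dc)))). Qed.

Lemma dfun_zero d : Dfun d (fun=> zero).
Proof. by exists (Equal (Var (inl 0)) Zero). Qed.

Lemma dfun_one d : Dfun d (fun=> one).
Proof. by exists (Equal (Var (inl 0)) One). Qed.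

Lemma def_app1 d (P : M -> (nat -> M) -> Prop) g :
  Def d (fun r => P (r 0) (shift r)) -> Dfun d g -> Def d (fun r => P (g r) r).
Proof.
move=> dP dg; apply: (@def_ext _ (fun r => exists a, a = g r /\ P a r)).
  by move=> r; split=> [[_ [->]]|h] //; exists (g r).
by apply: def_ex; apply: def_and.
Qed.

Lemma dfun_rename d (s : nat -> nat) g : Dfun d g -> Dfun d (fun r => g (r \o s)).
Proof. exact: (@def_rename d (fun n => if n is m.+1 then (s m).+1 else 0)). Qed.

Lemma def_fam d (P : M -> (nat -> M) -> Prop) (s : nat -> nat) g :
  Def d (fun r => P (r 0) (shift r)) -> Dfun d g ->
  Def d (fun r => P (g r) (fun n => r (s n))).
Proof.
move=> dP dg; apply: (@def_app1 _ (fun a r => P a (fun n => r (s n)))) => //.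
exact: (@def_rename d (fun n => if n is m.+1 then (s m).+1 else 0) _ dP).
Qed.

Lemma def_app2 d (R : M -> M -> Prop) g h : Def d (fun r => R (r 0) (r 1)) ->
  Dfun d g -> Dfun d h -> Def d (fun r => R (g r) (h r)).
Proof.
move=> dR dg dh; apply: (@def_app1 _ (fun a r => R a (h r))) => //.
apply: (@def_app1 _ (fun b r => R (r 0) b) (fun r => h (shift r))).
  exact: (@def_rename d (fun n => if n is 0 then 1 else 0) _ dR).
exact: (@dfun_rename d succn).
Qed.

Lemma def_app3 d (R : M -> M -> M -> Prop) g h k :
  Def d (fun r => R (r 0) (r 1) (r 2)) ->
  Dfun d g -> Dfun d h -> Dfun d k -> Def d (fun r => R (g r) (h r) (k r)).
Proof.
move=> dR dg dh dk; apply: (@def_app1 _ (fun a r => R a (h r) (k r))) => //.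
apply: (@def_app1 _ (fun b r => R (r 0) b (k (shift r))) (fun r => h (shift r))).
  apply: (@def_app1 _ (fun c r => R (r 1) (r 0) c) (fun r => k (fun n => r n.+2))).
    exact: (@def_rename d (fun n => 2 - n) _ dR).
  exact: (@dfun_rename d (fun n => n.+2)).
exact: (@dfun_rename d succn).
Qed.

Lemma def_eq d g h : Dfun d g -> Dfun d h -> Def d (fun r => g r = h r).
Proof. by apply: (@def_app2 d eq); exists (Equal (Var (inl 0)) (Var (inl 1))). Qed.

Lemma def_less d g h : Dfun d g -> Dfun d h -> Def d (fun r => less (g r) (h r)).
Proof. by apply: (@def_app2 d (@less M)); exists (Less (Var (inl 0)) (Var (inl 1))). Qed.

Lemma dfun_add d g h : Dfun d g -> Dfun d h -> Dfun d (fun r => add (g r) (h r)).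
Proof.
move=> dg dh; apply: (@def_app3 d (fun a b c => a = add b c) (fun r => r 0)).
- by exists (Equal (Var (inl 0)) (Add (Var (inl 1)) (Var (inl 2)))).
- exact: dfun_var.
- exact: (@dfun_rename d succn).
- exact: (@dfun_rename d succn).
Qed.

Lemma dfun_mul d g h : Dfun d g -> Dfun d h -> Dfun d (fun r => mul (g r) (h r)).
Proof.
move=> dg dh; apply: (@def_app3 d (fun a b c => a = mul b c) (fun r => r 0)).
- by exists (Equal (Var (inl 0)) (Mul (Var (inl 1)) (Var (inl 2)))).
- exact: dfun_var.
- exact: (@dfun_rename d succn).
- exact: (@dfun_rename d succn).
Qed.

Lemma dfun_comp d (F : M -> (nat -> M) -> M) g :
  Dfun d (fun r => F (r 0) (shift r)) -> Dfun d g -> Dfun d (fun r => F (g r) r).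
Proof.
move=> dF dg.
apply: (@def_app1 _ (fun a r => r 0 = F a (shift r)) (fun r => g (shift r))).
  exact: (@def_rename d (fun n => if n is 0 then 1 else if n is 1 then 0 else n) _ dF).
exact: (@dfun_rename d succn).
Qed.

Lemma dfun_app1 d (F : M -> M) g :
  Dfun d (fun r => F (r 0)) -> Dfun d g -> Dfun d (fun r => F (g r)).
Proof. exact: (@dfun_comp d (fun a _ => F a)). Qed.

Lemma def_comp d (P : M -> Prop) g :
  Def d (fun r => P (r 0)) -> Dfun d g -> Def d (fun r => P (g r)).
Proof. exact: (@def_app1 d (fun a _ => P a)). Qed.

Lemma dfun_teval d (V : Type) (t : term V) (v : V -> (nat -> M) -> M) :
  (forall i, Dfun d (v i)) -> Dfun d (fun r => teval (fun i => v i r) t).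
Proof.
move=> dv; elim: t => [x|||t1 IH1 t2 IH2|t1 IH1 t2 IH2] /=.
- exact: dv.
- exact: dfun_zero.
- exact: dfun_one.
- exact: dfun_add.
- exact: dfun_mul.
Qed.

Lemma def_holds d (V : Type) (p : form V) : forall (v : V -> (nat -> M) -> M),
  (forall i, Dfun d (v i)) -> Def d (fun r => holds p (fun i => v i r)).
Proof.
elim: p => {V} V => [t1 t2|t1 t2||p1 IH1 p2 IH2|p1 IH1] v dv /=.
- by apply: def_eq; exact: dfun_teval.
- by apply: def_less; exact: dfun_teval.
- exact: def_bot.
- by apply: def_imp; auto.
- apply: def_all.
  pose w (i : option V) r := if i is Some j then v j (shift r) else r 0.
  apply: (@def_ext _ (fun r => holds p1 (fun i => w i r))).
    by move=> r; apply: holds_vars => -[i|].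
  apply: IH1 => -[i|]; last exact: dfun_var.
  exact: (@dfun_rename d succn).
Qed.

Lemma def_finite d P : Def d P -> exists l : seq M,
  (forall x, List.In x l -> d x) /\ Def (fun x => List.In x l) P.
Proof.
move=> [p pP].
pose l := pmap (fun x : nat + {x : M | d x} => if x is inr a then Some (sval a) else None) (form_vars p).
have lP a : List.In (inr a) (form_vars p) -> List.In (sval a) l.
  rewrite /l; elim: (form_vars p) => [//|[n|b] s IH] /= [] //.
  by case=> ->; left.
  by move=> /IH; right.
exists l; split.
  move=> x; rewrite /l; elim: (form_vars p) => [//|[n|b] s IH] //= [<-|] //.
  exact: proj2_sig.
exists (fsubst p (fun x => match x with inl n => Var (inl n)
  | inr a => if pselect (List.In (sval a) l) is left H then Var (inr (exist _ (sval a) H))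
             else Zero end)) => r.
rewrite pP holds_fsubst; apply: holds_vars => -[n|a] //= /lP al.
by case: pselect.
Qed.

(** The induction axioms have free variables in [nat] only, so the finitely many parameters of a
    formula must be turned into values of numbered variables. *)
Lemma def_value (V : Type) (s : seq V) (e : V -> M) : exists (k : V -> nat) (v : nat -> M),
  forall x, List.In x s -> v (k x) = e x.
Proof.
elim: s => [|y s [k [v kv]]]; first by exists (fun=> 0), (fun=> zero).
exists (fun x => if pselect (x = y) then 0 else (k x).+1), (fun n => if n is m.+1 then v m else e y).
by move=> x /= xs; case: pselect => [xy|ne] /=; [rewrite xy|apply: kv; case: xs => // /esym].
Qed.

Hypothesis hM : model_of_PA M.

Lemma def_ind d (X : M -> Prop) : Def d (fun r => X (r 0)) ->
  X zero -> (forall x, X x -> X (add x one)) -> forall x, X x.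
Proof.
move=> [p pP] X0 XS.
have [k [v kv]] := def_value (form_vars p) (@assign d (fun=> zero)).
pose q : form (option nat) := frename (fun x => match x with inl 0 => None | _ => Some (k x) end) p.
have qP a : holds q (extend v a) <-> X a.
  rewrite (pP (fun n => if n is 0 then a else zero)) holds_frename; apply: holds_vars.
  by case=> [[|n]|b] //= /kv.
clearbody q; have := hM (PA_induction q) v => /=; rewrite holds_fsubst => ind x.
apply/qP; apply: ind => [|y].
  suff -> : (fun x0 => teval v (if x0 is Some y then Var y else Zero)) = extend v zero.
    exact: (qP _).2 X0.
  by apply: funext => -[].
rewrite holds_fsubst => /(qP _).1 /XS /(qP _).2.
suff -> : (fun x0 => teval (extend v y) (if x0 is Some z then Var (Some z) else Add (Var None) One))
  = extend v (add y one) by [].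
by apply: funext => -[].
Qed.

End Definable.

(** * Arithmetic in models of PA *)

Declare Scope pa_scope.
Delimit Scope pa_scope with pa.

Definition le (M : structure) (x y : M) : Prop := less x y \/ x = y.

Local Notation "x + y" := (add x y) : pa_scope.
Local Notation "x * y" := (mul x y) : pa_scope.
Local Notation "x < y" := (less x y) : pa_scope.
Local Notation "x <= y" := (le x y) : pa_scope.

Ltac dstep := lazymatch goal with
 | |- Def _ (fun r => _ /\ _) => apply: def_and
 | |- Def _ (fun r => _ \/ _) => apply: def_or
 | |- Def _ (fun r => _ <-> _) => apply: def_iff
 | |- Def _ (fun r => ~ _) => apply: def_not
 | |- Def _ (fun r => exists x, _) => apply: def_ex; cbv beta delta [shift]
 | |- Def _ (fun r => _ = _) => apply: def_eq
 | |- Def _ (fun r => less _ _) => apply: def_less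
 | |- Def _ (fun r => le _ _) => unfold le
 | |- Dfun _ (fun r => r _) => apply: dfun_var
 | |- Dfun _ (fun r => add _ _) => apply: dfun_add
 | |- Dfun _ (fun r => mul _ _) => apply: dfun_mul
 | |- Dfun _ (fun r => zero) => apply: dfun_zero
 | |- Dfun _ (fun r => one) => apply: dfun_one
 | |- Def _ (fun r => True) => apply: def_true
 | |- Def _ (fun r => False) => apply: def_bot
 | |- _ => first [ assumption | apply: dfun_cst; solve [exact I | assumption]
    | apply: def_imp | apply: def_all; cbv beta delta [shift] ]
 end.
Ltac dfn := cbv beta delta [shift]; repeat dstep.

Section Arith.
Variable M : structure.
Hypothesis hM : model_of_PA M.
Local Open Scope pa_scope.
Implicit Types (x y z a b c k m i j w : M) (X Y : set M).

Let env x y := fun n => if n is 0 then x else y.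

Lemma succ_neq0 x : x + one <> zero.
Proof. exact: (hM PA_succ_neq0 (env x x)). Qed.
Lemma succ_inj x y : x + one = y + one -> x = y.
Proof. exact: (hM PA_succ_inj (env x y)). Qed.
Lemma padd0 x : x + zero = x.
Proof. exact: (hM PA_add0 (env x x)). Qed.
Lemma paddS x y : x + (y + one) = (x + y) + one.
Proof. exact: (hM PA_addS (env x y)). Qed.
Lemma pmul0 x : x * zero = zero.
Proof. exact: (hM PA_mul0 (env x x)). Qed.
Lemma pmulS x y : x * (y + one) = x * y + x.
Proof. exact: (hM PA_mulS (env x y)). Qed.
Lemma ltE x y : x < y <-> exists z, x + (z + one) = y.
Proof.
have /= := hM PA_lt (env x y).
move=> h; split=> [lt|[z e]].
  apply: contrapT => ne; apply: h => h1 _; apply: (h1 lt) => z e.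
  by apply: ne; exists z.
by apply: contrapT => ne; apply: h => _ h2; apply: ne; apply: h2 => h3; apply: (h3 z).
Qed.

Lemma pind (X : M -> Prop) : Def setT (fun r => X (r 0)) ->
  X zero -> (forall x, X x -> X (x + one)) -> forall x, X x.
Proof. exact: def_ind. Qed.

Lemma padd0l x : zero + x = x.
Proof.
elim/pind: x => [||x IH]; [by dfn|exact: padd0|by rewrite paddS IH].
Qed.
Lemma paddSl x y : (x + one) + y = (x + y) + one.
Proof.
elim/pind: y => [||y IH]; [by dfn|by rewrite !padd0|by rewrite !paddS IH].
Qed.
Lemma paddC x y : x + y = y + x.
Proof.
elim/pind: y => [||y IH]; [by dfn|by rewrite padd0 padd0l|by rewrite paddS paddSl IH].
Qed.
Lemma paddA x y z : x + (y + z) = (x + y) + z.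
Proof.
elim/pind: z => [||z IH]; [by dfn|by rewrite !padd0|by rewrite !paddS IH].
Qed.
Lemma pmul0l x : zero * x = zero.
Proof.
elim/pind: x => [||x IH]; [by dfn|exact: pmul0|by rewrite pmulS IH padd0].
Qed.
Lemma pmulSl x y : (x + one) * y = x * y + y.
Proof.
elim/pind: y => [||y IH]; [by dfn|by rewrite !pmul0 padd0|].
rewrite !pmulS IH !paddS; congr add; rewrite -!paddA; congr add; exact: paddC.
Qed.
Lemma pmulC x y : x * y = y * x.
Proof.
elim/pind: y => [||y IH]; [by dfn|by rewrite pmul0 pmul0l|by rewrite pmulS pmulSl IH].
Qed.
Lemma pmulDl x y z : (x + y) * z = x * z + y * z.
Proof.
elim/pind: z => [||z IH]; [by dfn|by rewrite !pmul0 padd0|].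
rewrite !pmulS IH -!paddA; congr add; rewrite !paddA; congr add; exact: paddC.
Qed.
Lemma pmulA x y z : x * (y * z) = (x * y) * z.
Proof.
elim/pind: z => [||z IH]; [by dfn|by rewrite !pmul0|].
by rewrite !pmulS -IH (pmulC x (_ + _)) pmulDl (pmulC _ x) (pmulC y x).
Qed.
Lemma pmul1l x : one * x = x.
Proof. by rewrite -(padd0l one) pmulSl pmul0l padd0l. Qed.

Lemma pa_semi_ring : semi_ring_theory (@zero M) one (@add M) (@mul M) eq.
Proof.
constructor.
- exact: padd0l.
- exact: paddC.
- exact: paddA.
- exact: pmul1l.
- exact: pmul0l.
- exact: pmulC.
- exact: pmulA.
- exact: pmulDl.
Qed.
Add Ring pa_ring : pa_semi_ring.

Lemma paddI x y z : x + z = y + z -> x = y.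
Proof.
elim/pind: z => [||z IH]; [by dfn|by rewrite !padd0|by rewrite !paddS => /succ_inj].
Qed.

Lemma padd_eq0 x y : x + y = zero -> y = zero.
Proof.
elim/pind: y => [||y _] //; first by dfn.
by rewrite paddS => /succ_neq0.
Qed.

Lemma zeroVsucc x : x = zero \/ exists y, x = y + one.
Proof.
elim/pind: x => [||x _]; [by dfn|by left|by right; exists x].
Qed.

Lemma leE x y : x <= y <-> exists z, y = x + z.
Proof.
split=> [[/ltE [z <-]|->]|[z ->]]; first by exists (z + one).
  by exists zero; rewrite padd0.
case: (zeroVsucc z) => [->|[t ->]]; first by right; rewrite padd0.
by left; apply/ltE; exists t.
Qed.

Lemma le_addr x y : x <= x + y. Proof. by apply/leE; exists y. Qed.
Lemma le_refl x : x <= x. Proof. by right. Qed.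
Lemma lt_irr x : ~ x < x.
Proof.
move=> /ltE [z e]; apply: (@succ_neq0 z); apply: (@paddI _ _ x).
by rewrite padd0l paddC.
Qed.
Lemma le_trans x y z : x <= y -> y <= z -> x <= z.
Proof. by move=> /leE [t ->] /leE [u ->]; apply/leE; exists (t + u); ring. Qed.
Lemma lt_leS x y : x < y <-> x + one <= y.
Proof.
by split=> [/ltE [z <-]|/leE [z ->]]; [apply/leE|apply/ltE]; exists z; ring.
Qed.
Lemma lt_le x y : x < y -> x <= y. Proof. by left. Qed.
Lemma lt_le_trans x y z : x < y -> y <= z -> x < z.
Proof. by rewrite !lt_leS; exact: le_trans. Qed.
Lemma le_lt_trans x y z : x <= y -> y < z -> x < z.
Proof. by move=> [xy yz|->//]; apply: lt_le_trans xy _; exact: lt_le. Qed.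
Lemma lt_trans x y z : x < y -> y < z -> x < z.
Proof. by move=> xy /lt_le; exact: lt_le_trans. Qed.
Lemma ltS x y : x < y + one <-> x <= y.
Proof.
rewrite lt_leS; split=> /leE [z]; last by move=> ->; apply/leE; exists z; ring.
by move=> e; apply/leE; exists z; apply: (@paddI _ _ one); rewrite e; ring.
Qed.
Lemma lt_succ x : x < x + one. Proof. by apply/ltS; exact: le_refl. Qed.
Lemma le0 x : zero <= x. Proof. by apply/leE; exists x; rewrite padd0l. Qed.
Lemma le_total x y : x <= y \/ y < x.
Proof.
elim/pind: x => [||x [[xy|->]|yx]]; first by dfn.
- by left; exact: le0.
- by left; apply/lt_leS.
- by right; exact: lt_succ.
- by right; apply: lt_trans yx _; exact: lt_succ.
Qed.
Lemma leNlt x y : x <= y <-> ~ y < x.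
Proof.
split=> [xy yx|nyx]; first by apply: (@lt_irr x); exact: le_lt_trans yx.
by case: (le_total x y).
Qed.
Lemma ltNle x y : x < y <-> ~ y <= x.
Proof. by rewrite leNlt; split=> [h []//|/contrapT]. Qed.
Lemma lt_neq x y : x < y -> x <> y.
Proof. by move=> xy e; apply: (@lt_irr x); rewrite {2}e. Qed.
Lemma neq_lt x y : x <> y -> x < y \/ y < x.
Proof. by move=> ne; case: (le_total x y) => [[|//]|]; auto. Qed.
Lemma le_anti x y : x <= y -> y <= x -> x = y.
Proof. by move=> [xy|//] /leNlt. Qed.
Lemma lt0 x : ~ x < zero. Proof. by apply/leNlt; exact: le0. Qed.
Lemma le_add x y z w : x <= y -> z <= w -> x + z <= y + w.
Proof. by move=> /leE [t ->] /leE [u ->]; apply/leE; exists (t + u); ring. Qed.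
Lemma lt_add x y z w : x < y -> z <= w -> x + z < y + w.
Proof.
rewrite !lt_leS => xy zw; rewrite (_ : _ + _ + _ = (x + one) + z); last by ring.
exact: le_add.
Qed.
Lemma le_mul x y z w : x <= y -> z <= w -> x * z <= y * w.
Proof.
move=> /leE [t ->] /leE [u ->]; apply/leE; exists (x * u + t * z + t * u); ring.
Qed.
Lemma lt_mul x y z : zero < z -> x < y -> x * z < y * z.
Proof.
move=> /ltE [t <-] /ltE [u <-]; apply/ltE.
by exists (x * zero + u * t + u + t); ring.
Qed.
Lemma le_addI x y z : x + z <= y + z -> x <= y.
Proof.
move=> /leE [t e]; apply/leE; exists t; apply: (@paddI _ _ z).
by rewrite e; ring.
Qed.

Lemma least (d : set M) X x : Def d (fun r => X (r 0)) -> X x ->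
  exists2 y, X y & forall z, X z -> y <= z.
Proof.
move=> dX Xx; apply: contrapT => ne.
have dX' : Def setT (fun r => X (r 0)) by apply: def_sub dX.
have h z : forall y, y < z -> ~ X y.
  elim/pind: z => [||z IH y].
  - apply: def_all; cbv beta delta [shift]; apply: def_imp; first by dfn.
    by apply: def_not; apply: (@def_comp _ _ X) => //; dfn.
  - by move=> y /lt0.
  - move=> /ltS yz Xy; apply: ne; exists y => // t Xt.
    by apply/leNlt => ty; apply: (IH t) => //; exact: lt_le_trans yz.
exact: (h (x + one) x (lt_succ x)).
Qed.

(** * Coding bounded definable sets by single elements *)

Definition dvd x y := exists k, y = x * k.
Lemma dvd_mulr x y z : dvd x y -> dvd x (y * z).
Proof. by move=> [k ->]; exists (k * z); ring. Qed.
Lemma dvd_mull x y z : dvd x y -> dvd x (z * y).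
Proof. by move=> [k ->]; exists (k * z); ring. Qed.
Lemma dvd_addI x y z : dvd x y -> dvd x (y + z) -> dvd x z.
Proof.
move=> [k ->] [j e]; case: (le_total k j) => [/leE [t jE]|/ltE [t kE]].
  by exists t; apply: (@paddI _ _ (x * k)); rewrite paddC e jE; ring.
exists zero; rewrite pmul0; apply: (@padd_eq0 (x * (t + one))).
apply: (@paddI _ _ (x * j)); rewrite padd0l -{2}e -kE; ring.
Qed.
Lemma dvd_refl x : dvd x x. Proof. by exists one; ring. Qed.

(* When m is divisible by 1, ..., b, the moduli of distinct x < b are coprime, so
   that every definable subset of [0, b) is the set of members of some c. *)
Definition modulus m x := one + (x + one) * m.
Definition member m c x := dvd (modulus m x) c.
Definition divisible_upto m b := m <> zero /\ forall k, k <= b -> k <> zero -> dvd k m.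

Lemma divisible_upto_ex b : exists m, divisible_upto m b.
Proof.
elim/pind: b => [||b [m [m0 mP]]].
- by rewrite /divisible_upto /dvd; dfn.
- exists one; split=> [e|k k0 nk]; first by apply: (@succ_neq0 zero); rewrite padd0l.
  by case: nk; apply: le_anti => //; exact: le0.
- exists (m * (b + one)); split=> [e|k kb k0].
    have [/m0//|[t mE]] := zeroVsucc m.
    by apply: (@succ_neq0 (t * b + t + b)); rewrite -e mE; ring.
  case: kb => [/ltS kb|->]; first by apply: dvd_mulr; exact: mP.
  by apply: dvd_mull; exact: dvd_refl.
Qed.

(** Coprimality without Bezout: the combination [(z + 1) * modulus m x - (x + 1) * modulus m z]
    equals [z - x], so [modulus m x] divides [k * c] with [k] the distance of [x] and [z]. As [k]
    divides [m], it divides [(x + 1) * m * c], hence also [c]. *)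
Lemma member_mul m b c x z : divisible_upto m b -> x < b -> z < b -> x <> z ->
  member m (c * modulus m z) x -> member m c x.
Proof.
move=> [m0 mP] xb zb xz; rewrite /member => dxz.
have key k : k <= b -> k <> zero -> dvd (modulus m x) (k * c) -> dvd (modulus m x) c.
  move=> kb k0 dk; have [t mE] := mP k kb k0.
  have : dvd (modulus m x) ((x + one) * m * c).
    rewrite (_ : _ * _ = (k * c) * ((x + one) * t)); last by rewrite mE; ring.
    exact: dvd_mulr.
  move=> /dvd_addI; apply; exists c; rewrite /modulus; ring.
have [/ltE [k e]|/ltE [k e]] := neq_lt xz.
- apply: (key (k + one)); last 1 first.
  + apply: (@dvd_addI _ ((x + one) * (c * modulus m z))); first exact: dvd_mull.
    exists ((z + one) * c); rewrite -e /modulus; ring.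
  + apply: le_trans (lt_le zb); rewrite -e (paddC x); exact: le_addr.
  + exact: succ_neq0.
- apply: (key (k + one)); last 1 first.
  + apply: (@dvd_addI _ (modulus m x * (z + one) * c)).
      by apply: dvd_mulr; apply: dvd_mulr; exact: dvd_refl.
    rewrite (_ : _ + _ = (x + one) * (c * modulus m z)); first exact: dvd_mull.
    rewrite -e /modulus; ring.
  + apply: le_trans (lt_le xb); rewrite -e (paddC z); exact: le_addr.
  + exact: succ_neq0.
Qed.

Lemma coding d X m b : Def d (fun r => X (r 0)) -> divisible_upto m b ->
  exists c, forall x, x < b -> (member m c x <-> X x).
Proof.
move=> dX mb.
have dX' : Def setT (fun r => X (r 0)) by apply: def_sub dX.
have h z : exists c, forall x, x < b -> (member m c x <-> x < z /\ X x).
  elim/pind: z => [||z [c cP]].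
  - rewrite /member /modulus /dvd; dfn; apply: (@def_comp _ _ X) => //; dfn.
  (* The empty product codes the empty set: [m] is nonzero, so every modulus exceeds [one]. *)
  - exists one => x xb; split=> [[k]|[/lt0//]].
    have [->|[t ->]] := zeroVsucc k.
      by rewrite pmul0 => e; case: (@succ_neq0 zero); rewrite padd0l.
    have [/mb.1 //|[s ->]] := zeroVsucc m; rewrite /modulus => e.
    case: (@succ_neq0 ((x + one) * s + x + ((x + one) * s + x + one) * t + t)).
    by apply: (@paddI _ _ one); rewrite padd0l; apply: (etrans _ (esym e)); ring.
  - have [Xz|nXz] := pselect (X z); last first.
      exists c => x xb; rewrite cP // ltS; split=> [[/lt_le]//|[[//|->]]] //.
    have [zb|bz] := pselect (z < b); last first.
      exists c => x xb; rewrite cP // ltS; split=> [[/lt_le]//|[xz Xx]]; split=> //.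
      by apply: lt_le_trans xb _; apply/leNlt.
    exists (c * modulus m z) => x xb; split.
      have [->|xz] := pselect (x = z); first by split=> //; exact: lt_succ.
      move=> /(member_mul mb xb zb xz); rewrite cP // => -[xz' Xx]; split=> //.
      by apply/ltS; exact: lt_le.
    move=> [/ltS [xz Xx|-> _]]; last by apply: dvd_mull; exact: dvd_refl.
    by apply: dvd_mulr; apply/cP.
have [c cP] := h b; exists c => x xb; rewrite cP //; tauto.
Qed.

(** A pairing that needs no division: with [s = i + x] the value lies between [s^2] and [(s + 1)^2],
    which determines [s]. *)
Definition pair i x := (i + x) * (i + x) + x.

Lemma pair_inj i x j y : pair i x = pair j y -> i = j /\ x = y.
Proof.
have key a b c e : a + b < c + e -> pair a b <> pair c e.
  move=> h; apply: lt_neq; rewrite /pair.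
  apply: (@lt_le_trans _ ((a + b + one) * (a + b + one))).
    apply/ltE; exists (a + a + b); ring.
  apply: le_trans (le_addr _ _).
  by apply: le_mul; apply/lt_leS.
move=> e; have : i + x = j + y.
  apply: contrapT => /neq_lt [/key|/key]; [exact|by move=> /(_ (esym e))].
move=> s; move: e; rewrite /pair s => e.
have xy : x = y by apply: (@paddI _ _ ((j + y) * (j + y))); rewrite paddC e paddC.
by split=> //; apply: (@paddI _ _ x); rewrite s xy.
Qed.

Lemma pair_lt i x j y : i < j -> x < y -> pair i x < pair j y.
Proof.
move=> ij xy; rewrite /pair paddC (paddC (_ * _)); apply: lt_add => //.
by apply: le_mul; apply: le_add; exact: lt_le.
Qed.

(** * Internal cardinality *)

Definition graph m c i x := member m c (pair i x).

(* M sees that X has at most c elements: X is covered by the range of a partial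
   function on [0, c) whose graph is coded in M. *)
Definition covered X c := exists m e w,
  (forall i x y, i < c -> x < w -> y < w -> graph m e i x -> graph m e i y -> x = y) /\
  forall x, X x -> x < w /\ exists i, i < c /\ graph m e i x.

Lemma covered_intro d (F : M -> M -> Prop) X c z :
  Def d (fun r => F (r 0) (r 1)) -> (forall x, X x -> x < z) ->
  (forall i x y, i < c -> F i x -> F i y -> x = y) ->
  (forall x, X x -> exists i, i < c /\ F i x) -> covered X c.
Proof.
move=> dF Xz Ff FX.
have [m mb] := divisible_upto_ex (pair c z).
have dF' : Def setT (fun r => F (r 0) (r 1)) by apply: def_sub dF.
have [|e eP] := @coding setT (fun t => exists i x, [/\ i < c, x < z, t = pair i x & F i x]) m (pair c z) _ mb.
  apply: (@def_ext _ _ (fun r => exists i x, i < c /\ x < z /\ r 0 = pair i x /\ F i x)).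
    by move=> r; split=> -[i [x]]; [move=> [? [? []]]|case]; exists i, x.
  by rewrite /pair; dfn; apply: (@def_app2 _ _ F) => //; dfn.
have gP i x : i < c -> x < z -> (graph m e i x <-> F i x).
  move=> ic xz; rewrite /graph eP; last exact: pair_lt.
  split=> [[j [y [_ _ /pair_inj [-> ->]]]]//|h]; by exists i, x.
exists m, e, z; split=> [i x y ic xz yz /gP h1 /gP h2|x Xx].
  by apply: (Ff i) => //; auto.
split; first exact: Xz.
by have [i [ic Fi]] := FX x Xx; exists i; split=> //; apply/gP => //; exact: Xz.
Qed.

(** Quantifying over codes keeps internal cardinality first-order, so that induction and least
    elements apply to it. *)
Lemma def_covered d (P : M -> (nat -> M) -> Prop) (g : (nat -> M) -> M) :
  Def d (fun r => P (r 0) (shift r)) -> Dfun d g ->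
  Def d (fun r => covered (fun x => P x r) (g r)).
Proof.
move=> dP dg; rewrite /covered /graph /member /dvd /modulus /pair.
apply: def_ex; apply: def_ex; apply: def_ex; cbv beta delta [shift].
have dg3 s : Dfun d (fun r => g (fun n => r (s n))) by exact: (@dfun_rename _ d s).
apply: def_and.
  apply: def_all; apply: def_all; apply: def_all; cbv beta delta [shift].
  apply: def_imp; first by apply: def_less; [dfn|exact: (dg3 (fun n => n.+3.+3))].
  by dfn.
apply: def_all; cbv beta delta [shift]; apply: def_imp.
  by apply: (@def_fam _ d P (fun n => n.+4) (fun r => r 0)) => //; dfn.
apply: def_and; first by dfn.
apply: def_ex; cbv beta delta [shift]; apply: def_and; last by dfn.
by apply: def_less; [dfn|exact: (dg3 (fun n => n.+4.+1))].
Qed.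

Lemma covered_sub X Y c : X `<=` Y -> covered Y c -> covered X c.
Proof. by move=> XY [m [e [w [f h]]]]; exists m, e, w; split=> // x /XY; exact: h. Qed.

Lemma covered_addr X Y c k : covered X c -> covered Y k ->
  covered (X `|` Y) (c + k).
Proof.
move=> [m [e [w [f h]]]] [m' [e' [w' [f' h']]]].
apply: (@covered_intro setT (fun i x => (i < c /\ x < w /\ graph m e i x) \/
   exists j, i = c + j /\ j < k /\ x < w' /\ graph m' e' j x) _ _ (w + w')).
- by rewrite /graph /member /modulus /pair /dvd; dfn.
- move=> x [/h [xw _]|/h' [xw _]]; apply: lt_le_trans xw _; first exact: le_addr.
  by rewrite paddC; exact: le_addr.
- move=> i x y ick [[ic [xw gx]]|[j [ij [jk [xw gx]]]]] [[ic' [yw gy]]|[j' [ij' [jk' [yw gy]]]]].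
  + exact: (f i).
  + by exfalso; move: ic; rewrite ij'; apply/leNlt; exact: le_addr.
  + by exfalso; move: ic'; rewrite ij; apply/leNlt; exact: le_addr.
  + apply: (f' j) => //; rewrite (_ : j = j') //.
    by apply: (@paddI _ _ c); rewrite paddC -ij ij' paddC.
- move=> x [/h [xw [i [ic g]]]|/h' [xw [i [ic g]]]].
    by exists i; split; [apply: lt_le_trans ic _; exact: le_addr|left].
  exists (c + i); split; last by right; exists i.
  by rewrite !(paddC c); apply: lt_add => //; exact: le_refl.
Qed.

Lemma covered_set0 : covered set0 zero.
Proof. by exists zero, zero, zero; split=> [i x y /lt0|]. Qed.

Lemma covered_le X c k : c <= k -> covered X c -> covered X k.
Proof.
move=> ck [m [e [w [f h]]]].
apply: (@covered_intro setT (fun i x => i < c /\ x < w /\ graph m e i x) _ _ w).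
- by rewrite /graph /member /modulus /pair /dvd; dfn.
- by move=> x /h [].
- by move=> i x y _ [ic [xw gx]] [_ [yw gy]]; exact: (f i).
- move=> x /h [xw [i [ic g]]]; exists i; split=> //; exact: lt_le_trans ck.
Qed.

Lemma covered_set1 x : covered [set x] one.
Proof.
apply: (@covered_intro setT (fun i y => y = x) _ _ (x + one)).
- by dfn.
- by move=> y ->; exact: lt_succ.
- by move=> i y z _ -> ->.
- by move=> y ->; exists zero; split=> //; have := lt_succ zero; rewrite padd0l.
Qed.

Lemma covered_lt z : covered (fun x => x < z) z.
Proof.
apply: (@covered_intro setT (fun i y => i = y) _ _ z) => //; first by dfn.
  by move=> i x y _ <-.
by move=> x xz; exists x.
Qed.

(** In the induction step let [i0] be the index of the top element. Dropping that element frees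
    [i0], which takes over the value of the last index [c]; the indices below [c] then suffice for
    the rest. *)
Lemma pigeonhole c : ~ covered (fun x => x < c + one) c.
Proof.
elim/pind: c => [||c IH [m [e [w [f h]]]]].
- by apply: def_not; apply: (@def_covered _ (fun x r => x < r 0 + one)); dfn.
- move=> [m [e [w [f h]]]]; have [|_ [i [/lt0 //]]] := h zero.
  exact: lt_succ.
- apply: IH; have [cw [i0 [i0c g0]]] := h (c + one) (lt_succ _).
  apply: (@covered_intro setT (fun i x => x < w /\ ((i <> i0 /\ graph m e i x) \/
     (i = i0 /\ graph m e c x))) _ _ (c + one)) => //.
  + by rewrite /graph /member /modulus /pair /dvd; dfn.
  + have cc : c < c + one by exact: lt_succ.
    move=> i x y ic [xw Hx] [yw Hy]; have ic' := lt_trans ic cc.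
    case: Hx => [[ii gx]|[ii gx]]; case: Hy => [[ii' gy]|[ii' gy]] //.
      exact: (f i).
    exact: (f c).
  + move=> x xc; have [xw [i [ic gx]]] := h x (lt_trans xc (lt_succ _)).
    have ii0 : i <> i0.
      move=> ii0; apply: (lt_neq xc); apply: (f i) => //; by rewrite ii0.
    move/ltS: ic => [ic|ic]; first by exists i; split=> //; split=> //; left.
    exists i0; split; last by split=> //; right; rewrite -ic.
    move/ltS: i0c => [//|i0c]; by case: ii0; rewrite ic i0c.
Qed.

Lemma covered_fibers d X (g : M -> M) a c : Def d (fun r => X (r 0)) ->
  Dfun d (fun r => g (r 0)) -> (forall x, X x -> g x < a) ->
  (forall k, k < a -> covered (fun x => X x /\ g x = k) c) -> covered X (a * c).
Proof.
move=> dX dg Xa cov.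
have dX' : Def setT (fun r => X (r 0)) by apply: def_sub dX.
have dg' : Dfun setT (fun r => g (r 0)) by apply: def_sub dg.
have h k : k <= a -> covered (fun x => X x /\ g x < k) (k * c).
  elim/pind: k => [||k IH /lt_leS ka].
  - apply: def_imp; first by dfn.
    apply: (@def_covered _ (fun x r => X x /\ g x < r 0)); last by dfn.
    cbv beta delta [shift]; apply: def_and => //.
    by apply: def_less => //; dfn.
  - by move=> _; rewrite pmul0l; apply: covered_sub covered_set0 => x [_ /lt0].
  - rewrite (_ : _ * _ = k * c + c); last by ring.
    apply: covered_sub (covered_addr (IH (lt_le ka)) (cov k ka)).
    by move=> x [Xx /ltS [gk|gk]]; [left|right].
by apply: covered_sub (h a (le_refl a)) => x Xx; split=> //; exact: Xa.
Qed.

Lemma numeral_add n p : numeral M (n + p)%N = numeral M n + numeral M p.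
Proof. by elim: p => [|p IH]; rewrite ?addn0 ?padd0 // addnS /= IH paddS. Qed.

Lemma numeral_mul n p : numeral M (n * p)%N = numeral M n * numeral M p.
Proof. by elim: p => [|p IH]; rewrite ?muln0 ?pmul0 // mulnS numeral_add IH /= pmulS paddC. Qed.

Lemma lt_numeral n x : x < numeral M n -> exists2 p, (p < n)%N & x = numeral M p.
Proof.
elim: n => [/lt0//|n IH] /ltS [/IH [p pn ->]|->]; last by exists n.
by exists p => //; exact: ltnW.
Qed.

Lemma covered_numeral X n : covered X (numeral M n) ->
  exists l : seq M, forall x, X x -> List.In x l.
Proof.
move=> [m [e [w [f h]]]].
have /choice [g gP] i : exists y, forall x, x < w -> i < numeral M n -> graph m e i x -> x = y.
  have [[y [yw [ic gy]]]|ne] := pselect (exists y, y < w /\ i < numeral M n /\ graph m e i y).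
    by exists y => x xw _ gx; exact: (f i).
  by exists zero => x xw ic gx; case: ne; exists x.
exists (map (fun p => g (numeral M p)) (iota 0 n)) => x /h [xw [i [ic gx]]].
rewrite (gP i x xw ic gx); have [p pn ->] := lt_numeral ic.
have : p \in iota 0 n by rewrite mem_iota.
elim: (iota 0 n) => //= q s IH; rewrite in_cons => /orP [/eqP ->|/IH]; by [left|right].
Qed.

Lemma pow_gt0 a n : one <= a -> one <= power a n.
Proof.
move=> a1; elim: n => [|n IH] /=; first exact: le_refl.
by rewrite -(pmul1l one); apply: le_mul.
Qed.

Lemma pow_add a n p : power a (n + p)%N = power a n * power a p.
Proof.
by elim: p => [|p IH]; rewrite ?addn0 ?addnS /= ?IH; ring.
Qed.

Lemma pow_le a n p : one <= a -> (n <= p)%N -> power a n <= power a p.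
Proof.
move=> a1 np; rewrite -(subnKC np) pow_add -{1}(pmul1l (power a n)) (pmulC one).
by apply: le_mul; [exact: le_refl|exact: pow_gt0].
Qed.

(* The notion of largeness of all filter conditions: no standard power of a bounds
   the internal cardinality of X. *)
Definition big a X := forall n, ~ covered X (power a n).

Lemma big_sub a X Y : X `<=` Y -> big a X -> big a Y.
Proof. by move=> XY bX n /(covered_sub XY); exact: bX. Qed.

Section Base.
Variable a : M.
Hypothesis a2 : one + one <= a.

Lemma base_ge1 : one <= a.
Proof. by apply: le_trans a2; exact: le_addr. Qed.

Lemma covered_bigU (W : Type) (ws : seq W) (D : W -> set M) n :
  (forall p, List.In p ws -> covered (D p) (power a n)) ->
  covered (fun x => exists2 p, List.In p ws & D p x) (power a (n + size ws)).
Proof.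
elim: ws => [|p ws IH] h.
  apply: covered_le (le0 _) _; apply: covered_sub covered_set0 => x [].
  by [].
apply: (@covered_le _ (power a n + power a (n + size ws))).
  rewrite addnS /= (pmulC _ a); apply: (@le_trans _ ((one + one) * power a (n + size ws))).
    rewrite pmulDl pmul1l; apply: le_add; last exact: le_refl.
    by apply: pow_le; [exact: base_ge1|exact: leq_addr].
  by apply: le_mul => //; exact: le_refl.
apply: covered_sub (covered_addr (h p (or_introl erefl)) (IH _)).
  by move=> x [q /= [<-|qs] Dx]; [left|right; exists q].
by move=> q qs; apply: h; right.
Qed.

(** There are [a + 1] possible values and [a + 1 <= a * a], hence the loss of two powers of [a]. *)
Lemma cap_fiber d X (g : M -> M) n : Def d (fun r => X (r 0)) ->
  Dfun d (fun r => g (r 0)) -> (forall x, X x -> g x <= a) ->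
  ~ covered X (power a n.+2) ->
  exists k, ~ covered (fun x => X x /\ g x = k) (power a n).
Proof.
move=> dX dg ga nc; apply: contrapT => ne; apply: nc.
apply: (@covered_le _ ((a + one) * power a n)).
  rewrite /= -pmulA (pmulC _ (a * a)); apply: le_mul; last exact: le_refl.
  apply: (@le_trans _ ((one + one) * a)); last by apply: le_mul => //; exact: le_refl.
  rewrite pmulDl pmul1l; apply: le_add; [exact: le_refl|exact: base_ge1].
apply: (covered_fibers dX dg) => [x /ga /ltS //|k _].
by apply: contrapT => nc; apply: ne; exists k.
Qed.

(** A discrete intermediate value argument: raising [z] by one adds at most one element to the part
    of [X] below [z], so the first [z] at which the count reaches [c] has count exactly [c]. *)
Lemma rank_ivt X c : Def setT (fun r => X (r 0)) -> (exists b, X `<=` (fun x => x < b)) ->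
  (forall k, k < c -> ~ covered X k) ->
  exists z, covered (fun x => X x /\ x < z) c /\
    forall k, covered (fun x => X x /\ x < z) k -> c <= k.
Proof.
move=> dX [b Xb] h.
have [||z zP zmin] := @least setT (fun z => forall k, k < c -> ~ covered (fun x => X x /\ x < z) k) b.
- apply: def_all; cbv beta delta [shift]; apply: def_imp; first by dfn.
  apply: def_not; apply: (@def_covered _ (fun x r => X x /\ x < r 1)); last by dfn.
  by cbv beta delta [shift]; apply: def_and => //; dfn.
- by move=> k kc; apply: contra_not (h k kc); apply: covered_sub => x Xx; split=> //; exact: Xb.
exists z; split; last by move=> k hk; apply/leNlt => /zP.
have [z0|[t zt]] := zeroVsucc z.
  by apply: covered_le (le0 c) _; apply: covered_sub covered_set0 => x [_]; rewrite z0 => /lt0.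
have : ~ forall k, k < c -> ~ covered (fun x => X x /\ x < t) k.
  by move=> /zmin; rewrite leNlt; apply; rewrite zt; exact: lt_succ.
move=> /existsNP [k /not_implyP [kc /contrapT hk]].
apply: (@covered_le _ (k + one)); first exact/lt_leS.
apply: covered_sub (covered_addr hk (covered_set1 t)).
by move=> x [Xx]; rewrite zt => /ltS [xt|->]; [left|right].
Qed.

(** Let [c] be the internal cardinality of [X] and [w] the quotient of [c] by [a]. Bigness puts [w]
    above all standard powers of [a]. The point [U t] is where the count of [X] reaches [t * w]; a
    block covered by [a^n] would give [(t + 1) * w <= t * w + a^n]. *)
Lemma blocks X b : Def setT (fun r => X (r 0)) -> X `<=` (fun x => x < b) -> big a X ->
  exists U : M -> M, (forall s t, s < t -> t <= a -> U s < U t) /\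
    forall t, t < a -> big a (fun x => X x /\ U t <= x /\ x < U (t + one)).
Proof.
move=> dX Xb bX.
have [||c cX cmin] := @least setT (fun c => covered X c) b.
- by apply: (@def_covered _ (fun x _ => X x)) => //; dfn.
- by apply: covered_sub (covered_lt b).
have lem x : x < a * (x + one).
  apply: (@lt_le_trans _ (x + one)); first exact: lt_succ.
  rewrite -{1}(pmul1l (x + one)); apply: le_mul; [exact: base_ge1|exact: le_refl].
have [||w wP wmin] := @least setT (fun w => c < a * (w + one)) c; [by dfn|exact: lem|].
have awc : a * w <= c.
  have [->|[t wt]] := zeroVsucc w; first by rewrite pmul0; exact: le0.
  rewrite leNlt wt => h; have := wmin t h; rewrite wt leNlt; apply; exact: lt_succ.
have pw n : power a n < w.
  rewrite ltNle => wn; apply: (bX n.+2); apply: covered_le cX; apply: lt_le.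
  apply: (lt_le_trans wP); rewrite /= (pmulC _ a); apply: le_mul; first exact: le_refl.
  apply: (@le_trans _ (power a n * (one + one))); last by apply: le_mul => //; exact: le_refl.
  rewrite pmulC pmulDl pmul1l; apply: le_add => //.
  by apply: pow_gt0; exact: base_ge1.
have w0 : zero < w by apply: le_lt_trans (pw 0); exact: le0.
have h t : t <= a -> forall k, k < t * w -> ~ covered X k.
  move=> ta k kt ck; apply: ((leNlt _ _).1 (cmin k ck)); apply: (lt_le_trans kt).
  by apply: le_trans awc; apply: le_mul => //; exact: le_refl.
have /choice [U ultrapower] t : exists z, t <= a -> covered (fun x => X x /\ x < z) (t * w) /\
    forall k, covered (fun x => X x /\ x < z) k -> t * w <= k.
  have [ta|nta] := pselect (t <= a); last by exists zero.
  have [z zP] := rank_ivt dX (ex_intro _ b Xb) (h t ta); by exists z.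
exists U; split=> [s t st ta|t ta n hc].
  apply/ltNle => Uts; have sa := le_trans (lt_le st) ta.
  have := (ultrapower t ta).2 (s * w); rewrite leNlt; apply.
    by apply: covered_sub (ultrapower s sa).1 => x [Xx xt]; split=> //; exact: lt_le_trans Uts.
  exact: lt_mul.
have ta1 : t + one <= a by apply/lt_leS.
have [cU mU] := ultrapower t (lt_le ta); have [_ mU1] := ultrapower (t + one) ta1.
have : (t + one) * w <= t * w + power a n.
  apply: mU1; apply: covered_sub (covered_addr cU hc) => x [Xx xU].
  by case: (le_total (U t) x) => xt; [right|left].
rewrite pmulDl pmul1l !(paddC (t * w)) => /le_addI; rewrite leNlt; apply; exact: pw.
Qed.

End Base.

(** Powers of two are standard numbers, so base two turns bigness into plain infinity. This is the
    notion for steps that only realize a type. *)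
Lemma big_infinite X : (forall l : seq M, exists2 x, X x & ~ List.In x l) ->
  big (one + one) X.
Proof.
move=> inf n cov; have e : power (one + one) n = numeral M (2 ^ n).
  elim: n {cov} => [|n IH] /=; first by rewrite padd0l.
  by rewrite IH expnS mulnC numeral_mul /= padd0l.
move: cov; rewrite e => /covered_numeral [l lP].
by have [x /lP] := inf l.
Qed.

Definition dcl (d : set M) z := Dfun d (fun=> z).

Lemma dcl_self (d : set M) z : d z -> dcl d z.
Proof. exact: dfun_cst. Qed.

Lemma dcl_app (d : set M) (g : M -> M) z : Dfun d (fun r => g (r 0)) -> dcl d z -> dcl d (g z).
Proof. by move=> dg dz; apply: (dfun_app1 dg dz). Qed.

Lemma dcl_pow (d : set M) a n : d a -> dcl d (power a n).
Proof.
move=> da; elim: n => [|n IH]; first exact: dfun_one.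
by apply: dfun_mul => //; exact: dfun_cst.
Qed.

Definition outside u v z := z < u \/ v < z.

Lemma disjoint_filter (l : seq (M * M)) z :
  List.ForallOrdPairs (fun p q => q.2 < p.1) l ->
  (forall p, List.In p l -> p.1 <= p.2) ->
  exists l', [/\ (size l <= (size l').+1)%N, forall p, List.In p l' -> List.In p l,
    List.ForallOrdPairs (fun p q => q.2 < p.1) l' &
    forall p, List.In p l' -> outside p.1 p.2 z].
Proof.
elim: l => [|p l IH] /=; first by exists [::].
move=> H hl; inversion H as [|? ? Hp Hl]; subst.
have [pz|pz] := pselect (outside p.1 p.2 z).
  have [l' [sl sub ord out]] := IH Hl (fun q ql => hl q (or_intror ql)).
  exists (p :: l'); split=> //= [q [->|/sub]|| q [<-//|/out//]]; auto.
  constructor=> //; apply/List.Forall_forall => q /sub ql.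
  by move/List.Forall_forall: Hp; apply.
exists l; split=> // [q|q ql]; first by right.
right; have := (List.Forall_forall _ _).1 Hp q ql => qp; apply: (lt_le_trans qp).
by apply/leNlt => zp; apply: pz; left.
Qed.

Lemma disjoint_pick (hs : seq (M -> M)) x : forall l : seq (M * M),
  List.ForallOrdPairs (fun p q => q.2 < p.1) l ->
  (forall p, List.In p l -> p.1 <= p.2) -> (size hs < size l)%N ->
  exists2 p, List.In p l & forall h, List.In h hs -> outside p.1 p.2 (h x).
Proof.
elim: hs => [|h hs IH] l ord hl sl /=.
  by case: l ord hl sl => [//|p l] _ _ _; exists p => //; left.
have [l' [sl' sub ord' out]] := disjoint_filter (h x) ord hl.
have [||p pl' pP] := IH l' ord'; first by move=> p /sub /hl.
  by rewrite -ltnS; exact: leq_trans sl sl'.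
by exists p; [exact: sub|move=> k [<-|/pP//]; exact: out].
Qed.

Lemma def_outside_list (d : set M) X (hs : seq (M -> M)) : Def d (fun r => X (r 0)) ->
  (forall h, List.In h hs -> Dfun d (fun r => h (r 0))) ->
  Def d (fun r => X (r 0) /\ forall h, List.In h hs -> outside (r 1) (r 2) (h (r 0))).
Proof.
move=> dX; elim: hs => [|h hs IH] dh.
  by apply: def_ext dX => r; split=> [|[]].
apply: (@def_ext _ _ (fun r => (X (r 0) /\ forall f, List.In f hs -> outside (r 1) (r 2) (f (r 0)))
   /\ outside (r 1) (r 2) (h (r 0)))).
  move=> r; split=> [[[Xr hr] hh]|[Xr hr]]; first by split=> // k [<-|/hr].
  by split; [split=> // k ks|]; apply: hr; [right|left].
apply: def_and; first by apply: IH => k ks; apply: dh; right.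
have dh0 := dh h (or_introl erefl).
by apply: def_or; apply: def_less => //; dfn.
Qed.

(* If too many x had some h x in [u, v], the same would hold for intervals
   [s, t] with s and t definable over d, starting with s = 0 and moving up to
   the next disjoint interval; all these intervals lie below u, and one point x
   cannot have an h x in more intervals than there are functions h. *)
Lemma avoid (d : set M) a u v X (hs : seq (M -> M)) n : one + one <= a -> d a -> u <= v ->
  (forall z, dcl d z -> outside u v z) -> Def d (fun r => X (r 0)) ->
  (forall h, List.In h hs -> Dfun d (fun r => h (r 0))) ->
  ~ covered X (power a (n + (size hs).+1)) ->
  ~ covered (fun x => X x /\ forall h, List.In h hs -> outside u v (h x)) (power a n).
Proof.
move=> a2 da uv out dX dh nc cov; apply: nc.
pose W s t x := X x /\ forall h, List.In h hs -> outside s t (h x).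
have dW : Def d (fun r => W (r 1) (r 2) (r 0)) by exact: def_outside_list.
have below s : dcl d s -> s <= v -> s < u.
  by move=> /out [//|vs] sv; case: (@lt_irr s); exact: le_lt_trans vs.
(* The candidate [v] works because [s < u]. The least [t] that works is definable over [d] and at
   most [v], and [[u, v]] contains no such element, so [t < u]. *)
have step s : dcl d s -> s < u ->
    exists t, [/\ dcl d t, t < u, s <= t & covered (W s t) (power a n)].
  move=> ds su.
  have dS : Def d (fun r => covered (W s (r 0)) (power a n) /\ s <= r 0).
    apply: def_and.
      apply: (@def_covered _ (fun x r => W s (r 0) x)); last by exact: (dcl_pow n da).
      cbv beta delta [shift].
      apply: (@def_app3 _ _ (fun x y z => W y z x)) => //; try exact: dfun_var.
    by apply: def_or; [apply: def_less|apply: def_eq] => //; dfn.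
  have [|t [ct st] tmin] := @least d (fun t => covered (W s t) (power a n) /\ s <= t) v dS.
    split; last by apply: lt_le; exact: lt_le_trans uv.
    apply: covered_sub cov => x [Xx hx]; split=> // h hh.
    by case: (hx h hh) => H; [left; exact: lt_trans su|right].
  have dt : dcl d t.
    apply: (@def_ext _ _ (fun r => (covered (W s (r 0)) (power a n) /\ s <= r 0) /\
      forall z, covered (W s z) (power a n) /\ s <= z -> r 0 <= z)).
      move=> r; split=> [[h1 h2]|->]; last by split.
      by apply: le_anti; [exact: h2|exact: tmin].
    apply: def_and => //; apply: def_all; cbv beta delta [shift].
    apply: def_imp; first by apply: (@def_comp _ _ (fun z => covered (W s z) (power a n) /\ s <= z)) => //; dfn.
    by dfn.
  exists t; split=> //; apply: below => //; apply: tmin.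
  split; last by apply: lt_le; exact: lt_le_trans uv.
  apply: covered_sub cov => x [Xx hx]; split=> // h hh.
  by case: (hx h hh) => H; [left; exact: lt_trans su|right].
have seqs (k : nat) : exists (l : seq (M * M)) s, [/\ size l = k, dcl d s /\ s < u,
    List.ForallOrdPairs (fun p q => q.2 < p.1) l &
    forall p, List.In p l -> [/\ p.1 <= p.2, p.2 < s & covered (W p.1 p.2) (power a n)]].
  elim: k => [|k [l [s [sl [ds su] ord hl]]]].
    exists [::], zero; split=> //; last by constructor.
    by split; [exact: dfun_zero|apply: below; [exact: dfun_zero|exact: le0]].
  have [t [dt tu st ct]] := step s ds su.
  exists ((s, t) :: l), (t + one); split=> /=.
  - by rewrite sl.
  - have dt1 : dcl d (t + one) by apply: dfun_add => //; exact: dfun_one.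
    by split=> //; apply: below => //; apply: le_trans uv; apply/lt_leS.
  - by constructor=> //; apply/List.Forall_forall => q /hl [].
  - move=> p [<-|/hl [p12 ps cp]]; split=> //=; first exact: lt_succ.
    apply: lt_trans ps _; exact/ltS.
have [l [s [sl _ ord hl]]] := seqs (size hs).+1.
rewrite -sl; apply: covered_sub (covered_bigU a2 (ws := l) (D := fun p => W p.1 p.2) _).
  move=> x Xx; have [||p pl pP] := disjoint_pick x ord (hs := hs).
  - by move=> p /hl [].
  - by rewrite sl.
  - by exists p.
by move=> p /hl [].
Qed.

End Arith.

(** * Elementary chains *)

Section Partial.
Variable T : Type.

(* Structures on subsets of a fixed type, so that the union of an elementary chain
   is a literal union; the values outside [dom] are irrelevant. *)
Record prestructure := Pre {
  dom : set T;
  pzero : T;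
  pone : T;
  padd : T -> T -> T;
  pmul : T -> T -> T;
  pless : T -> T -> Prop
}.
Implicit Types P Q : prestructure.

Definition wfp P := [/\ dom P (pzero P), dom P (pone P),
  forall x y, dom P x -> dom P y -> dom P (padd P x y) &
  forall x y, dom P x -> dom P y -> dom P (pmul P x y)].

Fixpoint peval P (V : Type) (v : V -> T) (t : term V) : T :=
  match t with
  | Var x => v x
  | Zero => pzero P
  | One => pone P
  | Add t1 t2 => padd P (peval P v t1) (peval P v t2)
  | Mul t1 t2 => pmul P (peval P v t1) (peval P v t2)
  end.

Fixpoint psat P (V : Type) (p : form V) : (V -> T) -> Prop :=
  match p with
  | Equal t1 t2 => fun v => peval P v t1 = peval P v t2
  | Less t1 t2 => fun v => pless P (peval P v t1) (peval P v t2)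
  | Bot => fun=> False
  | Imp p1 p2 => fun v => psat P p1 v -> psat P p2 v
  | All p1 => fun v => forall a, dom P a -> psat P p1 (extend v a)
  end.

Definition St P (w : wfp P) : structure :=
  let '(And4 w0 w1 wa wm) := w in
  @Structure {x : T | dom P x} (exist _ _ w0) (exist _ _ w1)
    (fun x y => exist _ _ (wa _ _ (proj2_sig x) (proj2_sig y)))
    (fun x y => exist _ _ (wm _ _ (proj2_sig x) (proj2_sig y)))
    (fun x y => pless P (sval x) (sval y)).

Definition el P (w : wfp P) (x : St w) : T.
Proof. by case: w x => w0 w1 wa wm x; exact: (sval x). Defined.

Lemma el_dom P (w : wfp P) (x : St w) : dom P (el x).
Proof. by case: w x => w0 w1 wa wm x; exact: (proj2_sig x). Qed.

Lemma el_inj P (w : wfp P) : injective (@el P w).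
Proof.
case: w => w0 w1 wa wm [x hx] [y hy] /= e; case: _ / e hy => hy.
by congr exist; exact: Prop_irrelevance.
Qed.

Definition mk P (w : wfp P) (x : T) (h : dom P x) : St w.
Proof. by case: w => w0 w1 wa wm; exact: (exist _ x h). Defined.

Lemma mkE P (w : wfp P) (x : T) (h : dom P x) : el (mk w h) = x.
Proof. by case: w => w0 w1 wa wm. Qed.

Lemma el_less P (w : wfp P) (x y : St w) : less x y <-> pless P (el x) (el y).
Proof. by case: w x y => w0 w1 wa wm. Qed.

Lemma el_eval P (w : wfp P) (V : Type) (v : V -> St w) t :
  el (teval v t) = peval P (fun i => el (v i)) t.
Proof. by case: w v => w0 w1 wa wm v; elim: t => //= [t1 -> t2 ->|t1 -> t2 ->]. Qed.

Lemma psatP P (w : wfp P) (V : Type) (p : form V) : forall (v : V -> St w),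
  holds p v <-> psat P p (fun i => el (v i)).
Proof.
elim: p => {V} V => [t1 t2|t1 t2||p1 IH1 p2 IH2|p1 IH1] v /=.
- rewrite -!el_eval; split=> [->//|]; exact: el_inj.
- by rewrite el_less !el_eval.
- by [].
- by rewrite IH1 IH2.
- have e a : (fun i => el (extend v a i)) = extend (fun i => el (v i)) (el a).
    by apply: funext => -[].
  split=> h a.
    by move=> da; have := h (mk w da); rewrite IH1 e mkE.
  by apply/IH1; rewrite e; apply: h; exact: el_dom.
Qed.

Definition elem P Q := dom P `<=` dom Q /\
  forall (V : Type) (p : form V) (v : V -> T), (forall i, dom P (v i)) ->
    psat P p v <-> psat Q p v.

Lemma elem_refl P : elem P P. Proof. by split. Qed.

Lemma elem_trans P Q S : elem P Q -> elem Q S -> elem P S.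
Proof.
move=> [PQ pq] [QS qs]; split=> [x /PQ /QS //|V p v vP].
by rewrite pq // qs // => i; apply: PQ.
Qed.

Lemma elem_zero P Q : wfp P -> elem P Q -> pzero P = pzero Q.
Proof.
move=> [w0 _ _ _] [_ /(_ _ (Equal (Var tt) Zero) (fun=> pzero P)) h].
exact: (h (fun=> w0)).1.
Qed.
Lemma elem_one P Q : wfp P -> elem P Q -> pone P = pone Q.
Proof.
move=> [_ w1 _ _] [_ /(_ _ (Equal (Var tt) One) (fun=> pone P)) h].
exact: (h (fun=> w1)).1.
Qed.
Lemma elem_add P Q x y : wfp P -> elem P Q -> dom P x -> dom P y -> padd P x y = padd Q x y.
Proof.
move=> [_ _ wa _] [_ h] dx dy.
have := h _ (Equal (Var None) (Add (Var (Some true)) (Var (Some false))))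
  (fun i => if i is Some b then if b then x else y else padd P x y).
by move=> /= [|-> //]; case=> [[]|] //; exact: wa.
Qed.
Lemma elem_mul P Q x y : wfp P -> elem P Q -> dom P x -> dom P y -> pmul P x y = pmul Q x y.
Proof.
move=> [_ _ _ wm] [_ h] dx dy.
have := h _ (Equal (Var None) (Mul (Var (Some true)) (Var (Some false))))
  (fun i => if i is Some b then if b then x else y else pmul P x y).
by move=> /= [|-> //]; case=> [[]|] //; exact: wm.
Qed.
Lemma elem_less P Q x y : elem P Q -> dom P x -> dom P y -> pless P x y <-> pless Q x y.
Proof.
move=> [_ h] dx dy.
by have := h _ (Less (Var true) (Var false)) (fun b => if b then x else y); apply; case.
Qed.

Section Union.
Variables (t0 : T) (fam : set prestructure).

Definition pickT (S : set T) : T := if pselect (exists x, S x) is left e then sval (cid e) else t0.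

Definition chain_union : prestructure := Pre
  (fun x => exists2 P, fam P & dom P x)
  (pickT (fun z => exists2 P, fam P & z = pzero P))
  (pickT (fun z => exists2 P, fam P & z = pone P))
  (fun x y => pickT (fun z => exists2 P, fam P & [/\ dom P x, dom P y & z = padd P x y]))
  (fun x y => pickT (fun z => exists2 P, fam P & [/\ dom P x, dom P y & z = pmul P x y]))
  (fun x y => exists2 P, fam P & [/\ dom P x, dom P y & pless P x y]).

Hypothesis wf_fam : forall P, fam P -> wfp P.
Hypothesis chain : forall P Q, fam P -> fam Q -> elem P Q \/ elem Q P.

Lemma pickT_uniq (S : set T) x : S x -> (forall y, S y -> y = x) -> pickT S = x.
Proof.
move=> Sx u; rewrite /pickT; case: pselect => [e|[]]; last by exists x.
by case: cid => y /= /u.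
Qed.

Lemma chain_union_zero P : fam P -> pzero chain_union = pzero P.
Proof.
move=> fP; apply: pickT_uniq; first by exists P.
move=> _ [Q fQ ->]; case: (chain fP fQ) => [/(elem_zero (wf_fam fP)) //|/(elem_zero (wf_fam fQ)) //].
Qed.
Lemma chain_union_one P : fam P -> pone chain_union = pone P.
Proof.
move=> fP; apply: pickT_uniq; first by exists P.
move=> _ [Q fQ ->]; case: (chain fP fQ) => [/(elem_one (wf_fam fP)) //|/(elem_one (wf_fam fQ)) //].
Qed.
Lemma chain_union_add P x y : fam P -> dom P x -> dom P y -> padd chain_union x y = padd P x y.
Proof.
move=> fP dx dy; apply: pickT_uniq; first by exists P.
move=> _ [Q fQ [qx qy ->]].
by case: (chain fP fQ) => [h|h]; [rewrite (elem_add (wf_fam fP) h)|rewrite (elem_add (wf_fam fQ) h)].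
Qed.
Lemma chain_union_mul P x y : fam P -> dom P x -> dom P y -> pmul chain_union x y = pmul P x y.
Proof.
move=> fP dx dy; apply: pickT_uniq; first by exists P.
move=> _ [Q fQ [qx qy ->]].
by case: (chain fP fQ) => [h|h]; [rewrite (elem_mul (wf_fam fP) h)|rewrite (elem_mul (wf_fam fQ) h)].
Qed.
Lemma chain_union_less P x y : fam P -> dom P x -> dom P y -> pless chain_union x y <-> pless P x y.
Proof.
move=> fP dx dy; split=> [[Q fQ [qx qy]]|h]; last by exists P.
by case: (chain fP fQ) => h; [rewrite -(elem_less h)|rewrite (elem_less h)].
Qed.

Lemma chain_union_pair x y : dom chain_union x -> dom chain_union y -> exists2 P, fam P & dom P x /\ dom P y.
Proof.
move=> [P fP dx] [Q fQ dy].
by case: (chain fP fQ) => -[s _]; [exists Q => //; split=> //; exact: s|exists P => //; split=> //; exact: s].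
Qed.

Lemma chain_union_wf P : fam P -> wfp chain_union.
Proof.
move=> fP; have [w0 w1 _ _] := wf_fam fP; split.
- by rewrite (chain_union_zero fP); exists P.
- by rewrite (chain_union_one fP); exists P.
- move=> x y /chain_union_pair h /h [Q fQ [dx dy]]; rewrite (chain_union_add fQ) //; exists Q => //.
  by have [_ _ wa _] := wf_fam fQ; exact: wa.
- move=> x y /chain_union_pair h /h [Q fQ [dx dy]]; rewrite (chain_union_mul fQ) //; exists Q => //.
  by have [_ _ _ wm] := wf_fam fQ; exact: wm.
Qed.

Lemma peval_dom P (V : Type) (v : V -> T) t : wfp P -> (forall i, dom P (v i)) -> dom P (peval P v t).
Proof. by move=> [w0 w1 wa wm] vP; elim: t => //= t1 ? t2 ?; [exact: wa|exact: wm]. Qed.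

Lemma chain_union_eval P (V : Type) (v : V -> T) t : fam P -> (forall i, dom P (v i)) ->
  peval chain_union v t = peval P v t.
Proof.
move=> fP vP; elim: t => [x|||t1 IH1 t2 IH2|t1 IH1 t2 IH2]; cbn [peval].
- by [].
- exact: chain_union_zero.
- exact: chain_union_one.
- by rewrite IH1 IH2 (chain_union_add fP) //; apply: peval_dom => //; exact: wf_fam.
- by rewrite IH1 IH2 (chain_union_mul fP) //; apply: peval_dom => //; exact: wf_fam.
Qed.

(** The elementary chain theorem. The induction on formulas is uniform in the member of the chain,
    since the quantifier step passes to a larger member that contains the new element. *)
Lemma chain_union_elem P : fam P -> elem P chain_union.
Proof.
move=> fP; split=> [x dx|V p]; first by exists P.
elim: p P fP => {V} V => [t1 t2|t1 t2||p1 IH1 p2 IH2|p1 IH1] P fP v vP; cbn [psat].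
- by rewrite !(chain_union_eval _ fP).
- by rewrite !(chain_union_eval _ fP) // (chain_union_less fP) //; apply: peval_dom => //; exact: wf_fam.
- by [].
- by rewrite (IH1 P) // (IH2 P).
- split=> h a da.
    have [Q [fQ dQ PQ]] : exists Q, [/\ fam Q, dom Q a & elem P Q].
      case: da => Q fQ dQ; case: (chain fP fQ) => [|QP]; first by exists Q.
      by exists P; split=> //; [case: QP => s _; exact: s|exact: elem_refl].
    have vQ i : dom Q (v i) by apply: PQ.1.
    have hQ : psat Q (All p1) v by rewrite -PQ.2.
    by rewrite -(IH1 Q) //; [exact: hQ|case].
  rewrite (IH1 P) //; first by apply: h; exists P.
  by case.
Qed.

End Union.

(** Elementarity speaks only about assignments with values in [P], so an axiom is transferred
    through its universal closure, obtained by iterating [clo] beyond the last free variable. *)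
Lemma elem_PA P Q (w : wfp P) (w' : wfp Q) : elem P Q -> model_of_PA (St w) -> model_of_PA (St w').
Proof.
move=> PQ hP.
pose clo (p : form nat) : form nat := All (frename (fun n => if n is k.+1 then Some k else None) p).
have cloP (M : structure) p (v : nat -> M) : holds (clo p) v <->
    forall a, holds p (fun n => if n is k.+1 then v k else a).
  rewrite /=; split=> h a; have := h a; rewrite holds_frename => H;
    apply/(holds_vars _).1: H; by case.
have iterP (M : structure) N : forall p (v : nat -> M), holds (iter N clo p) v <->
    forall u : nat -> M, holds p (fun n => if (n < N)%N then u n else v (n - N)%N).
  elim: N => [|N IH] p v.
    have e (u : nat -> M) : (fun n => if (n < 0)%N then u n else v (n - 0)%N) = v.
      by apply: funext => n; rewrite subn0.
    by split=> [h u|h]; [rewrite e|have := h v; rewrite e].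
  rewrite iterSr IH; split=> h u; last first.
    apply/cloP => a; have := h (fun n => if n is k.+1 then u k else a) => H.
    by apply/(holds_vars _).1: H; case.
  have /cloP /(_ (u 0)) H := h (fun n => u n.+1); apply/(holds_vars _).1: H; by case.
move=> p hp v.
have [N NP] : exists N, forall n, List.In n (form_vars p) -> (n < N)%N.
  elim: (form_vars p) => [|x s [N IH]]; first by exists 0.
  exists (maxn N x.+1) => n /= [<-|/IH h]; rewrite leq_max ?leqnn ?orbT //.
  by rewrite h.
have h1 (u : nat -> St w) : holds (iter N clo p) u by apply/iterP => u'; exact: hP.
have x0 : St w by have [d0 _ _ _] := w; exact: (mk w d0).
have /psatP := h1 (fun=> x0); rewrite PQ.2; last by move=> i; exact: el_dom.
have dx0 : dom Q (el x0) by apply: PQ.1; exact: el_dom.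
rewrite (_ : (fun=> el x0) = (fun n : nat => el (mk w' dx0))); last by apply: funext => n; rewrite mkE.
move=> /psatP /iterP /(_ v) H; apply/(holds_vars _).1: H => n /NP nN.
by rewrite nN.
Qed.

End Partial.

(** * Definable ultrapowers and good cuts *)

Definition Dfn (M : structure) (c : set M) (h : M -> M) := Dfun c (fun r => h (r 0)).

Lemma dfn_rename (M : structure) (c : set M) (h : M -> M) n : Dfn c h -> Dfun c (fun r => h (r n)).
Proof. by move=> dh; apply: (dfun_app1 dh); exact: dfun_var. Qed.

(** The least witness is a definable choice; points without a witness get the value [zero]. *)
Lemma skolem (M : structure) (hM : model_of_PA M) (d : set M) (A : M -> M -> Prop) :
  Def d (fun r => A (r 0) (r 1)) ->
  exists h : M -> M, Dfn d h /\ forall t, (exists a, A t a) -> A t (h t).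
Proof.
move=> dA.
have dAt t : Def setT (fun r => A t (r 0)).
  apply: (@def_app2 _ _ A); last exact: dfun_var; first exact: def_sub dA.
  exact: dfun_cst.
have /choice [h hP] t : exists a, (A t a /\ forall z, A t z -> le a z) \/
    ((~ exists z, A t z) /\ a = zero).
  have [[z Az]|nA] := pselect (exists z, A t z); last by exists zero; right.
  by have [y Ay ymin] := least hM (dAt t) Az; exists y; left.
exists h; split=> [|t [a Aa]]; last by case: (hP t) => [[]//|[[]]]; exists a.
apply: (@def_ext _ _ (fun r => (A (r 1) (r 0) /\ forall z, A (r 1) z -> le (r 0) z) \/
    ((~ exists z, A (r 1) z) /\ r 0 = zero))).
  move=> r; split=> [|->]; last exact: hP.
  case: (hP (r 1)) => [[Ah hmin]|[nA ->]] [[Ar rmin]|[nAr ->]] //.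
  - by apply: (le_anti hM); [exact: rmin|exact: hmin].
  - by case: nAr; exists (h (r 1)).
  - by case: nA; exists (r 0).
by dfn; apply: (@def_app2 _ _ A) => //; dfn.
Qed.

(** * Ultrapowers of definable functions *)

Section Ultrapower.
Variables (T : Type) (M : structure) (hM : model_of_PA M) (c : set M).
Variables (U : set_system M) (UU : UltraFilter U) (psi : (M -> M) -> T).
Hypothesis psiP : forall h h', Dfn c h -> Dfn c h' ->
  (psi h = psi h' <-> U [set t | h t = h' t]).

Let PU : ProperFilter U := @ultra_proper _ _ UU.

Definition repr (z : T) : M -> M :=
  if pselect (exists h, Dfn c h /\ psi h = z) is left e then sval (cid e) else fun=> zero.

Definition ultrapower : prestructure T := Pre
  (fun z => exists2 h, Dfn c h & psi h = z)
  (psi (fun=> zero)) (psi (fun=> one))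
  (fun x y => psi (fun t => add (repr x t) (repr y t)))
  (fun x y => psi (fun t => mul (repr x t) (repr y t)))
  (fun x y => U [set t | less (repr x t) (repr y t)]).

Lemma reprP h : Dfn c h -> Dfn c (repr (psi h)) /\ U [set t | repr (psi h) t = h t].
Proof.
move=> dh; rewrite /repr; case: pselect => [e|[]]; last by exists h.
by case: cid => h' /= [dh' /psiP e']; split=> //; exact: e'.
Qed.

Lemma ultrapower_wf : wfp ultrapower.
Proof.
split=> /=.
- by exists (fun=> zero) => //; exact: dfun_zero.
- by exists (fun=> one) => //; exact: dfun_one.
- move=> x y [h dh <-] [h' dh' <-]; eexists; last reflexivity.
  by apply: dfun_add; [have [] := reprP dh|have [] := reprP dh'].
- move=> x y [h dh <-] [h' dh' <-]; eexists; last reflexivity.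
  by apply: dfun_mul; [have [] := reprP dh|have [] := reprP dh'].
Qed.

Lemma ultrapower_eval (V : Type) (H : V -> M -> M) t : (forall i, Dfn c (H i)) ->
  peval ultrapower (fun i => psi (H i)) t = psi (fun s => teval (fun i => H i s) t) /\
  Dfn c (fun s => teval (fun i => H i s) t).
Proof.
move=> dH; have dt u : Dfn c (fun s => teval (fun i => H i s) u).
  exact: (@dfun_teval _ c _ u (fun i r => H i (r 0))).
split=> //; elim: t => [x|||t1 IH1 t2 IH2|t1 IH1 t2 IH2] //.
- change (padd ultrapower (peval ultrapower (fun i => psi (H i)) t1) (peval ultrapower (fun i => psi (H i)) t2) =
     psi (fun s => add (teval (fun i => H i s) t1) (teval (fun i => H i s) t2))).
  rewrite IH1 IH2 /=; have [d1 U1] := reprP (dt t1); have [d2 U2] := reprP (dt t2).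
  apply/psiP; [exact: dfun_add|exact: (dt (Add t1 t2))|].
  by apply: filterS (filterI U1 U2) => s [/= -> ->].
- change (pmul ultrapower (peval ultrapower (fun i => psi (H i)) t1) (peval ultrapower (fun i => psi (H i)) t2) =
     psi (fun s => mul (teval (fun i => H i s) t1) (teval (fun i => H i s) t2))).
  rewrite IH1 IH2 /=; have [d1 U1] := reprP (dt t1); have [d2 U2] := reprP (dt t2).
  apply/psiP; [exact: dfun_mul|exact: (dt (Mul t1 t2))|].
  by apply: filterS (filterI U1 U2) => s [/= -> ->].
Qed.

Lemma ultrapower_less h h' : Dfn c h -> Dfn c h' ->
  (pless ultrapower (psi h) (psi h') <-> U [set t | less (h t) (h' t)]).
Proof.
move=> /reprP [_ U1] /reprP [_ U2]; rewrite /=; split=> U3.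
  by apply: filterS (filterI (filterI U1 U2) U3) => s [/= [<- <-]].
by apply: filterS (filterI (filterI U1 U2) U3) => s [/= [-> ->]].
Qed.

(** Only definable functions represent elements, so in the quantifier case the function of
    counterexamples has to be definable; [skolem] provides it. *)
Lemma los (V : Type) (p : form V) : forall (H : V -> M -> M), (forall i, Dfn c (H i)) ->
  (psat ultrapower p (fun i => psi (H i)) <-> U [set t | holds p (fun i => H i t)]).
Proof.
elim: p => {V} V => [t1 t2|t1 t2||p1 IH1 p2 IH2|p1 IH1] H dH; cbn [psat].
- have [-> d1] := ultrapower_eval t1 dH; have [-> d2] := ultrapower_eval t2 dH.
  by rewrite psiP.
- have [-> d1] := ultrapower_eval t1 dH; have [-> d2] := ultrapower_eval t2 dH.
  by rewrite ultrapower_less.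
- split=> // U0; apply: (@filter_not_empty _ U PU).
  by apply: filterS U0.
- rewrite IH1 // IH2 //; split=> [h|h U1]; last first.
    by apply: filterS (filterI h U1) => t /= [h' /h'].
  have [/h U2|chain_union] := in_ultra_setVsetC [set t | holds p1 (fun i => H i t)] UU.
    by apply: filterS U2 => t /=.
  by apply: filterS chain_union => t /= n1 /n1.
- have ext h : extend (fun i => psi (H i)) (psi h) =
      (fun i => psi (if i is Some j then H j else h)).
    by apply: funext => -[].
  have dext h : Dfn c h -> forall i, Dfn c (if i is Some j then H j else h).
    by move=> dh [j|].
  split=> [hall|Uall a [h dh <-]]; last first.
    rewrite ext IH1; last exact: dext.
    apply: filterS Uall => t /= /(_ (h t)) H1; apply/(holds_vars _).1: H1.
    by case.
  have [//|chain_union] := in_ultra_setVsetC [set t | holds (All p1) (fun i => H i t)] UU.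
  have [|h [dh hP]] := @skolem _ hM c (fun t a => ~ holds p1 (extend (fun i => H i t) a)).
    apply: def_not; apply: (@def_ext _ _ (fun r => holds p1 (fun i =>
      (if i is Some j then fun r => H j (r 0) else fun r : nat -> M => r 1) r))).
      by move=> r; apply: holds_vars => -[].
    by apply: def_holds => -[j|]; [exact: dH|exact: dfun_var].
  have := hall (psi h) (ex_intro2 _ _ h dh erefl).
  rewrite ext IH1; last exact: dext.
  move=> Uh; exfalso; apply: (@filter_not_empty _ U PU).
  apply: filterS (filterI Uh chain_union) => t /= [h1 h2].
  have /hP : exists a, ~ holds p1 (extend (fun i => H i t) a) by exact/existsNP.
  by apply; apply/(holds_vars _).1: h1; case.
Qed.

End Ultrapower.

(** * Good cuts in ultrapowers *)

Section Cuts.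
Variables (dL : Order.disp_t) (L : orderType dL).

(* No set of fewer than |L| elements has definable closure meeting every
   interval [u, v] with u in A and v in B. *)
Definition good (M : structure) (A B : set M) :=
  (forall u v, A u -> B v -> less u v) /\
  forall d, small L d -> exists u v, [/\ A u, B v & forall z, dcl d z -> outside u v z].

Definition goodP (T : Type) (P : prestructure T) (A B : set T) := [/\ A `<=` dom P, B `<=` dom P &
  exists w : wfp P, good (M := St w) (fun x => A (el x)) (fun x => B (el x))].

(** The form of goodness that survives the ultrapower: an element definable there from given classes
    is the class of a function definable from the parameters of their representatives. *)
Definition Fgood (M : structure) (F : set_system M) (A B : set M) :=
  forall e, small L e -> exists u v, [/\ A u, B v &
    forall h, Dfn e h -> F [set t | outside u v (h t)]].

Variables (dK : Order.disp_t) (K : orderType dK).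
Hypothesis hL : is_infinite_cardinal L.
Hypothesis hpow : ([set: short_seq L] #= [set: L])%card.
Hypothesis hK : is_succ_cardinal L K.

Lemma form_le (V : Type) : inj_le [set: V] [set: L] -> inj_le [set: form V] [set: L].
Proof.
move=> [f [_ fI]]; have [p pI] := L_pairing hL hpow; have [n nI] := nat_inj_L hL.
exists (fun q => form_code p n q f); split=> // x y _ _.
by apply: (form_code_inj pI nI) => // u v; exact: fI.
Qed.

Lemma sum_le (V W : Type) : inj_le [set: V] [set: L] -> inj_le [set: W] [set: L] ->
  inj_le [set: V + W] [set: L].
Proof.
move=> [f [_ fI]] [g [_ gI]]; have [p pI] := L_pairing hL hpow; have [n nI] := nat_inj_L hL.
exists (fun x => match x with inl a => p (n 0) (f a) | inr b => p (n 1) (g b) end).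
split=> // -[a|a] [b|b] _ _ /pI [/nI //].
  by move=> _ /fI ->.
by move=> _ /gI ->.
Qed.

Lemma nat_le : inj_le [set: nat] [set: L].
Proof. by have [n nI] := nat_inj_L hL; exists n; split=> // x y _ _; exact: nI. Qed.

Lemma Dfn_le (M : structure) (c : set M) : inj_le c [set: L] ->
  inj_le [set h | Dfn c h] [set: L].
Proof.
move=> [f [_ fI]].
have lec : inj_le [set: {x | c x}] [set: L].
  exists (fun x => f (sval x)); split=> // -[x cx] [y cy] _ _ /= /fI e.
  by have {}e := e cx cy; case: _ / e cy => cy; congr exist; exact: Prop_irrelevance.
apply: inj_le_trans (form_le (sum_le nat_le lec)).
have /choice [g gP] (h : M -> M) : exists p : form (nat + {x | c x}), Dfn c h ->
    forall r, r 0 = h (r 1) <-> holds p (@assign M c r).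
  by have [[p pP]|nd] := pselect (Dfn c h); [exists p|exists Bot].
exists g; split=> // h k /gP hP /gP kP e; apply: funext => t.
pose r n := if n is 0 then h t else t.
have := (hP r).1 erefl; rewrite e => /kP; exact.
Qed.

Lemma small_In (T : Type) (l : seq T) : small L (fun x => List.In x l).
Proof. by apply: small_finite => //; exact: In_finite. Qed.

(* The definable ultrapower by an ultrafilter extending F, placed in K above P. *)
Lemma ultra_ext (P : prestructure K) (w : wfp P) (F : set_system (St w)) :
  model_of_PA (St w) -> inj_le (dom P) [set: L] -> ProperFilter F ->
  exists (P' : prestructure K) (x : K), [/\ wfp P', elem P P', inj_le (dom P') [set: L], dom P' x &
   [/\ (forall s, F [set t | t <> s]) -> ~ dom P x,
     forall (V : Type) (v : V -> St w) (q : form (option V)),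
       F [set t | holds q (extend v t)] -> psat P' q (extend (fun i => el (v i)) x) &
     forall A B : set (St w), (forall u v, A u -> B v -> less u v) -> Fgood F A B ->
       goodP P' (@el _ _ w @` A) (@el _ _ w @` B)]].
Proof.
move=> hM leP PF; set M := St w in hM F PF *.
have [U [UU FU]] := ultraFilterLemma PF.
have PU : ProperFilter U := @ultra_proper _ _ UU.
have leM : inj_le [set: M] [set: L].
  case: leP => f [_ fI]; exists (fun x => f (el x)); split=> // x y _ _ /fI e.
  by apply: (@el_inj _ _ w); apply: e; exact: el_dom.
have [g [gI gU]] := K_compl hL hpow hK leP.
have [k [_ kI]] := Dfn_le leM.
pose cls (h : M -> M) := fun h' => Dfn setT h' /\ U [set t | h t = h' t].
pose rep (h : M -> M) : M -> M := if pselect (exists h', cls h h') is left e then sval (cid e) else h.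
have repP h : Dfn setT h -> cls h (rep h).
  move=> dh; rewrite /rep; case: pselect => [e|[]]; first by case: cid.
  by exists h; split=> //; apply: filterE.
have rep_eq h h' : U [set t | h t = h' t] -> Dfn setT h -> Dfn setT h' -> rep h = rep h'.
  move=> Uh dh dh'; rewrite /rep (_ : cls h = cls h'); first by
    case: pselect => // -[]; exists h'; split=> //; exact: filterE.
  apply: funext => h1; apply: propext; split=> -[d1 U1]; split=> //.
    by apply: filterS (filterI Uh U1) => t [/= <-].
  by apply: filterS (filterI Uh U1) => t [/= ->].
(* Functions constant modulo [U] go to the constant itself, so that [P] is literally contained in
   the ultrapower; all other classes receive points of [K] outside [P]. *)
pose psi (h : M -> M) : K := if pselect (exists x : M, U [set t | h t = x]) is left e
  then el (sval (cid e)) else g (k (rep h)).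
have psi_cst h (x : M) : U [set t | h t = x] -> psi h = el x.
  move=> Ux; rewrite /psi; case: pselect => [e|[]]; last by exists x.
  case: cid => y /= Uy; congr el.
  by have [t [/= <- <-]] := filter_ex (filterI Uy Ux).
have psi_new h : ~ (exists x : M, U [set t | h t = x]) -> psi h = g (k (rep h)).
  by rewrite /psi; case: pselect.
have psiP h h' : Dfn setT h -> Dfn setT h' -> (psi h = psi h' <-> U [set t | h t = h' t]).
  move=> dh dh'; split=> [|Uh]; last first.
    have [[x Ux]|nx] := pselect (exists x : M, U [set t | h' t = x]).
      rewrite (psi_cst h' x) // (psi_cst h x) //.
      by apply: filterS (filterI Uh Ux) => t [/= ->].
    rewrite !psi_new // ?(rep_eq h h') // => -[x Ux]; apply: nx; exists x.
    by apply: filterS (filterI Uh Ux) => t [/= ->].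
  have [[x Ux]|nx] := pselect (exists x : M, U [set t | h t = x]);
    have [[x' Ux']|nx'] := pselect (exists x : M, U [set t | h' t = x]).
  - rewrite (psi_cst h x) // (psi_cst h' x') // => /(@el_inj _ _ w) e.
    by apply: filterS (filterI Ux Ux') => t [/= -> ->].
  - rewrite (psi_cst h x) // (psi_new h') // => e; case: (gU (k (rep h'))).
    by rewrite -e; exact: el_dom.
  - rewrite (psi_cst h' x') // (psi_new h) // => e; case: (gU (k (rep h))).
    by rewrite e; exact: el_dom.
  - rewrite !psi_new // => /gI /kI e.
    have [d1 U1] := repP _ dh; have [d2 U2] := repP _ dh'.
    have {}e := e d1 d2; rewrite e in U1.
    by apply: filterS (filterI U1 U2) => t [/= -> ->].
pose P' := ultrapower (T := K) setT U psi.
have w' : wfp P' := ultrapower_wf psiP.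
have lo := los hM UU psiP.
have dcst (x : M) : Dfn setT (fun=> x) by exact: dfun_cst.
have did : Dfn setT (fun x : M => x) by exact: dfun_var.
have pcst (x : M) : psi (fun=> x) = el x by apply: psi_cst; exact: filterE.
have UE (A : Prop) : U [set t | A] <-> A.
  split=> [Ua|a]; last exact: filterE.
  by have [] := filter_ex Ua.
have PP' : elem P P'.
  split=> [x dx|V p v vP].
    by exists (fun=> mk w dx) => //; rewrite pcst mkE.
  have vE : v = (fun i => psi (fun=> mk w (vP i))) by apply: funext => i; rewrite pcst mkE.
  rewrite [in X in _ <-> X]vE (lo _ p (fun i _ => mk w (vP i))) // UE psatP.
  by rewrite (_ : (fun i => el (mk w (vP i))) = v) //; apply: funext => i; rewrite mkE.
exists P', (psi id); split=> //.
- apply: inj_le_trans (Dfn_le leM).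
  by apply: (@inj_le_surj _ _ (fun x => x) _ _ psi) => x [h dh <-]; exists h.
- by exists id.
split.
- move=> Fn dx; have := psiP id (fun=> mk w dx) did (dcst _).
  rewrite pcst mkE => -[/(_ erefl) U1 _].
  by have [t [/= e /(_ e)]] := filter_ex (filterI U1 (FU _ (Fn (mk w dx)))).
- move=> V v q /FU Uq.
  rewrite (_ : extend _ _ = fun i => psi (if i is Some j then fun=> v j else id)).
    apply/lo; first by case.
    by apply: filterS Uq => t /= H; apply/(holds_vars _).1: H; case.
  by apply: funext => -[j|//] /=; rewrite pcst.
move=> A B AB Fg; split.
- by move=> _ [u _ <-]; apply: PP'.1; exact: el_dom.
- by move=> _ [u _ <-]; apply: PP'.1; exact: el_dom.
exists w'; split.
  move=> x y [u Au e1] [v Bv e2]; apply/el_less; rewrite -e1 -e2.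
  apply/(elem_less PP'); [exact: el_dom|exact: el_dom|].
  by apply/el_less; exact: AB.
move=> d sd.
have /choice [H HP] (z : St w') : exists h, Dfn setT h /\ psi h = el z.
  by have [h] := el_dom z; exists h.
have /choice [l lP] z : exists l : seq M, Dfn (fun x => List.In x l) (H z).
  by have [l [_ dl]] := def_finite (HP z).1; exists l.
(* Each element of [d] is the class of a function with finitely many parameters. The set [e] of all
   these parameters is small by regularity, and every element definable from [d] is the class of a
   function definable from [e]. *)
pose e x := exists2 z, d z & List.In x (l z).
have se : small L e by apply: small_bigcup => // z _; exact: small_In.
have [u [v [Au Bv uv]]] := Fg e se.
have du : dom P' (el u) by apply: PP'.1; exact: el_dom.
have dv : dom P' (el v) by apply: PP'.1; exact: el_dom.
exists (mk w' du), (mk w' dv); split; [by exists u; rewrite ?mkE|by exists v; rewrite ?mkE|].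
move=> z [p pP].
pose G (y : M -> M) (i : nat + {x | d x}) : M -> M :=
  match i with inl 0 => y | inl _ => fun=> zero | inr q => H (sval q) end.
have dG y : Dfn setT y -> forall i, Dfn setT (G y i).
  by move=> dy [[|n]|q] //=; exact: (HP _).1.
have key y : Dfn setT y -> psi y = el z <-> U [set t | holds p (fun i => G y i t)].
  move=> dy; rewrite -lo; last exact: dG.
  have dpsi h : Dfn setT h -> dom P' (psi h) by move=> dh; exists h.
  pose r n := if n is 0 then mk w' (dpsi y dy) else mk w' (dpsi _ (dcst zero)).
  have -> : (fun i => psi (G y i)) = (fun i => el (@assign (St w') d r i)).
    by apply: funext => -[[|n]|q] /=; rewrite ?mkE // (HP _).2.
  rewrite -psatP -pP /=; split=> [h|<-]; last by rewrite mkE.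
  by apply: el_inj; rewrite mkE.
have [|h [dh hP]] := @skolem _ hM e (fun t a => holds p (fun i => G (fun=> a) i t)).
  apply: (@def_ext _ _ (fun r => holds p (fun i => match i with inl 0 => fun r : nat -> M => r 1
    | inl _ => fun=> zero | inr q => fun r => H (sval q) (r 0) end r))).
    by move=> r; apply: holds_vars => -[[|n]|q].
  apply: def_holds => -[[|n]|q]; [exact: dfun_var|exact: dfun_zero|].
  by apply: dfun_sub (lP (sval q)) => x xl; exists (sval q) => //; exact: proj2_sig.
have dhT : Dfn setT h by exact: dfun_sub dh.
have ez : psi h = el z.
  apply/key => //; have /key := (HP z).2 => /(_ (HP z).1) Uz.
  apply: filterS Uz => t /= Hz.
  have /hP : exists a, holds p (fun i => G (fun=> a) i t).
    by exists (H z t); apply/(holds_vars _).1: Hz; case=> [[]|].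
  by move=> H1; apply/(holds_vars _).1: H1; case=> [[]|].
have /FU Uo := uv h dh.
rewrite /outside !el_less !mkE -ez -!pcst.
have [Ul|Ul] := in_ultra_setVsetC [set t | less (h t) u] UU; [left|right].
  by apply/(ultrapower_less UU psiP).
apply/(ultrapower_less UU psiP) => //.
by apply: filterS (filterI Uo Ul) => t /= [[]].
Qed.

End Cuts.

(** * Filters preserving good cuts *)

Definition cap (T : Type) (l : seq (set T)) : set T := fun x => forall X, List.In X l -> X x.

Lemma def_cap (M : structure) (d : set M) (l : seq (set M)) :
  (forall X, List.In X l -> Def d (fun r => X (r 0))) -> Def d (fun r => cap l (r 0)).
Proof.
elim: l => [|X l IH] h; first by apply: def_ext (def_true d) => r; split=> // _ X [].
apply: (@def_ext _ _ (fun r => X (r 0) /\ cap l (r 0))).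
  move=> r; split=> [[Xr lr] Y [<-//|/lr//]|hr]; split=> [|Y Yl]; apply: hr; by [left|right].
by apply: def_and; [apply: h; left|apply: IH => Y Yl; apply: h; right].
Qed.

Section Filters.
Variables (dL : Order.disp_t) (L : orderType dL).
Hypothesis hL : is_infinite_cardinal L.
Hypothesis hpow : ([set: short_seq L] #= [set: L])%card.

Lemma inj_le_setU (T : Type) (A B : set T) :
  inj_le A [set: L] -> inj_le B [set: L] -> inj_le (A `|` B) [set: L].
Proof.
move=> lA lB; have [n nI] := nat_inj_L hL.
apply: (@inj_le_trans _ _ _ _ (fun y => exists2 b : bool, setT b & (if b then A else B) y)).
  by apply: inj_le_sub => y [h|h]; [exists true|exists false].
apply: (inj_le_bigcup hL hpow); last by case.
by exists (fun b : bool => n b); split=> // -[] [] _ _ // /nI //.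
Qed.

Lemma inj_le_set1 (T : Type) (x : T) : inj_le [set x] [set: L].
Proof. by have [n nI] := nat_inj_L hL; exists (fun=> n 0); split=> // y z -> ->. Qed.

Lemma small_below (i : L) : small L (below i).
Proof. by apply: card_lt_small; have [[_ h] _] := hL; exact: h. Qed.

Variable M : structure.
Hypothesis hM : model_of_PA M.
Hypothesis leM : inj_le [set: M] [set: L].
Variable DD : set (set M * set M).
Hypothesis leD : inj_le DD [set: L].
Hypothesis goodD : forall D, DD D -> good L D.1 D.2.

(** There are at most [|L|] cuts and, by [small_sets_le], at most [|L|] small sets. The dummy pair
    of empty sets makes every small set occur even when there is no cut. *)
Lemma task_enum : exists E : L -> (set M * set M) * set M,
  (forall i, small L (E i).2) /\
  (forall e, small L e -> exists i, (E i).2 = e) /\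
  forall D e, DD D -> small L e -> exists i, E i = (D, e).
Proof.
pose S := [set x : (set M * set M) * set M |
  (DD `|` [set (set0, set0)]) x.1 /\ [set d : set M | small L d /\ d `<=` setT] x.2].
have leS : inj_le S [set: L].
  apply: (inj_le_setX hL hpow); last exact: small_sets_le.
  by apply: inj_le_setU => //; exact: inj_le_set1.
have S0 : S ((set0, set0), set0) by split=> /=; [right|split=> //; exact: small_set0].
have [E [ES EP]] := inj_le_enum S0 leS.
exists E; split=> [i|]; first by have [_ []] := ES i.
split=> [e se|D e DDD se].
  have [|i iP] := EP ((set0, set0), e); last by exists i; rewrite iP.
  by split=> /=; [right|split].
by have [|i iP] := EP (D, e); [split=> /=; [left|split]|exists i].
Qed.

Local Notation two := (add (@one M) one).

(* A filter of big sets is extended in L steps; step i meets the requirement that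
   the functions definable over the i-th small set avoid some interval of the i-th
   cut, which costs only finitely many factors of two by [avoid]. *)
Lemma ordinary_filter (d0 : set M) (G0 : set (set M)) : small L d0 ->
  (forall X, G0 X -> Def d0 (fun r => X (r 0))) ->
  (forall l, (forall X, List.In X l -> G0 X) -> big two (cap l)) ->
  exists F : set_system M, [/\ ProperFilter F, G0 `<=` F, forall s, F [set t | t <> s] &
    forall D, DD D -> Fgood L F D.1 D.2].
Proof.
move=> sd0 defG0 bigG0; have [E [Es [_ EP]]] := task_enum.
have [wo card] := hL.1.
have [h hP] : exists h : L -> set M * set (set M), forall i,
  [/\ small L (h i).1, forall X, (h i).2 X -> Def (h i).1 (fun r => X (r 0)),
    forall l, (forall X, List.In X l -> (h i).2 X) -> big two (cap l),
    d0 `<=` (h i).1 /\ G0 `<=` (h i).2 &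
    (forall j, (j < i)%O -> (h j).1 `<=` (h i).1 /\ (h j).2 `<=` (h i).2) /\
    (DD (E i).1 -> exists u v, [/\ (E i).1.1 u, (E i).1.2 v &
      forall g, Dfn (E i).2 g -> (h i).2 [set t | outside u v (g t)]])].
  apply: (wf_choice wo (d0, G0) (R := fun i h s =>
  [/\ small L s.1, forall X, s.2 X -> Def s.1 (fun r => X (r 0)),
    forall l, (forall X, List.In X l -> s.2 X) -> big two (cap l),
    d0 `<=` s.1 /\ G0 `<=` s.2 &
    (forall j, (j < i)%O -> (h j).1 `<=` s.1 /\ (h j).2 `<=` s.2) /\
    (DD (E i).1 -> exists u v, [/\ (E i).1.1 u, (E i).1.2 v &
      forall g, Dfn (E i).2 g -> s.2 [set t | outside u v (g t)]])])).
    move=> i h h' s hh' [s1 s2 s3 s4 [s5 s6]]; split=> //; split=> // j ji.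
    by rewrite -hh' //; exact: s5.
  move=> i h IH.
  pose d1 : set M := (d0 `|` (fun x => exists2 j, below i j & (h j).1 x)) `|` ((E i).2 `|` [set two]).
  pose G1 : set (set M) := G0 `|` (fun X => exists2 j, below i j & (h j).2 X).
  have sd1 : small L d1.
    apply: small_setU => //; apply: small_setU => //; last exact: small_set1.
    by apply: small_bigcup => //; [exact: small_below|move=> j /IH []].
  have defG1 X : G1 X -> Def d1 (fun r => X (r 0)).
    move=> [/defG0|[j ji Xj]]; first by apply: def_sub => x; left; left.
    have [_ /(_ X Xj) D1 _ _ _] := IH j ji; apply: def_sub D1 => x xj.
    by left; right; exists j.
  (* Finitely many earlier conditions already belong to a single earlier step, so bigness passes to
     limits. *)
  have chain (l : seq (set M)) : (forall X, List.In X l -> G1 X) ->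
      (forall X, List.In X l -> G0 X) \/
      exists2 j, below i j & forall X, List.In X l -> (h j).2 X.
    elim: l => [|X l IHl] hl; first by left.
    have [|l0|[j ji lj]] := IHl; first by move=> Y Yl; apply: hl; right.
      case: (hl X (or_introl erefl)) => [X0|[j ji Xj]].
        by left=> Y [<-|/l0].
      right; exists j => // Y [<-//|/l0 Y0].
      by have [_ _ _ [_ s] _] := IH j ji; exact: s.
    right; case: (hl X (or_introl erefl)) => [X0|[j' ji' Xj']].
      exists j => // Y [<-|/lj//]; by have [_ _ _ [_ s] _] := IH j ji; exact: s.
    case: (Order.TotalTheory.ltgtP j j') => jj'.
    - exists j' => // Y [<-//|/lj Yj]; by have [_ _ _ _ [/(_ j jj') [_ s] _]] := IH j' ji'; exact: s.
    - exists j => // Y [<-|/lj//]; by have [_ _ _ _ [/(_ j' jj') [_ s] _]] := IH j ji; exact: s.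
    - by exists j => // Y [<-|/lj//]; rewrite jj'.
  have bigG1 l : (forall X, List.In X l -> G1 X) -> big two (cap l).
    move=> /chain [|[j ji hl]]; first exact: bigG0.
    by have [_ _ + _ _] := IH j ji; apply.
  have sub1 j : (j < i)%O -> (h j).1 `<=` d1 /\ (h j).2 `<=` G1.
    by move=> ji; split=> [x xj|X Xj]; [left; right; exists j|right; exists j].
  have [DDi|nDD] := pselect (DD (E i).1); last first.
    exists (d1, G1); split=> //=; split.
      by move=> x; left; left.
    by move=> X; left.
  have [AB /(_ d1 sd1) [u [v [Au Bv out]]]] := goodD DDi.
  pose G2 : set (set M) := G1 `|` (fun X => exists2 g, Dfn (E i).2 g & X = [set t | outside u v (g t)]).
  exists (d1 `|` [set u; v], G2); split=> /=.
  - apply: small_setU => //; apply: small_finite => //; exact: finite_set2.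
  - move=> X [/defG1|[g dg ->]]; first by apply: def_sub => x; left.
    have dg2 : Dfun (d1 `|` [set u; v]) (fun r => g (r 0)).
      by apply: dfun_sub dg => x xe; left; right; left.
    by apply: def_or; apply: def_less => //; apply: dfun_cst; right; [left|right].
  - move=> l hl n.
    have [l1 [hs [l1G hsD sub]]] : exists l1 hs, [/\ forall X, List.In X l1 -> G1 X,
        forall g, List.In g hs -> Dfn (E i).2 g &
        forall x, cap l1 x -> (forall g, List.In g hs -> outside u v (g x)) -> cap l x].
      elim: l hl => [|X l IHl] hl; first by exists [::], [::].
      have [|l1 [hs [l1G hsD sub]]] := IHl; first by move=> Y Yl; apply: hl; right.
      case: (hl X (or_introl erefl)) => [X1|[g dg XE]].
        exists (X :: l1), hs; split=> // [Y [<-|/l1G]//|x cx ox Y].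
        case=> [<-|Yl]; first by apply: cx; left.
        by apply: sub => // Z Zl; apply: cx; right.
      exists l1, (g :: hs); split=> // [f [<-|/hsD]//|x cx ox Y].
      case=> [<-|Yl]; first by rewrite XE; apply: ox; left.
      by apply: sub => // f fl; apply: ox; right.
    have dX : Def d1 (fun r => cap l1 (r 0)) by apply: def_cap => X /l1G /defG1.
    have dhs g : List.In g hs -> Dfun d1 (fun r => g (r 0)).
      by move=> /hsD; apply: dfun_sub => x xe; right; left.
    have := @avoid M hM d1 two u v (cap l1) hs n (le_refl _) _ (lt_le (AB _ _ Au Bv)) out dX dhs (bigG1 l1 l1G _).
    move=> /(_ (or_intror (or_intror erefl))) nc; apply: contra_not nc; apply: covered_sub.
    by move=> x [cx ox]; exact: sub.
  - by split=> [x|X]; [left; left; left|left; left].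
  - split=> [j /sub1 [s1 s2]|_]; first by split=> [x /s1|X /s2]; left.
    by exists u, v; split=> // g dg; right; exists g.
have mono i j : (i <= j)%O -> (h i).2 `<=` (h j).2.
  rewrite Order.POrderTheory.le_eqVlt => /orP [/eqP->//|ij].
  by have [_ _ _ _ [/(_ i ij) [_]]] := hP j.
(* Finitely many points [ys] may be discarded, which puts the complement of every point into [F];
   properness survives because finite sets are not big. *)
pose F : set_system M := fun Y => exists i l ys, (forall X, List.In X l -> (h i).2 X) /\
  forall x, cap l x -> ~ List.In x ys -> Y x.
have [i0 _] := nat_inj_L hL.
exists F; split.
- apply: Build_ProperFilter_ex.
    move=> Y [i [l [ys [hl lY]]]]; apply: contrapT => nY.
    have [_ _ /(_ l hl (size ys)) nc _ _] := hP i; apply: nc.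
    have := @covered_bigU M hM two (le_refl _) M ys (fun y => [set y]) 0.
    rewrite add0n => cov; apply: covered_sub (cov _) => [x cx|p _]; last exact: covered_set1.
    have [xy|xy] := pselect (List.In x ys); first by exists x.
    by case: nY; exists x; exact: lY.
  split.
  + by exists (i0 0), [::], [::].
  + move=> Y Z [i [l [ys [hl lY]]]] [i' [l' [ys' [hl' lZ]]]].
    exists (Order.max i i'), (l ++ l'), (ys ++ ys'); split.
      move=> X; rewrite In_cat => -[/hl|/hl'] h'; apply: mono h'.
        by rewrite Order.TotalTheory.le_max Order.POrderTheory.lexx.
      by rewrite Order.TotalTheory.le_max Order.POrderTheory.lexx orbT.
    move=> x cx nx; split; [apply: lY|apply: lZ] => [X Xl|xy|X Xl|xy].
    * by apply: cx; rewrite In_cat; left.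
    * by apply: nx; rewrite In_cat; left.
    * by apply: cx; rewrite In_cat; right.
    * by apply: nx; rewrite In_cat; right.
  + move=> Y Z YZ [i [l [ys [hl lY]]]]; exists i, l, ys; split=> // x cx nx.
    by apply: YZ; exact: lY.
- move=> X X0; exists (i0 0), [:: X], [::]; split=> [Y [<-|//]|x cx _].
    by have [_ _ _ [_ s] _] := hP (i0 0); exact: s.
  by apply: cx; left.
- move=> s; exists (i0 0), [::], [:: s]; split=> // x _ xs e; apply: xs; left; exact: esym.
- move=> D DDD e se; have [i EiE] := EP D e DDD se.
  have [_ _ _ _ [_]] := hP i; rewrite EiE => /(_ DDD) [u [v [Au Bv out]]].
  exists u, v; split=> // g dg; exists i, [:: [set t | outside u v (g t)]], [::].
  split=> [Y [<-|//]|x cx _]; first exact: out.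
  by apply: cx; left.
Qed.

Definition coded (m b y x : M) := less x b /\ member m y x.

Definition flat (a : M) (g : M -> M) (X : set M) :=
  forall x x', X x -> X x' -> g x = g x' \/ (le a (g x) /\ le a (g x')).

(* y codes a big subset of every set coded in d0, on which each d-definable
   function is constant or at least a, and avoids the interval [u, v] if
   o = Some (u, v). *)
Definition refinement (a b m : M) (d d0 : set M) (o : option (M * M)) (y : M) := [/\ big a (coded m b y),
  forall z, d0 z -> coded m b y `<=` coded m b z,
  forall g, Dfn d g -> flat a g (coded m b y) &
  forall u v, o = Some (u, v) -> forall g, Dfn d g -> forall x, coded m b y x -> outside u v (g x)].

Definition refinable (a b m : M) (d d0 : set M) (o : option (M * M)) :=
  [/\ small L d, d a /\ d b /\ d m, d0 `<=` d,
    forall u v, o = Some (u, v) -> le u v /\ forall z, dcl d z -> outside u v z &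
    forall l, (forall z, List.In z l -> d0 z) -> exists y,
      big a (coded m b y) /\ forall z, List.In z l -> coded m b y `<=` coded m b z].

(** * A filter filling a cut whose image under [h] stays good *)

Section Kill.
Variables (a b m : M) (h : M -> M).
Hypothesis a2 : le two a.
Hypothesis powb : forall n, le (power a n) b.
Hypothesis hmono : forall x y, less x y <-> less (h x) (h y).
Hypothesis hsurj : forall y, exists x, h x = y.
Hypothesis hb : h b = a.
Hypothesis N1 : forall d d0 o, refinable a b m d d0 o -> exists y, refinement a b m d d0 o y.
Hypothesis N2 : forall d y, small L d -> big a (coded m b y) -> exists s t y',
  [/\ big a (coded m b y'), coded m b y' `<=` coded m b y,
    forall x, coded m b y' x -> le s x /\ less x t &
    forall z, le s z -> le z t -> ~ dcl d (h z)].

(** From [a^n + 1 <= 2 * a^n <= a^(n+1) <= b], a covering of [[0, b)] by [a^n] would contradict the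
    pigeonhole principle. *)
Lemma big_lt : big a (fun x => less x b).
Proof.
move=> n cov; apply: (@pigeonhole _ hM (power a n)); apply: covered_sub cov => x xb.
apply: (lt_le_trans hM xb); apply: le_trans (powb n.+1) => //=.
rewrite (pmulC hM); apply: (@le_trans _ hM _ (mul two (power a n))); last first.
  by apply: le_mul => //; exact: le_refl.
rewrite (pmulDl hM) (pmul1l hM); apply: le_add => //; first exact: le_refl.
by apply: pow_gt0 => //; exact: base_ge1.
Qed.

Lemma big_ex (X : set M) : big a X -> exists x, X x.
Proof.
move=> bX; apply: contrapT => nX; apply: (bX 0); apply: covered_le (le0 hM _) _ => //.
by apply: covered_sub (covered_set0 hM) => x Xx; apply: nX; exists x.
Qed.

(* The conditions are codes of big subsets of [0, b). Values of h on [0, b) lie below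
   a, so functions that are constant or at least a on a condition avoid h[s, t] once
   [s, t] is chosen by [N2]. *)
Lemma kill_filter : exists (F : set_system M) (A B : set M), [/\ ProperFilter F,
  (forall s, A s -> F [set x | le s x]), (forall t, B t -> F [set x | less x t]),
  (forall s t, A s -> B t -> less s t) &
  Fgood L F (h @` A) (h @` B) /\ forall D, DD D -> Fgood L F D.1 D.2].
Proof.
have [E [Es [Ee EP]]] := task_enum; have [wo card] := hL.1.
have [H HP] : exists H : L -> M, forall i, [/\ big a (coded m b (H i)),
   forall j, (j < i)%O -> coded m b (H i) `<=` coded m b (H j),
   DD (E i).1 -> exists u v, [/\ (E i).1.1 u, (E i).1.2 v &
     forall g, Dfn (E i).2 g -> forall x, coded m b (H i) x -> outside u v (g x)] &
   exists s t, (forall x, coded m b (H i) x -> le s x /\ less x t) /\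
     forall g, Dfn (E i).2 g -> forall x, coded m b (H i) x -> outside (h s) (h t) (g x)].
  apply: (wf_choice wo a (R := fun i H y => [/\ big a (coded m b y),
   forall j, (j < i)%O -> coded m b y `<=` coded m b (H j),
   DD (E i).1 -> exists u v, [/\ (E i).1.1 u, (E i).1.2 v &
     forall g, Dfn (E i).2 g -> forall x, coded m b y x -> outside u v (g x)] &
   exists s t, (forall x, coded m b y x -> le s x /\ less x t) /\
     forall g, Dfn (E i).2 g -> forall x, coded m b y x -> outside (h s) (h t) (g x)])).
    move=> i H H' y HH' [h1 h2 h3 h4]; split=> // j ji; rewrite -HH' //; exact: h2.
  move=> i H IH.
  pose d0 : set M := fun y => exists2 j, below i j & [set H j] y.
  pose d : set M := (d0 `|` (E i).2) `|` [set a; b; m].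
  have sd : small L d.
    apply: small_setU => //; last by apply: small_finite => //; exact: finite_set3.
    apply: small_setU => //; apply: small_bigcup => //; first exact: small_below.
    by move=> j _; exact: small_set1.
  have sub1 g : Dfn (E i).2 g -> Dfn d g by apply: dfun_sub => x; left; right.
  have [da [db dm]] : d a /\ d b /\ d m.
    by split; [|split]; right; [left; left|left; right|right].
  have [o oP] : exists o, (forall u v, o = Some (u, v) ->
        le u v /\ forall z, dcl d z -> outside u v z) /\
      (DD (E i).1 -> exists u v, [/\ (E i).1.1 u, (E i).1.2 v & o = Some (u, v)]).
    have [DDi|nDD] := pselect (DD (E i).1); last by exists None.
    have [AB /(_ d sd) [u [v [Au Bv out]]]] := goodD DDi.
    exists (Some (u, v)); split=> [u' v' [<- <-]|_]; last by exists u, v.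
    by split=> //; apply: lt_le; exact: AB.
  have [|y [yb yd0 yflat yo]] := N1 (d := d) (d0 := d0) (o := o).
    split=> //; first by move=> x xd; left; left.
      exact: oP.1.
    move=> l hl.
    have : (forall z, ~ List.In z l) \/ exists2 j, below i j &
        forall z, List.In z l -> coded m b (H j) `<=` coded m b z.
      elim: l hl => [|z l IHl] hl; first by left=> z [].
      right; have [j ji zj] := hl z (or_introl erefl).
      have [|nl|[j' ji' lj']] := IHl; first by move=> t tl; apply: hl; right.
        by exists j => // t [<-|/nl//]; rewrite zj.
      case: (Order.TotalTheory.ltgtP j j') => jj'.
      - by exists j' => // t [<-|/lj'//]; rewrite zj; have [_ h2 _ _] := IH j' ji'; exact: h2.
      - exists j => // t [<-|/lj' s]; first by rewrite zj.
        by have [_ h2 _ _] := IH j ji; exact: subset_trans (h2 j' jj') s.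
      - by exists j => // t [<-|]; [rewrite zj|rewrite jj'; exact: lj'].
    case=> [nl|[j ji lj]].
      (* Every modulus divides [zero], so [zero] codes the whole of [[0, b)], the weakest
         condition. *)
      exists zero; split=> [|z /nl//]; apply: big_sub big_lt => x xb.
      by split=> //; exists zero; rewrite pmul0.
    by have [bH _ _ _] := IH j ji; exists (H j).
  have sdy : small L (d `|` [set y]) by apply: small_setU => //; exact: small_set1.
  have [s [t [y' [by' y'y y'st stP]]]] := N2 sdy yb.
  exists y'; split=> //.
  - by move=> j ji x /y'y Yx; apply: yd0 Yx; exists j.
  - move=> /oP.2 [u [v [Au Bv oE]]]; exists u, v; split=> // g dg x /y'y Yx.
    by apply: (yo u v oE g) => //; exact: sub1.
  - exists s, t; split=> [x /y'st //|g dg x Yx'].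
    have Yx := y'y _ Yx'; have [sx xt] := y'st _ Yx'.
    (* Surjectivity of [h] writes [z] as [h z'], and monotonicity turns the position of [z] relative
       to [[h s, h t]] into that of [z'] relative to [[s, t]]. *)
    have out z : dcl (d `|` [set y]) z -> outside (h s) (h t) z.
      move=> dz; apply: contrapT => no; have [z' z'E] := hsurj z.
      apply: (stP z'); last by rewrite z'E.
        apply/(leNlt hM) => zs; apply: no; left; rewrite -z'E; exact: ((hmono _ _).1 zs).
      apply/(leNlt hM) => zs; apply: no; right; rewrite -z'E; exact: ((hmono _ _).1 zs).
    have [ga|ag] := pselect (less (g x) a).
      (* A value below [a] is by flatness the only value of [g] on the condition [y], hence
         definable from [d] and [y]. This is why [y] is added to [d] before [N2] is applied. *)
      apply: out; apply: (@def_ext _ _ (fun r => exists x, coded m b y x /\ g x = r 0)).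
        move=> r; split=> [[x' [Yx2 <-]]|->]; last by exists x.
        have /(_ x x' Yx Yx2) := yflat g (sub1 g dg).
        by case=> [->//|[/(leNlt hM)]].
      have dg' : Dfun (d `|` [set y]) (fun r => g (r 0)).
        by apply: dfun_sub (sub1 g dg) => z; left.
      have dy : Dfun (d `|` [set y]) (fun=> y) by apply: dfun_cst; right.
      have dbb : Dfun (d `|` [set y]) (fun=> b) by apply: dfun_cst; left.
      have dmm : Dfun (d `|` [set y]) (fun=> m) by apply: dfun_cst; left.
      apply: def_ex; cbv beta delta [shift]; apply: def_and; last by apply: def_eq => //; dfn.
      by rewrite /coded /member /dvd /modulus; dfn.
    (* If [g x] is at least [a], it suffices that [h t < a = h b]. Otherwise [b] would lie in
       [[s, t]], although [h b = a] is definable from [d]. *)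
    right; apply: (lt_le_trans hM (y := a)); last exact/(leNlt hM).
    rewrite -hb; apply: (hmono _ _).1; apply/(ltNle hM) => bt.
    apply: (stP b) => //; last by rewrite hb; apply: dcl_self; left.
    by apply: (le_trans hM sx); apply: lt_le; case: Yx.
have mono i j : (i <= j)%O -> coded m b (H j) `<=` coded m b (H i).
  rewrite Order.POrderTheory.le_eqVlt => /orP [/eqP->//|ij].
  by have [_ /(_ i ij)] := HP j.
pose F : set_system M := fun Z => exists i, coded m b (H i) `<=` Z.
pose A s := exists i, forall x, coded m b (H i) x -> le s x.
pose B t := exists i, forall x, coded m b (H i) x -> less x t.
have [i0 _] := nat_inj_L hL.
exists F, A, B; split.
- apply: Build_ProperFilter_ex.
    by move=> Z [i iZ]; have [/big_ex [x Yx] _ _ _] := HP i; exists x; exact: iZ.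
  split.
  + by exists (i0 0).
  + move=> Y Z [i iY] [j jZ]; exists (Order.max i j) => x Yx; split.
      by apply: iY; apply: mono Yx; rewrite Order.TotalTheory.le_max Order.POrderTheory.lexx.
    by apply: jZ; apply: mono Yx; rewrite Order.TotalTheory.le_max Order.POrderTheory.lexx orbT.
  + by move=> Y Z YZ [i iY]; exists i => x /iY /YZ.
- by move=> s [i iA]; exists i.
- by move=> t [i iB]; exists i.
- move=> s t [i iA] [j jB]; have [/big_ex [x Yx] _ _ _] := HP (Order.max i j).
  apply: (le_lt_trans hM (y := x)).
    by apply: iA; apply: mono Yx; rewrite Order.TotalTheory.le_max Order.POrderTheory.lexx.
  by apply: jB; apply: mono Yx; rewrite Order.TotalTheory.le_max Order.POrderTheory.lexx orbT.
split=> [e se|D DDD e se].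
  have [i Ei] := Ee e se; have [_ _ _ [s [t [st out]]]] := HP i.
  exists (h s), (h t); split.
  + by exists s => //; exists i => x /st [].
  + by exists t => //; exists i => x /st [].
  + by rewrite -Ei => g dg; exists i => x; exact: out.
have [i Ei] := EP D e DDD se; have [_ _ + _] := HP i.
rewrite Ei => /(_ DDD) [u [v [Au Bv out]]]; exists u, v; split=> // g dg.
by exists i => x; exact: out.
Qed.

End Kill.

End Filters.

(** * Refinements of conditions from saturation *)

Section Saturation.
Variables (dL : Order.disp_t) (L : orderType dL).
Hypothesis hL : is_infinite_cardinal L.
Hypothesis hpow : ([set: short_seq L] #= [set: L])%card.
Variable M : structure.
Hypothesis hM : model_of_PA M.

Definition set_saturated := forall A : set M, small L A -> forall G : set (set M),
  (forall X, G X -> Def A (fun r => X (r 0))) ->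
  (forall l, (forall X, List.In X l -> G X) -> exists b, cap l b) ->
  exists b, forall X, G X -> X b.

Lemma saturated_of_sets : set_saturated -> saturated L M.
Proof.
move=> sat A ltA p hp.
have [||b bP] := sat A (card_lt_small ltA) (fun X => exists2 f, p f & X = satisfies f);
  last by exists b => f pf; apply: (bP (satisfies f)); exists f.
- move=> _ [f pf ->].
  apply: (@def_ext _ _ (fun r => holds f (fun i => match i with None => fun r : nat -> M => r 0
     | Some x => fun=> sval x end r))).
    by move=> r; apply: holds_vars => -[].
  apply: def_holds => -[x|]; [apply: dfun_cst; exact: proj2_sig|exact: dfun_var].
- move=> l hl.
  have [q [qp ql]] : exists q : seq (form (option {x | A x})), (forall f, List.In f q -> p f) /\
      forall X, List.In X l -> exists2 f, List.In f q & X = satisfies f.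
    elim: l hl => [|X l IH] hl; first by exists [::].
    have [|q [qp ql]] := IH; first by move=> Y Yl; apply: hl; right.
    have [f pf XE] := hl X (or_introl erefl).
    exists (f :: q); split=> [g [<-|/qp]//|Y [<-|/ql [g gq ->]]].
      by exists f => //; left.
    by exists g => //; right.
  have [b bP] := hp (fun f => List.In f q) qp (In_finite q).
  by exists b => X /ql [f /bP fb ->].
Qed.

Hypothesis sat : set_saturated.
Variables (a b m : M).
Hypothesis a2 : le (add one one) a.
Hypothesis mb : divisible_upto m b.

(** Cutting [g] off at [a] leaves [a + 1] values, and a fiber of the cut-off function is flat for
    [g]. By [cap_fiber] each function costs two powers of [a], which explains the doubled length. *)
Lemma flat_fibers (gs : seq (M -> M)) n : forall X : set M, Def setT (fun r => X (r 0)) ->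
  (forall g, List.In g gs -> Dfn setT g) -> ~ covered X (power a (n + (size gs).*2)) ->
  exists Y : set M, [/\ Y `<=` X, Def setT (fun r => Y (r 0)), ~ covered Y (power a n) &
    forall g, List.In g gs -> flat a g Y].
Proof.
elim: gs => [|g gs IH] X dX dgs nc.
  by exists X; split=> //; rewrite addn0 in nc.
pose cg x := if pselect (less (g x) a) then g x else a.
have cgP x : (less (g x) a /\ cg x = g x) \/ (~ less (g x) a /\ cg x = a).
  by rewrite /cg; case: pselect => h /=; [left|right].
have dg : Dfun setT (fun r => g (r 0)) by apply: dgs; left.
have dcg : Dfun setT (fun r => cg (r 0)).
  have dg1 : Dfun setT (fun r => g (r 1)) by exact: dfn_rename.
  apply: (@def_ext _ _ (fun r => (less (g (r 1)) a /\ r 0 = g (r 1)) \/ (~ less (g (r 1)) a /\ r 0 = a))).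
    move=> r; case: (cgP (r 1)) => -[h ->]; split; [|by left|case=> [[]|[]]//|by right].
    by case=> [[]//|[]].
  by dfn.
have ca x : X x -> le (cg x) a by move=> _; case: (cgP x) => -[h ->]; [left|right].
rewrite /= doubleS !addnS in nc.
have [k nk] := cap_fiber hM a2 dX dcg ca nc.
have [||Y [YX dY nY fY]] := IH (fun x => X x /\ cg x = k) _ _ nk.
- by apply: def_and => //; apply: def_eq => //; dfn.
- by move=> f fs; apply: dgs; right.
exists Y; split=> // [x /YX []//|f [<-|/fY//]].
move=> x x' /YX [_ e] /YX [_ e'].
case: (cgP x) => -[h cE]; case: (cgP x') => -[h' cE'].
- by left; rewrite -cE -cE' e e'.
- by exfalso; apply: (@lt_irr _ hM a); rewrite -{1}cE' e' -e cE.
- by exfalso; apply: (@lt_irr _ hM a); rewrite -{1}cE e -e' cE'.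
- by right; split; apply/(leNlt hM).
Qed.

Lemma def_coded (d : set M) : d b -> d m -> Def d (fun r => coded m b (r 0) (r 1)).
Proof.
move=> db dm; have dbb : Dfun d (fun=> b) by exact: dfun_cst.
have dmm : Dfun d (fun=> m) by exact: dfun_cst.
by rewrite /coded /member /dvd /modulus; dfn.
Qed.

Definition finite_refinement (o : option (M * M)) n (zs : seq M) (gs : seq (M -> M)) y :=
  [/\ ~ covered (coded m b y) (power a n),
    forall z, List.In z zs -> coded m b y `<=` coded m b z,
    forall g, List.In g gs -> flat a g (coded m b y) &
    forall u v, o = Some (u, v) -> forall g, List.In g gs ->
      forall x, coded m b y x -> outside u v (g x)].

(** The intersection of the given conditions is big, so exponents are free: avoid the interval first
    by [avoid], then flatten, then code the definable set that remains. *)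
Lemma finite_refinement_ex d d0 o n zs gs : refinable L a b m d d0 o ->
  (forall z, List.In z zs -> d0 z) -> (forall g, List.In g gs -> Dfn d g) ->
  exists y, finite_refinement o n zs gs y.
Proof.
move=> [sd [da [db dm]] d0d oP bigP] hzs hgs.
pose X0 x := less x b /\ forall z, List.In z zs -> coded m b z x.
have dX0 : Def d (fun r => X0 (r 0)).
  have dbb : Dfun d (fun=> b) by exact: dfun_cst.
  apply: def_and; first by dfn.
  apply: (@def_ext _ _ (fun r => cap (map (coded m b) zs) (r 0))).
    move=> r; rewrite /cap; split=> [h z zl|h X].
      by apply: h; elim: (zs) zl => //= t s IH [->|/IH]; [left|right].
    by elim: (zs) h => //= t s IH h [<-|/IH]; [apply: h; left|apply=> z zs'; apply: h; right].
  apply: def_cap => X; elim: (zs) hzs => //= t s IH hzs [<-|/IH]; last by apply=> z zs'; apply: hzs; right.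
  have dt : Dfun d (fun=> t) by apply: dfun_cst; apply: d0d; apply: hzs; left.
  by apply: (@def_app2 _ _ (coded m b)) => //; [exact: def_coded|dfn].
have dsub : forall g, List.In g gs -> Dfn setT g by move=> g /hgs; exact: dfun_sub.
have bigX0 : big a X0.
  have [y0 [by0 y0z]] := bigP zs hzs; apply: big_sub by0 => x Yx.
  by split=> [|z zl]; [case: Yx|exact: y0z].
have [X1 [X10 dX1 nX1 oX1]] : exists X1 : set M, [/\ X1 `<=` X0, Def setT (fun r => X1 (r 0)),
    ~ covered X1 (power a (n + (size gs).*2)) &
    forall u v, o = Some (u, v) -> forall g, List.In g gs -> forall x, X1 x -> outside u v (g x)].
  case: o oP => [[u v]|] oP; last first.
    by exists X0; split=> //; exact: def_sub dX0.
  have [uv out] := oP u v erefl.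
  exists (fun x => X0 x /\ forall g, List.In g gs -> outside u v (g x)); split.
  - by move=> x [].
  - apply: (@def_app3 _ _ (fun x y z => X0 x /\ forall g, List.In g gs -> outside y z (g x))
       (fun r => r 0) (fun=> u) (fun=> v)); try by dfn.
    by apply: def_outside_list => //; exact: def_sub dX0.
  - by apply: (avoid hM a2 da uv out dX0 hgs); exact: bigX0.
  - by move=> u' v' [<- <-] g gs' x [_]; exact.
have [X2 [X21 dX2 nX2 fX2]] := flat_fibers dX1 dsub nX1.
have [y yP] := coding hM dX2 mb.
have YE x : coded m b y x <-> X2 x.
  split=> [[xb]|Xx]; first by rewrite yP.
  have [xb _] := X10 _ (X21 _ Xx); by split=> //; rewrite yP.
exists y; split.
- by apply: contra_not nX2; apply: covered_sub => x; rewrite YE.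
- by move=> z zl x /YE /X21 /X10 [_]; exact.
- by move=> g /fX2 fg x x' /YE Xx /YE Xx'; exact: fg.
- by move=> u v oE g gs' x /YE /X21; exact: oX1.
Qed.

(** The clauses of [refinement] form a type in the code [y] over the small set [A]: a condition for
    each standard power, each earlier code and each [d]-definable function. Saturation reduces it to
    finitely many clauses. *)
Lemma refinement_ex d d0 o : refinable L a b m d d0 o -> exists y, refinement a b m d d0 o y.
Proof.
move=> hyp; have [sd [da [db dm]] d0d oP bigP] := hyp.
pose A : set M := d `|` (fun x => exists u v, o = Some (u, v) /\ [set u; v] x).
have sA : small L A.
  apply: small_setU => //; case: (o) => [[u v]|]; last first.
    by apply: (@small_sub _ _ _ _ set0); [move=> x [u [v []]]|exact: small_set0].
  apply: (@small_sub _ _ _ _ [set u; v]); first by move=> x [u' [v' [[<- <-]]]].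
  by apply: small_finite => //; exact: finite_set2.
have dA : d `<=` A by move=> x; left.
have dY : Def A (fun r => coded m b (r 0) (r 1)) by apply: def_coded; left.
pose C0 n := [set y | ~ covered (coded m b y) (power a n)].
pose C1 z := [set y | coded m b y `<=` coded m b z].
pose C2 g := [set y | flat a g (coded m b y)].
pose C3 g := [set y | forall u v, o = Some (u, v) -> forall x, coded m b y x -> outside u v (g x)].
pose G : set (set M) := fun X => [\/ exists n, X = C0 n, exists2 z, d0 z & X = C1 z,
  exists2 g, Dfn d g & X = C2 g | exists2 g, Dfn d g & X = C3 g].
have dYr i j : Def A (fun r => coded m b (r i) (r j)).
  by apply: (@def_app2 _ _ (coded m b)) => //; dfn.
have [y yP] : exists y, forall X, G X -> X y.
  apply: (sat sA) => [X [[n ->]|[z d0z ->]|[g dg ->]|[g dg ->]]|l hl].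
  - apply: def_not; apply: (@def_covered _ _ (fun x r => coded m b (r 0) x)).
      exact: (dYr 1 0).
    by apply: (@dcl_pow _ A); exact: dA.
  - have dz : Dfun A (fun=> z) by apply: dfun_cst; apply: dA; exact: d0d.
    apply: def_all; cbv beta delta [shift]; apply: def_imp; first exact: (dYr 1 0).
    by apply: (@def_app2 _ _ (coded m b)) => //; dfn.
  - have da' : Dfun A (fun=> a) by apply: dfun_cst; exact: dA.
    have dg' i : Dfun A (fun r => g (r i)) by apply: dfn_rename; apply: dfun_sub dg.
    apply: def_all; apply: def_all; cbv beta delta [shift].
    apply: def_imp; first exact: (dYr 2 1).
    apply: def_imp; first exact: (dYr 2 0).
    by dfn.
  - have dg' i : Dfun A (fun r => g (r i)) by apply: dfn_rename; apply: dfun_sub dg.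
    have ov : (exists u v, o = Some (u, v)) \/ (forall u v, o <> Some (u, v)).
      by case: (o) => [[u v]|]; [left; exists u, v|right].
    case: ov => [[u [v oE]]|no]; last first.
      by apply: def_ext (def_true A) => r; split=> // _ u v oE; case: (no u v oE).
    have du : Dfun A (fun=> u) by apply: dfun_cst; right; exists u, v; split=> //; left.
    have dv : Dfun A (fun=> v) by apply: dfun_cst; right; exists u, v; split=> //; right.
    apply: (@def_ext _ _ (fun r => forall x, coded m b (r 0) x -> outside u v (g x))).
      by move=> r; split=> [h u' v'|h]; [rewrite oE => -[<- <-]|exact: (h u v)].
    apply: def_all; cbv beta delta [shift]; apply: def_imp; first exact: (dYr 1 0).
    by rewrite /outside; dfn.
  have [n [zs [gs [hzs hgs sub]]]] : exists n zs gs, [/\ forall z, List.In z zs -> d0 z,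
      forall g, List.In g gs -> Dfn d g & forall y, finite_refinement o n zs gs y -> cap l y].
    elim: l hl => [|X l IH] hl; first by exists 0, [::], [::]; split=> // y _ X [].
    have [|n [zs [gs [hzs hgs sub]]]] := IH; first by move=> Y Yl; apply: hl; right.
    have a1 := base_ge1 hM a2.
    case: (hl X (or_introl erefl)) => [[k ->]|[z d0z ->]|[g dg ->]|[g dg ->]].
    - exists (maxn n k), zs, gs; split=> // y [t0 t1 t2 t3] Y [<-|Yl].
        by apply: contra_not t0; apply: covered_le => //; apply: pow_le => //; exact: leq_maxr.
      apply: sub => //; split=> //; apply: contra_not t0; apply: covered_le => //.
      by apply: pow_le => //; exact: leq_maxl.
    - exists n, (z :: zs), gs; split=> // [t [<-|/hzs]//|y [t0 t1 t2 t3] Y [<-|Yl]].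
        by apply: t1; left.
      by apply: sub => //; split=> // t tz; apply: t1; right.
    - exists n, zs, (g :: gs); split=> // [t [<-|/hgs]//|y [t0 t1 t2 t3] Y [<-|Yl]].
        by apply: t2; left.
      by apply: sub => //; split=> // [f fs|u v oE f fs]; [apply: t2; right|apply: t3 => //; right].
    - exists n, zs, (g :: gs); split=> // [t [<-|/hgs]//|y [t0 t1 t2 t3] Y [<-|Yl]].
        by move=> u v oE; apply: (t3 u v oE); left.
      by apply: sub => //; split=> // [f fs|u v oE f fs]; [apply: t2; right|apply: t3 => //; right].
  have [y Ty] := finite_refinement_ex n hyp hzs hgs; by exists y; exact: sub.
exists y; split.
- by move=> n; apply: (yP (C0 n)); constructor 1; exists n.
- by move=> z d0z; apply: (yP (C1 z)); constructor 2; exists z.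
- by move=> g dg; apply: (yP (C2 g)); constructor 3; exists g.
- by move=> u v oE g dg; apply: (yP (C3 g)) => //; constructor 4; exists g.
Qed.

End Saturation.

(** * Transfer along elementary extensions *)

(* Relations defined by the same formula in all structures; unlike Def, this
   allows transfer along elementary extensions. *)
Definition UDef (P : forall M : structure, (nat -> M) -> Prop) :=
  exists p : form nat, forall M r, P M r <-> holds p r.
Definition UTerm (t : forall M : structure, (nat -> M) -> M) :=
  exists u : term nat, forall M r, t M r = teval r u.

Lemma ud_ext (P Q : forall M : structure, (nat -> M) -> Prop) :
  (forall M r, P M r <-> Q M r) -> UDef P -> UDef Q.
Proof. by move=> PQ [p pP]; exists p => M r; rewrite -PQ. Qed.
Lemma ud_imp P Q : UDef P -> UDef Q -> UDef (fun M r => P M r -> Q M r).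
Proof. by move=> [p pP] [q qP]; exists (Imp p q) => M r /=; rewrite pP qP. Qed.
Lemma ud_bot : UDef (fun M r => False). Proof. by exists Bot. Qed.
Lemma ud_not P : UDef P -> UDef (fun M r => ~ P M r).
Proof. by move=> dP; apply: (ud_imp dP ud_bot). Qed.
Lemma ud_and P Q : UDef P -> UDef Q -> UDef (fun M r => P M r /\ Q M r).
Proof.
move=> dP dQ; apply: (@ud_ext (fun M r => ~ (P M r -> ~ Q M r))).
  by move=> M r; split=> [/not_implyP [? /contrapT]|[Pr Qr] h]; [|apply: h].
by apply: ud_not; apply: ud_imp => //; exact: ud_not.
Qed.
Lemma ud_or P Q : UDef P -> UDef Q -> UDef (fun M r => P M r \/ Q M r).
Proof.
move=> dP dQ; apply: (@ud_ext (fun M r => ~ P M r -> Q M r)).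
  move=> M r; split=> [h|[] //]; by case: (pselect (P M r)) => [|/h]; auto.
by apply: ud_imp => //; exact: ud_not.
Qed.
Lemma ud_all (P : forall M : structure, M -> (nat -> M) -> Prop) :
  UDef (fun M r => P M (r 0) (shift r)) -> UDef (fun M r => forall a, P M a r).
Proof.
move=> [p pP]; exists (All (frename (fun n => if n is k.+1 then Some k else None) p)) => M r /=.
have e a : P M a r <-> holds p (fun n => if n is k.+1 then r k else a).
  by rewrite -pP.
split=> h a; first have := (e a).1 (h a); last apply/e; last have := h a;
  rewrite holds_frename => H; apply/(holds_vars _).1: H; by case.
Qed.
Lemma ud_ex (P : forall M : structure, M -> (nat -> M) -> Prop) :
  UDef (fun M r => P M (r 0) (shift r)) -> UDef (fun M r => exists a, P M a r).
Proof.
move=> dP; apply: (@ud_ext (fun M r => ~ forall a, ~ P M a r)).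
  by move=> M r; split=> [/existsNP [a /contrapT]|[a Pa] h]; [exists a|apply: (h a)].
by apply: ud_not; apply: ud_all; exact: ud_not.
Qed.
Lemma ud_eq s t : UTerm s -> UTerm t -> UDef (fun M r => s M r = t M r).
Proof. by move=> [u uP] [v vP]; exists (Equal u v) => M r /=; rewrite uP vP. Qed.
Lemma ud_less s t : UTerm s -> UTerm t -> UDef (fun M r => less (s M r) (t M r)).
Proof. by move=> [u uP] [v vP]; exists (Less u v) => M r /=; rewrite uP vP. Qed.
Lemma ut_var n : UTerm (fun M r => r n). Proof. by exists (Var n). Qed.
Lemma ut_zero : UTerm (fun M r => zero). Proof. by exists Zero. Qed.
Lemma ut_one : UTerm (fun M r => one). Proof. by exists One. Qed.
Lemma ut_add s t : UTerm s -> UTerm t -> UTerm (fun M r => add (s M r) (t M r)).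
Proof. by move=> [u uP] [v vP]; exists (Add u v) => M r /=; rewrite uP vP. Qed.
Lemma ut_mul s t : UTerm s -> UTerm t -> UTerm (fun M r => mul (s M r) (t M r)).
Proof. by move=> [u uP] [v vP]; exists (Mul u v) => M r /=; rewrite uP vP. Qed.
Lemma ut_pow n k : UTerm (fun M r => power (r n) k).
Proof.
elim: k => [|k IH]; first exact: ut_one.
exact: (ut_mul IH (ut_var n)).
Qed.

Ltac ustep := lazymatch goal with
 | |- UDef (fun M r => _ /\ _) => apply: ud_and
 | |- UDef (fun M r => _ \/ _) => apply: ud_or
 | |- UDef (fun M r => ~ _) => apply: ud_not
 | |- UDef (fun M r => exists x, _) => apply: ud_ex; cbv beta delta [shift]
 | |- UDef (fun M r => _ = _) => apply: ud_eq
 | |- UDef (fun M r => less _ _) => apply: ud_less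
 | |- UDef (fun M r => le _ _) => unfold le
 | |- UTerm (fun M r => r _) => apply: ut_var
 | |- UTerm (fun M r => add _ _) => apply: ut_add
 | |- UTerm (fun M r => mul _ _) => apply: ut_mul
 | |- UTerm (fun M r => zero) => apply: ut_zero
 | |- UTerm (fun M r => one) => apply: ut_one
 | |- UTerm (fun M r => power _ _) => apply: ut_pow
 | |- UDef (fun M r => False) => apply: ud_bot
 | |- _ => first [ apply: ud_imp | apply: ud_all; cbv beta delta [shift] ]
 end.
Ltac udfn := cbv beta delta [shift]; repeat ustep.

Lemma ud_coded : UDef (fun M r => coded (r 0) (r 1) (r 2) (r 3)).
Proof. by rewrite /coded /member /dvd /modulus; udfn. Qed.

Lemma ud_coded_sub : UDef (fun M r => coded (r 0) (r 1) (r 2) `<=` coded (r 0) (r 1) (r 3)).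
Proof. by rewrite /subset /coded /member /dvd /modulus; udfn. Qed.

Lemma ud_coded_covered n : UDef (fun M r => covered (coded (r 0) (r 1) (r 2)) (power (r 3) n)).
Proof.
rewrite /covered /graph /coded /member /dvd /modulus /pair; udfn.
all: exact: ut_pow.
Qed.

Section Transfer.
Variable T : Type.
Implicit Types P Q : prestructure T.

Lemma peval_tsubst P (V W : Type) (s : V -> term W) (v : W -> T) t :
  peval P v (tsubst s t) = peval P (fun x => peval P v (s x)) t.
Proof. by elim: t => //= t1 -> t2 ->. Qed.

Lemma psat_fsubst P (V : Type) (p : form V) : forall (W : Type) (s : V -> term W) (v : W -> T),
  psat P (fsubst p s) v <-> psat P p (fun x => peval P v (s x)).
Proof.
elim: p => {V} V => [t1 t2|t1 t2||p1 IH1 p2 IH2|p1 IH1] W s v /=.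
- by rewrite !peval_tsubst.
- by rewrite !peval_tsubst.
- by [].
- by rewrite IH1 IH2.
- have e a : (fun x => peval P (extend v a) (up_subst s x)) =
             extend (fun x => peval P v (s x)) a.
    apply: funext => -[x|//] /=; by rewrite peval_tsubst.
  by split=> h a da; have := h a da; rewrite IH1 e.
Qed.

(** * Moving refinements between a model and an elementary extension *)

Section Ext.
Variables (P Q : prestructure T) (w : wfp P) (w' : wfp Q).
Hypothesis PQ : elem P Q.

Definition inj (x : St w) : St w' := mk w' (PQ.1 _ (el_dom x)).

Lemma injE x : el (inj x) = el x. Proof. exact: mkE. Qed.

Lemma inj_inj : injective inj.
Proof. by move=> x y /(congr1 (@el _ _ w')); rewrite !injE => /el_inj. Qed.

Lemma elem_holds (V : Type) (p : form V) (v : V -> St w) :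
  holds p v <-> holds p (fun i => inj (v i)).
Proof.
rewrite !psatP (_ : (fun i => el (inj (v i))) = fun i => el (v i)); last first.
  by apply: funext => i; rewrite injE.
by apply: PQ.2 => i; exact: el_dom.
Qed.

Lemma elem_udef (R : forall M : structure, (nat -> M) -> Prop) (r : nat -> St w) :
  UDef R -> R (St w) r <-> R (St w') (fun n => inj (r n)).
Proof. by move=> [p pP]; rewrite !pP; exact: elem_holds. Qed.

Lemma inj_less x y : less x y <-> less (inj x) (inj y).
Proof. by rewrite !el_less !injE; apply: elem_less => //; exact: el_dom. Qed.

Lemma inj_le_el x y : le x y <-> le (inj x) (inj y).
Proof. by rewrite /le -inj_less; split=> -[|e]; auto; right; [rewrite e|exact: inj_inj]. Qed.

Lemma inj_outside u v z : outside u v z <-> outside (inj u) (inj v) (inj z).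
Proof. by rewrite /outside -!inj_less. Qed.

Lemma inj_term (t : forall M : structure, (nat -> M) -> M) (r : nat -> St w) :
  UTerm t -> inj (t _ r) = t _ (fun n => inj (r n)).
Proof.
move=> ut; have := @elem_udef (fun M r => r 0 = t M (shift r)) (fun n => if n is k.+1 then r k else t _ r).
move=> [|/(_ erefl) //].
have [u uP] := ut; exists (Equal (Var 0) (tsubst (fun n => Var n.+1) u)) => M s /=.
by rewrite uP teval_tsubst.
Qed.

Lemma inj_pow x n : inj (power x n) = power (inj x) n.
Proof. exact: (@inj_term (fun M r => power (r 0) n) (fun=> x) (ut_pow 0 n)). Qed.

Lemma inj_two : inj (add one one) = add one one.
Proof. exact: (@inj_term (fun M r => add one one) (fun=> zero) (ut_add ut_one ut_one)). Qed.

Lemma inj_coded m b y x : coded m b y x <-> coded (inj m) (inj b) (inj y) (inj x).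
Proof.
exact: (elem_udef (fun n => match n with 0 => m | 1 => b | 2 => y | _ => x end) ud_coded).
Qed.

Lemma inj_coded_sub m b y z : coded m b y `<=` coded m b z <->
  coded (inj m) (inj b) (inj y) `<=` coded (inj m) (inj b) (inj z).
Proof.
exact: (elem_udef (fun n => match n with 0 => m | 1 => b | 2 => y | _ => z end) ud_coded_sub).
Qed.

Lemma inj_big a m b y : big a (coded m b y) <-> big (inj a) (coded (inj m) (inj b) (inj y)).
Proof.
have h n := elem_udef (fun n => match n with 0 => m | 1 => b | 2 => y | _ => a end) (ud_coded_covered n).
by split=> bY n; have := bY n; rewrite h.
Qed.

Definition bind (V : Type) (p : form (nat + V)) : form (nat + V) :=
  All (frename (fun x => match x with inl 0 => None | inl n.+1 => Some (inl n)
    | inr a => Some (inr a) end) p).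

Definition scons (M : Type) (a : M) (r : nat -> M) n := if n is k.+1 then r k else a.

Definition sumv (M V : Type) (r : nat -> M) (c : V -> M) (x : nat + V) : M :=
  match x with inl n => r n | inr v => c v end.

Lemma holds_bind (M : structure) (V : Type) (p : form (nat + V)) (r : nat -> M) (c : V -> M) :
  holds (bind p) (sumv r c) <-> forall a, holds p (sumv (scons a r) c).
Proof.
rewrite /=; split=> h a; have := h a; rewrite holds_frename => H;
  apply/(holds_vars _).1: H; by case=> [[|n]|].
Qed.

Definition up (d : set (St w)) : set (St w') := inj @` d.

(** [skolem] solves the defining formula of [g] in the extension. At a point of [P] the solution is
    unique, a fact that transfers, so it is the image of the value of [g]. *)
Lemma dfn_up (hQ : model_of_PA (St w')) d g : Dfn d g ->
  exists g', Dfn (up d) g' /\ forall x, g' (inj x) = inj (g x).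
Proof.
move=> [p0 p0P].
(* Identifying all later variables with variable 1 makes the truth of [p] depend on argument and
   value only. *)
pose p := frename (fun i : nat + {x | d x} => match i with inl n.+1 => inl 1 | _ => i end) p0.
have pE (M : structure) (c : {x | d x} -> M) (r s : nat -> M) : r 0 = s 0 -> r 1 = s 1 ->
    holds p (sumv r c) <-> holds p (sumv s c).
  by move=> e0 e1; rewrite !holds_frename; apply: holds_vars => -[[|n]|q].
have pP a t r : a = g t <-> holds p (sumv (scons a (scons t r)) (fun q : {x | d x} => sval q)).
  rewrite (p0P (scons a (fun=> t))) holds_frename; apply: holds_vars.
  by case=> [[]|].
clearbody p.
have [|g' [dg' g'P]] := @skolem _ hQ (up d)
   (fun t a => holds p (sumv (scons a (fun=> t)) (fun q : {x | d x} => inj (sval q)))).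
  apply: (@def_ext _ _ (fun r => holds p (fun i => match i with inl 0 => fun r : nat -> St w' => r 1
     | inl n.+1 => fun r => r 0 | inr q => fun=> inj (sval q) end r))).
    by move=> r; apply: holds_vars => -[[]|].
  apply: def_holds => -[[|n]|q]; [exact: dfun_var|exact: dfun_var|].
  by apply: dfun_cst; exists (sval q) => //; exact: proj2_sig.
exists g'; split=> // x.
pose q := bind (Imp p (Equal (Var (inl 0)) (Var (inl 2)))).
have : holds q (sumv (scons x (fun=> g x)) (fun q : {x | d x} => sval q)).
  by apply/holds_bind => a /= /pP.
have injv (r : nat -> St w) : (fun i => inj (sumv r (fun q : {x | d x} => sval q) i)) =
    sumv (fun n => inj (r n)) (fun q : {x | d x} => inj (sval q)).
  by apply: funext => -[].
rewrite elem_holds injv => /holds_bind /(_ (g' (inj x))) /=; apply.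
have : exists a, holds p (sumv (scons a (fun=> inj x)) (fun q : {x | d x} => inj (sval q))).
  exists (inj (g x)); have := (pP (g x) x (fun=> x)).1 erefl.
  by rewrite elem_holds injv; apply: (pE _ _ _ _ _ _).1.
by move=> /g'P; apply: (pE _ _ _ _ _ _).1.
Qed.

(** The formula defining [z] has a solution in the extension, hence one in [P]; by uniqueness its
    image is [z]. *)
Lemma dcl_down d z : dcl (up d) z -> exists z', inj z' = z /\ dcl d z'.
Proof.
move=> [p0 p0P].
pose p := frename (fun i : nat + {x | up d x} => match i with inl n => inl 0 | _ => i end) p0.
have pP r : r 0 = z <-> holds p (sumv r (fun q : {x | up d x} => sval q)).
  rewrite (p0P (fun=> r 0)) holds_frename; apply: holds_vars.
  by case.
clearbody p.
have /choice [c cP] (q : {x | up d x}) : exists y, d y /\ inj y = sval q.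
  by have [y] := proj2_sig q; exists y.
have injv (r : nat -> St w) : (fun i => inj (sumv r c i)) =
    sumv (fun n => inj (r n)) (fun q : {x | up d x} => sval q).
  by apply: funext => -[n|q] //=; rewrite (cP q).2.
have pc r : holds p (sumv r c) <-> inj (r 0) = z.
  by rewrite elem_holds injv -pP.
have : ~ holds (bind (Neg p)) (sumv (fun=> zero) c).
  by rewrite elem_holds injv => /holds_bind /(_ z) /=; apply; apply/pP.
rewrite holds_bind => /existsNP [a /= /contrapT /pc /= az].
exists a; split=> //.
apply: (@def_ext _ _ (fun r => holds p (sumv r c))).
  by move=> r; rewrite pc -az; split=> [/inj_inj|->].
apply: (@def_ext _ _ (fun r => holds p (fun i => match i with inl n => fun r : nat -> St w => r n
   | inr q => fun=> c q end r))).
  by move=> r; apply: holds_vars => -[].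
by apply: def_holds => -[n|q]; [exact: dfun_var|apply: dfun_cst; exact: (cP q).1].
Qed.

Variables (dL : Order.disp_t) (L : orderType dL).

(** With [refinement_down] this allows a refinement for a stage to be sought in the saturated limit
    model, provided that the code found there belongs to the stage. *)
Lemma refinable_up a b m d d0 o : refinable L a b m d d0 o ->
  refinable L (inj a) (inj b) (inj m) (up d) (up d0) (omap (fun p => (inj p.1, inj p.2)) o).
Proof.
move=> [sd [da [db dm]] d0d oP fip]; split.
- exact: small_image.
- by split; [exists a|split; [exists b|exists m]].
- by move=> _ [x /d0d dx <-]; exists x.
- move=> u v; case: o oP => [[u' v']|//] oP [<- <-].
  have [uv out] := oP u' v' erefl; split; first exact/inj_le_el.
  by move=> z /dcl_down [z' [<- /out]]; rewrite inj_outside.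
- move=> l hl.
  have [l' [hl' ll']] : exists l', (forall z, List.In z l' -> d0 z) /\
      forall z, List.In z l -> exists2 z', List.In z' l' & inj z' = z.
    elim: l hl => [|z l IH] hl; first by exists [::].
    have [|l' [hl' ll']] := IH; first by move=> t tl; apply: hl; right.
    have [z' dz' e] := hl z (or_introl erefl).
    exists (z' :: l'); split=> [t [<-|/hl']//|t [<-|/ll' [t' tl' <-]]].
      by exists z' => //; left.
    by exists t' => //; right.
  have [y [by_ yz]] := fip l' hl'; exists (inj y); split; first by rewrite -inj_big.
  by move=> z /ll' [z' zl' <-]; apply/inj_coded_sub; exact: yz.
Qed.

Lemma refinement_down (hQ : model_of_PA (St w')) a b m d d0 o y :
  refinement (inj a) (inj b) (inj m) (up d) (up d0) (omap (fun p => (inj p.1, inj p.2)) o) (inj y) ->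
  refinement a b m d d0 o y.
Proof.
move=> [t0 t1 t2 t3]; split.
- by rewrite inj_big.
- by move=> z d0z; rewrite inj_coded_sub; apply: t1; exists z.
- move=> g /(dfn_up hQ) [g' [dg' gE]] x x'; rewrite !inj_coded => Yx Yx'.
  have := t2 g' dg' _ _ Yx Yx'; rewrite !gE !inj_le_el.
  by case=> [/inj_inj|]; auto.
- move=> u v oE g /(dfn_up hQ) [g' [dg' gE]] x; rewrite inj_coded => Yx.
  by rewrite inj_outside -gE; apply: (t3 _ _ _ g' dg') => //; rewrite oE.
Qed.

End Ext.

(** * Good cuts in unions of chains *)

Section UnionGood.
Variables (dL : Order.disp_t) (L : orderType dL).
Hypothesis hL : is_infinite_cardinal L.
Hypothesis hpow : ([set: short_seq L] #= [set: L])%card.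
Variables (t0 : T) (fam : set (prestructure T)).
Hypothesis wf_fam : forall P, fam P -> wfp P.
Hypothesis chain : forall P Q, fam P -> fam Q -> elem P Q \/ elem Q P.

Lemma small_preimage (X Y : Type) (f : X -> Y) (E : set Y) : injective f ->
  small L E -> small L [set x | E (f x)].
Proof.
move=> fI sE [g [gE gI]]; apply: sE; exists (f \o g); split=> [l _|x y _ _ /fI].
  exact: gE.
exact: gI.
Qed.

(** A small [d] need not lie in one member of the chain, but its finite subsets do, and definability
    uses only finite subsets. Each set of a small cofinal family of finite sets gets its interval
    from some member; goodness in one fixed member then yields an interval inside all of these. *)
Lemma chain_union_good (wU : wfp (chain_union t0 fam)) (hU : model_of_PA (St wU)) (A B : set T) :
  (forall ys : seq T, (forall y, List.In y ys -> dom (chain_union t0 fam) y) ->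
     exists2 P, fam P & (forall y, List.In y ys -> dom P y) /\ goodP L P A B) ->
  goodP L (chain_union t0 fam) A B.
Proof.
move=> cof; set U := chain_union t0 fam in wU hU cof *.
have [|P1 f1 [_ [A1 B1 [w1 [AB1 g1]]]]] := cof [::]; first by [].
have PU P : fam P -> elem P U by exact: chain_union_elem.
have AU : A `<=` dom U by move=> x /A1; exact: (PU _ f1).1.
have BU : B `<=` dom U by move=> x /B1; exact: (PU _ f1).1.
have AB (x y : St wU) : A (el x) -> B (el y) -> less x y.
  move=> Ax By; apply/el_less; apply/(elem_less (PU _ f1)); [exact: A1|exact: B1|].
  have := AB1 (mk w1 (A1 _ Ax)) (mk w1 (B1 _ By)); rewrite !mkE => /(_ Ax By) /el_less.
  by rewrite !mkE.
split=> //; exists wU; split=> // d sd.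
have [S [sS Sfin Scof]] := small_finite_cofinal hL hpow sd.
have /choice [uv uvP] (s : set (St wU)) : exists uv : St wU * St wU, S s ->
    [/\ A (el uv.1), B (el uv.2) & forall z, dcl s z -> outside uv.1 uv.2 z].
  have [Ss|nS] := pselect (S s); last by exists (zero, zero).
  have [fs _] := Sfin s Ss; have [l lP] := finite_list fs.
  have [|P fP [ysP [AP BP [wP [ABP gP]]]]] := cof (map (@el _ _ wU) l).
    by move=> y; elim: (l) => [//|x k IH] [<-|/IH//]; exact: el_dom.
  have ePU := PU _ fP; pose e : set (St wP) := [set x | s (inj wU ePU x)].
  have se : small L e by apply: small_preimage; [exact: inj_inj|exact: small_finite].
  have [u [v [Au Bv out]]] := gP e se.
  exists (inj wU ePU u, inj wU ePU v) => _; split; rewrite ?injE //.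
  move=> z dz; have [|z' [<- dz']] := dcl_down (w := wP) (PQ := ePU) (d := e) (z := z).
    apply: dfun_sub dz => x sx.
    have xP : dom P (el x).
      by apply: ysP; elim: (l) (lP x sx) => //= y k IH [->|/IH]; [left|right].
    have ex : inj wU ePU (mk wP xP) = x by apply: el_inj; rewrite injE mkE.
    by exists (mk wP xP) => //; rewrite /e /= ex.
  by rewrite -inj_outside; exact: out.
(* All chosen endpoints lie in [A] or [B], hence in the fixed model [P1]. An interval of the cut
   that contains none of them lies above every lower endpoint and below every upper one. *)
pose D : set (St w1) := [set x | ((fun s => el (uv s).1) @` S `|` (fun s => el (uv s).2) @` S) (el x)].
have sD : small L D.
  by apply: small_preimage; [exact: el_inj|apply: small_setU => //; exact: small_image].
have [u [v [Au Bv out]]] := g1 D sD; have e1 := PU _ f1.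
exists (inj wU e1 u), (inj wU e1 v); split; rewrite ?injE // => z /def_finite [l [ld dl]].
have [s Ss ls] := Scof l ld; have [As Bs outs] := uvP s Ss.
have dz : dcl s z by apply: dfun_sub dl => x; exact: ls.
have key (x : St wU) (hx : dom P1 (el x)) : D (mk w1 hx) -> outside (inj wU e1 u) (inj wU e1 v) x.
  move=> Dx; have -> : x = inj wU e1 (mk w1 hx) by apply: el_inj; rewrite injE mkE.
  by rewrite -inj_outside; apply: out; exact: dcl_self.
have us : less (uv s).1 (inj wU e1 u).
  have [|//|vu] := key (uv s).1 (A1 _ As); first by rewrite /D /= mkE; left; exists s.
  by case: (@lt_irr _ hU (uv s).1); apply: (lt_trans hU _ vu); apply: AB; rewrite ?injE.
have vs : less (inj wU e1 v) (uv s).2.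
  have [|vu|//] := key (uv s).2 (B1 _ Bs); first by rewrite /D /= mkE; right; exists s.
  by case: (@lt_irr _ hU (uv s).2); apply: (lt_trans hU vu); apply: AB; rewrite ?injE.
by case: (outs z dz) => h; [left; exact: (lt_trans hU h us)|right; exact: (lt_trans hU vs h)].
Qed.

End UnionGood.
End Transfer.

(** * The chain of models *)

Section Chain.
Local Open Scope order_scope.
Variables (dL : Order.disp_t) (L : orderType dL).
Variables (dK : Order.disp_t) (K : orderType dK).
Hypothesis hL : is_infinite_cardinal L.
Hypothesis hpow : ([set: short_seq L] #= [set: L])%card.
Hypothesis hK : is_succ_cardinal L K.
Variables (P0 : prestructure K) (w0 : wfp P0).
Hypothesis PA0 : model_of_PA (St w0).
Hypothesis leP0 : inj_le (dom P0) [set: L].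
Variables (guess : K -> set K) (pK : K -> K -> K) (tg : nat -> K).
Hypothesis pKI : forall x y x' y', pK x y = pK x' y' -> x = x' /\ y = y'.
Hypothesis tgI : injective tg.

(* A stage of the construction: a model and a cut that has to stay unfilled
   (the empty pair of sets when there is no such cut). *)
Definition State := (prestructure K * (set K * set K))%type.

(** [P0] is kept as a member so that the union is a model even when [B] is empty. *)
Definition fam (B : set K) (h : K -> State) : set (prestructure K) :=
  fun P => P = P0 \/ exists2 b, B b & P = (h b).1.

Definition Q (B : set K) (h : K -> State) : prestructure K := chain_union (pzero P0) (fam B h).

Definition active (c : set K * set K) := exists x, c.1 x.

Definition Ext a h (s : State) := [/\ wfp s.1, elem (Q (below a) h) s.1,
  inj_le (dom s.1) [set: L],
  forall c, c < a -> active (h c).2 -> goodP L s.1 (h c).2.1 (h c).2.2 &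
  active s.2 -> goodP L s.1 s.2.1 s.2.2].

(* X codes, under the tag 1, the graph of a function h; the new element x fills the
   cut (Au, Bv) of q, and the cut that has to stay unfilled is its image under h. *)
Definition Killed (q : prestructure K) (s : State) (X : set K) := exists (Au Bv : set K) (x : K),
  [/\ Au `<=` dom q, Bv `<=` dom q, dom s.1 x,
    (forall u, Au u -> ~ pless s.1 x u) /\ (forall v, Bv v -> pless s.1 x v) &
    [/\ s.2.1 = (fun y => exists2 u, Au u & X (pK (tg 1) (pK u y))),
      s.2.2 = (fun y => exists2 v, Bv v & X (pK (tg 1) (pK v y))) & active s.2]].

Definition code (f : form (option K)) : K := form_code pK tg f (option_code pK tg id).

Lemma code_inj : injective code.
Proof. by apply: form_code_inj => //; apply: option_code_inj. Qed.

(* The type over q coded by X under the tag 0. *)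
Definition ptype (X : set K) : set (form (option K)) := fun f => X (pK (tg 0) (code f)).

(* f depends only on the parameters in d. The condition is semantic because the
   parameters of f range over all of K. *)
Definition sem_supp (d : set K) (f : form (option K)) := forall (P : prestructure K) (v v' : option K -> K),
  v None = v' None -> (forall x, d x -> v (Some x) = v' (Some x)) -> psat P f v -> psat P f v'.

(** Realizations outside any finite list are required so that the next model can realize the type by
    a new element. *)
Definition infinite_type (q : prestructure K) (p : set (form (option K))) := forall l ys,
  (forall f, List.In f l -> p f) ->
  exists b, [/\ dom q b, ~ List.In b ys & forall f, List.In f l -> psat q f (extend id b)].

Definition Task (q : prestructure K) (s : State) (X : set K) :=
  (exists d, [/\ small L d, d `<=` dom q & forall f, ptype X f -> sem_supp d f]) ->
  infinite_type q (ptype X) ->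
  exists x, [/\ dom s.1 x, ~ dom q x & forall f, ptype X f -> psat s.1 f (extend id x)].

(** Adding a cut has priority over realizing a type. Its feasibility is phrased as the existence of
    some [s'], so the limit argument only has to exhibit one suitable extension. *)
Definition Step a h (s : State) := [/\ Ext a h s,
  (exists s', Ext a h s' /\ Killed (Q (below a) h) s' (guess a)) ->
    Killed (Q (below a) h) s (guess a) &
  ~ (exists s', Ext a h s' /\ Killed (Q (below a) h) s' (guess a)) ->
    Task (Q (below a) h) s (guess a)].

Section Facts.
Variables (B : set K) (h : K -> State).
Hypothesis Bdown : forall b c, b < c -> B c -> B b.
Hypothesis hB : forall b, B b -> Step b h (h b).

Lemma fam_wf P : fam B h P -> wfp P.
Proof. by move=> [->//|[b Bb ->]]; have [[]] := hB Bb. Qed.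

Lemma fam_elem c P : B c -> fam (below c) h P -> elem P (h c).1.
Proof.
have [[wo _] _ _] := hK.
move: P; elim/(well_founded_ind (wo_wf wo)): c => c IH P Bc fP.
have [[_ eQ _ _ _] _ _] := hB Bc; apply: elem_trans eQ.
have wfc R : fam (below c) h R -> wfp R.
  by move=> [->//|[b bc ->]]; have [[]] := hB (Bdown bc Bc).
apply: chain_union_elem => // R S [->|[b bc ->]] [->|[b' bc' ->]].
- by left; exact: elem_refl.
- by left; apply: IH => //; [exact: Bdown Bc|left].
- by right; apply: IH => //; [exact: Bdown Bc|left].
- case: (Order.TotalTheory.ltgtP b b') => bb'.
  + by left; apply: IH => //; [exact: Bdown Bc|right; exists b].
  + by right; apply: IH => //; [exact: Bdown Bc|right; exists b'].
  + by left; rewrite bb'; exact: elem_refl.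
Qed.

Lemma fam_chain P R : fam B h P -> fam B h R -> elem P R \/ elem R P.
Proof.
move=> [->|[b bc ->]] [->|[b' bc' ->]].
- by left; exact: elem_refl.
- by left; apply: fam_elem => //; left.
- by right; apply: fam_elem => //; left.
- case: (Order.TotalTheory.ltgtP b b') => bb'.
  + by left; apply: fam_elem => //; right; exists b.
  + by right; apply: fam_elem => //; right; exists b'.
  + by left; rewrite bb'; exact: elem_refl.
Qed.

Lemma Q_wf : wfp (Q B h).
Proof. by apply: (@chain_union_wf K (pzero P0) (fam B h) fam_wf fam_chain P0); left. Qed.

Lemma Q_elem P : fam B h P -> elem P (Q B h).
Proof. exact: (@chain_union_elem K (pzero P0) (fam B h) fam_wf fam_chain P). Qed.

Lemma Q_PA : model_of_PA (St Q_wf).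
Proof. by apply: elem_PA PA0; apply: Q_elem; left. Qed.

Lemma Q_le : inj_le B [set: L] -> inj_le (dom (Q B h)) [set: L].
Proof.
move=> leB; apply: (@inj_le_trans _ _ _ _ (dom P0 `|` (fun x => exists2 b, B b & dom (h b).1 x))).
  by apply: inj_le_sub => x [P [->|[b Bb ->]] dx]; [left|right; exists b].
apply: (inj_le_setU hL hpow leP0); apply: (inj_le_bigcup hL hpow leB) => b Bb.
by have [[]] := hB Bb.
Qed.

Lemma step_good b c : B b -> c <= b -> active (h c).2 -> goodP L (h b).1 (h c).2.1 (h c).2.2.
Proof.
move=> Bb; have [[_ _ _ hc hb] _ _] := hB Bb.
by rewrite Order.POrderTheory.le_eqVlt => /orP [/eqP->|cb]; [exact: hb|exact: hc].
Qed.

Lemma Q_good c : B c -> active (h c).2 -> goodP L (Q B h) (h c).2.1 (h c).2.2.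
Proof.
move=> Bc ac; apply: (chain_union_good hL hpow fam_wf fam_chain Q_PA) => ys hys.
have [b [Bb cb ysb]] : exists b, [/\ B b, c <= b & forall y, List.In y ys -> dom (h b).1 y].
  elim: ys hys => [|y ys IH] hys; first by exists c; split.
  have [|b [Bb cb ysb]] := IH; first by move=> z zs; apply: hys; right.
  have [R fR dR] := hys y (or_introl erefl).
  case: fR dR => [->|[b' Bb' ->]] dR.
    exists b; split=> // z [<-|/ysb//]; have [s _] := @fam_elem b P0 Bb (or_introl erefl).
    exact: s.
  case: (Order.TotalTheory.leP b' b) => bb'.
    exists b; split=> // z [<-|/ysb//]; move: bb'.
    rewrite Order.POrderTheory.le_eqVlt => /orP [/eqP<-//|bb'].
    have [|s _] := @fam_elem b (h b').1 Bb; last exact: s.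
    by right; exists b'.
  exists b'; split=> //; first by apply: Order.POrderTheory.ltW; exact: Order.POrderTheory.le_lt_trans bb'.
  move=> z [<-//|/ysb dz]; have [|s _] := @fam_elem b' (h b).1 Bb'; last exact: s.
  by right; exists b.
exists (h b).1; first by right; exists b.
by split=> //; exact: step_good.
Qed.

Lemma Q_infinite ys : exists2 b, dom (Q B h) b & ~ List.In b ys.
Proof.
have hM : model_of_PA (St Q_wf) := @Q_PA.
have [s sP] : exists s : St Q_wf, forall x : St Q_wf, List.In (el x) ys -> less x s.
  elim: ys => [|y ys [s IH]]; first by exists zero.
  have [dy|ndy] := pselect (dom (Q B h) y); last first.
    by exists s => x [e|/IH//]; case: ndy; rewrite e; exact: el_dom.
  exists (add (add s (mk Q_wf dy)) one) => x; rewrite (ltS hM).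
  case=> [e|/IH xs]; last by apply: (le_trans hM (lt_le xs)); exact: le_addr.
  have -> : x = mk Q_wf dy by apply: el_inj; rewrite mkE.
  by rewrite (paddC hM); exact: le_addr.
exists (el s); first exact: el_dom.
by move=> /sP; exact: lt_irr.
Qed.

End Facts.

Lemma fam_ext B h h' : (forall b, B b -> h b = h' b) -> fam B h = fam B h'.
Proof.
move=> e; apply: funext => P; apply: propext; split=> -[->|[b Bb ->]]; [by left|right|by left|right];
  by exists b; rewrite ?e.
Qed.

(** * One step of the construction *)

Section OneStep.
Variables (a : K) (h : K -> State).
Hypothesis IH : forall b, b < a -> Step b h (h b).

Let adown b c : b < c -> below a c -> below a b.
Proof. exact: Order.POrderTheory.lt_trans. Qed.
Variable wq : wfp (Q (below a) h).

Lemma wq_PA : model_of_PA (St wq).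
Proof. by rewrite (Prop_irrelevance wq (Q_wf adown IH)); exact: Q_PA. Qed.

Definition cuts : set (set (St wq) * set (St wq)) := fun D =>
  exists2 c, c < a /\ active (h c).2 &
    D = ((fun x => (h c).2.1 (el x)), (fun x => (h c).2.2 (el x))).

Lemma cuts_le : inj_le cuts [set: L].
Proof.
apply: (@inj_le_trans _ _ _ _ (below a)); last exact: (below_le hL hK).
apply: (@inj_le_surj _ _ a _ _ (fun c => ((fun x => (h c).2.1 (el x)), (fun x => (h c).2.2 (el x))))).
by move=> D [c [ca _] ->]; exists c.
Qed.

Lemma cuts_good D : cuts D -> good L D.1 D.2.
Proof.
move=> [c [ca ac] ->]; have [_ _ [w gw]] := Q_good adown IH ca ac.
by rewrite (Prop_irrelevance wq w).
Qed.

Lemma q_le : inj_le (dom (Q (below a) h)) [set: L].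
Proof. exact: (Q_le IH (below_le hL hK a)). Qed.

Lemma St_le : inj_le [set: St wq] [set: L].
Proof.
apply: inj_le_trans q_le; exists (@el _ _ wq); split=> [x _|x y _ _]; first exact: el_dom.
exact: el_inj.
Qed.

Lemma filter_step (F : set_system (St wq)) : ProperFilter F ->
  (forall D, cuts D -> Fgood L F D.1 D.2) ->
  exists (P' : prestructure K) (x : K), [/\ wfp P', elem (Q (below a) h) P', inj_le (dom P') [set: L],
    forall c, c < a -> active (h c).2 -> goodP L P' (h c).2.1 (h c).2.2 &
   [/\ dom P' x, (forall s, F [set t | t <> s]) -> ~ dom (Q (below a) h) x,
     forall (V : Type) (v : V -> St wq) (q : form (option V)),
       F [set t | holds q (extend v t)] -> psat P' q (extend (fun i => el (v i)) x) &
     forall A B : set (St wq), (forall u v, A u -> B v -> less u v) -> Fgood L F A B ->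
       goodP L P' (@el _ _ wq @` A) (@el _ _ wq @` B)]].
Proof.
move=> PF Fg; have [P' [x [w' e le' dx [h1 h2 h3]]]] := ultra_ext hL hpow hK wq_PA q_le PF.
exists P', x; split=> // c ca ac.
have [Ac Bc _] := Q_good adown IH ca ac.
have cD : cuts ((fun x => (h c).2.1 (el x)), (fun x => (h c).2.2 (el x))) by exists c.
have := h3 _ _ (cuts_good cD).1 (Fg _ cD) => /=.
have im (A : set K) : A `<=` dom (Q (below a) h) -> @el _ _ wq @` (fun x => A (el x)) = A.
  move=> Aq; apply/seteqP; split=> [_ [y Ay <-]//|y Ay].
  by exists (mk wq (Aq _ Ay)); rewrite mkE.
by rewrite !im.
Qed.

Lemma realize_step (d : set K) (p : set (form (option K))) : small L d ->
  d `<=` dom (Q (below a) h) -> (forall f, p f -> sem_supp d f) ->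
  infinite_type (Q (below a) h) p ->
  exists s : State, Ext a h s /\ exists x, [/\ dom s.1 x, ~ dom (Q (below a) h) x &
    forall f, p f -> psat s.1 f (extend id x)].
Proof.
move=> sd dq supp inf.
(* Elements of [K] outside [d] may not belong to the model; they are read as [zero], which
   [sem_supp] makes harmless. *)
pose v (x : K) : St wq := if pselect (d x) is left dx then mk wq (dq _ dx) else zero.
have vE x : d x -> el (v x) = x by rewrite /v; case: pselect => // dx _; rewrite mkE.
pose Xf (f : form (option K)) : set (St wq) := [set t | holds f (extend v t)].
have XfE f t : p f -> Xf f t <-> psat (Q (below a) h) f (extend id (el t)).
  move=> pf; rewrite /Xf /= psatP; split; apply: (supp f pf) => //= x dx; by rewrite vE.
pose d0 : set (St wq) := [set x | d (el x)].
have sd0 : small L d0 by apply: small_preimage => //; exact: el_inj.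
have [||F [PF GF Fn Fg]] := ordinary_filter hL hpow wq_PA St_le cuts_le cuts_good sd0
    (G0 := fun X => exists2 f, p f & X = Xf f).
- move=> _ [f pf ->].
  apply: (@def_ext _ _ (fun r => holds f (fun i => match i with None => fun r : nat -> St wq => r 0
    | Some x => fun=> v x end r))).
    by move=> r; apply: holds_vars => -[].
  apply: def_holds => -[x|]; last exact: dfun_var.
  rewrite /v; case: pselect => [dx|_]; last exact: dfun_zero.
  by apply: dfun_cst; rewrite /d0 /= mkE.
- move=> l hl; apply: (big_infinite wq_PA) => ys.
  have [l' [pl' ll']] : exists l', (forall f, List.In f l' -> p f) /\
      forall X, List.In X l -> exists2 f, List.In f l' & X = Xf f.
    elim: l hl => [|X l IHl] hl; first by exists [::].
    have [|l' [pl' ll']] := IHl; first by move=> Y Yl; apply: hl; right.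
    have [f pf XE] := hl X (or_introl erefl).
    exists (f :: l'); split=> [g [<-|/pl']//|Y [<-|/ll' [g gl ->]]].
      by exists f => //; left.
    by exists g => //; right.
  have [b [db nb bP]] := inf l' (map (@el _ _ wq) ys) pl'.
  exists (mk wq db).
    by move=> X /ll' [f fl ->]; apply/XfE; [exact: pl'|rewrite mkE; exact: bP].
  move=> bys; apply: nb; rewrite -(mkE wq db).
  by elim: (ys) bys => //= y s IHs [->|/IHs]; [left|right].
have [P' [x [w' e le' gc [dx nx sat _]]]] := filter_step PF Fg.
exists (P', (set0, set0)); split; first by split=> //= -[].
exists x; split=> //=; first exact: nx.
move=> f pf; have := sat K v f (GF _ (ex_intro2 _ _ f pf erefl)).
by apply: (supp f pf) => //= y dy; rewrite vE.
Qed.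

Lemma step_ex : exists s, Step a h s.
Proof.
have [[s' [Es' Ks']]|nk] := pselect (exists s', Ext a h s' /\ Killed (Q (below a) h) s' (guess a)).
  by exists s'; split=> // nk; case: nk; exists s'.
have [[[d [sd dq supp]] inf]|nt] := pselect ((exists d, [/\ small L d, d `<=` dom (Q (below a) h) &
    forall f, ptype (guess a) f -> sem_supp d f]) /\ infinite_type (Q (below a) h) (ptype (guess a))).
  have [s [Es [x xP]]] := realize_step sd dq supp inf.
  by exists s; split=> // _ _ _; exists x.
(* A useless guess still needs an extension that keeps the earlier cuts good; realizing the empty
   type gives one. *)
have s0 : small L (@set0 K) by exact: small_set0.
have inf0 : infinite_type (Q (below a) h) set0.
  move=> l ys hl; have [b db nb] := Q_infinite adown IH ys.
  by exists b; split=> // f /hl.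
have [s [Es _]] := @realize_step set0 set0 s0 (@sub0set _ _) (fun f e => False_ind _ e) inf0.
by exists s; split=> // _ h1 h2; case: nt.
Qed.

End OneStep.

Lemma chain_ex : exists h : K -> State, forall a, Step a h (h a).
Proof.
have [[wo _] _ _] := hK.
apply: (wf_choice wo (P0, (set0, set0)) (R := Step)); last first.
  move=> a h IH; apply: step_ex => //; apply: (Q_wf _ IH) => b c.
  exact: Order.POrderTheory.lt_trans.
move=> a h h' s hh'.
have QE : Q (below a) h = Q (below a) h' by rewrite /Q (@fam_ext (below a) h h').
have EE s' : Ext a h s' -> Ext a h' s'.
  by move=> [e1 e2 e3 e4 e5]; split=> // [|c ca]; [rewrite -QE|rewrite -hh' //; exact: e4].
have EE' s' : Ext a h' s' -> Ext a h s'.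
  by move=> [e1 e2 e3 e4 e5]; split=> // [|c ca]; [rewrite QE|rewrite hh' //; exact: e4].
move=> [Es Ks Ts]; split; first exact: EE.
  by move=> [s' [/EE' Es' Ks']]; rewrite -QE; apply: Ks; exists s'; rewrite QE.
by move=> nk; rewrite -QE; apply: Ts => -[s' [/EE Es' Ks']]; apply: nk; exists s'; rewrite -QE.
Qed.

End Chain.

(** * The limit model *)

Section Limit.
Local Open Scope order_scope.
Variables (dL : Order.disp_t) (L : orderType dL).
Variables (dK : Order.disp_t) (K : orderType dK).
Hypothesis hL : is_infinite_cardinal L.
Hypothesis hpow : ([set: short_seq L] #= [set: L])%card.
Hypothesis hK : is_succ_cardinal L K.
Variables (P0 : prestructure K) (w0 : wfp P0).
Hypothesis PA0 : model_of_PA (St w0).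
Hypothesis leP0 : inj_le (dom P0) [set: L].
Variables (guess : K -> set K) (pK : K -> K -> K) (tg : nat -> K).
Hypothesis pKI : forall x y x' y', pK x y = pK x' y' -> x = x' /\ y = y'.
Hypothesis tgI : injective tg.
Hypothesis guessP : forall X : set K,
  stationary [set a | has_cofinality L a /\ X `&` below a = guess a].
Variable h : K -> State K.
Hypothesis hS : forall a, Step L P0 guess pK tg a h (h a).

Let Tdown (b c : K) : b < c -> [set: K] c -> [set: K] b. Proof. by []. Qed.
Let TS b : [set: K] b -> Step L P0 guess pK tg b h (h b). Proof. by []. Qed.
Let adown (a b c : K) : b < c -> below a c -> below a b.
Proof. exact: Order.POrderTheory.lt_trans. Qed.
Let aS a b : below a b -> Step L P0 guess pK tg b h (h b). Proof. by []. Qed.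

Definition N : prestructure K := Q P0 setT h.
Definition Qa a : prestructure K := Q P0 (below a) h.
Definition wN : wfp N := Q_wf hK w0 Tdown TS.
Definition wQ a : wfp (Qa a) := Q_wf hK w0 (@adown a) (@aS a).
Lemma hN : model_of_PA (St wN).
Proof. exact: (@Q_PA _ _ _ _ hK _ w0 PA0). Qed.
Lemma hQ a : model_of_PA (St (wQ a)).
Proof. exact: (@Q_PA _ _ _ _ hK _ w0 PA0). Qed.

Lemma h_N a : elem (h a).1 N.
Proof. by apply: (Q_elem hK w0 Tdown TS); right; exists a. Qed.

Lemma Qa_h a : elem (Qa a) (h a).1.
Proof. by have [[]] := hS a. Qed.

Lemma Qa_N a : elem (Qa a) N.
Proof. exact: elem_trans (Qa_h a) (h_N a). Qed.

Lemma h_Qa a b : b < a -> elem (h b).1 (Qa a).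
Proof. by move=> ba; apply: (Q_elem hK w0 (@adown a) (@aS a)); right; exists b. Qed.

Lemma Qa_mono a b : a <= b -> dom (Qa a) `<=` dom (Qa b).
Proof.
move=> ab x [P [->|[c ca ->]] dx]; first by exists P0 => //; left.
by exists (h c).1 => //; right; exists c => //; exact: Order.POrderTheory.lt_le_trans ab.
Qed.

Lemma K_gt (b : K) : exists a, b < a.
Proof.
have [c cP] := K_bound hL hpow hK id (inj_le_set1 hL b).
by exists c; apply: cP.
Qed.

Lemma stage x : exists a, dom N x -> dom (Qa a) x.
Proof.
have [[P fP dx]|nx] := pselect (dom N x); last by exists x.
case: fP dx => [->|[b _ ->]] dx; first by exists x => _; exists P0 => //; left.
by have [a ba] := K_gt b; exists a => _; exists (h b).1 => //; right; exists b.
Qed.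

Lemma stage_bound (X : Type) (S : set X) (f : X -> K) : inj_le S [set: L] ->
  (forall x, S x -> dom N (f x)) -> exists a, forall x, S x -> dom (Qa a) (f x).
Proof.
move=> leS fN; have [g gP] := choice stage.
have [c cP] := K_bound hL hpow hK (g \o f) leS.
exists c => x Sx; apply: (@Qa_mono (g (f x))); last by apply: gP; exact: fN.
by apply: Order.POrderTheory.ltW; exact: cP.
Qed.

Lemma small_K_le (e : set K) : small L e -> inj_le e [set: L].
Proof.
move=> se; have [[wo card] _ _] := hK.
have [[g [ge gI]]|[a ea]] := collapse wo card e; last exact: inj_le_trans ea (below_le hL hK a).
have [i iI] := L_inj_K hL hK; exfalso; apply: se; exists (g \o i).
by split=> [x _|x y _ _ /gI e']; [exact: ge|apply: iI; exact: e'].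
Qed.

Lemma cof_below (a : K) : has_cofinality L a -> exists b, b < a.
Proof.
move=> [[C [Ca _] CL] _]; have [n _] := nat_inj_L hL.
have [c Cc] : exists c, C c.
  apply: contrapT => nC; have C0 : C = set0 by apply/seteqP; split=> // x Cx; case: nC; exists x.
  move: CL; rewrite C0 card_eq_sym card_eq0 => /eqP /seteqP [s _].
  exact: (s (n 0)).
by exists c; exact: Ca.
Qed.

Lemma guess_stage (X : set K) (B : K -> K) (c : K) : exists a : K,
  [/\ has_cofinality L a, X `&` below a = guess a, c < a & forall b, b < a -> B b < a].
Proof.
have [a [[cof gX] ca]] := guessP X (club_closed hL hpow hK (fun b => Order.max c (B b))).
have max b : b < a -> c < a /\ B b < a by move=> /ca; rewrite Order.TotalTheory.gt_max => /andP [].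
exists a; split=> // [|b /max []//].
by have [b /max []] := cof_below cof.
Qed.

Lemma elem_infinite a d p : d `<=` dom (Qa a) -> (forall f, p f -> sem_supp d f) ->
  infinite_type N p -> infinite_type (Qa a) p.
Proof.
move=> dq supp inf l ys hl; apply: contrapT => nb.
pose v y := if pselect (dom (Qa a) y) then y else pzero (Qa a).
have vq y : dom (Qa a) (v y) by rewrite /v; case: pselect => //= _; have [] := wQ a.
have vE y : dom (Qa a) y -> v y = y by rewrite /v; case: pselect.
pose neqs := foldr (fun y r => Imp (Neg (Equal (Var None) (Var (Some y)))) r) Bot ys : form (option K).
have neqsP P u : psat P neqs u <-> ~ forall y, List.In y ys -> u None <> u (Some y).
  rewrite /neqs; elim: (ys) => [|y s IH] /=; first by split=> // h1; apply: h1.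
  rewrite IH; split=> h1 h2; first by apply: h1 => [|z zs]; apply: h2; [left|right].
  by move=> h3; apply: h1 => z [<-//|]; exact: h3.
have impP P u r : psat P (foldr (@Imp (option K)) r l) u <->
    ((forall f, List.In f l -> psat P f u) -> psat P r u).
  elim: (l) => [|f s IH] /=; first by split=> [//|]; exact.
  rewrite IH; split=> h1 h2; first by apply: h1 => [|g gs]; apply: h2; [left|right].
  by move=> h3; apply: h1 => g [<-//|]; exact: h3.
have [_ /(_ _ (All (foldr (@Imp (option K)) neqs l)) v vq) e] := Qa_N a.
have fE P f b : List.In f l -> psat P f (extend v b) <-> psat P f (extend id b).
  by move=> fl; split; apply: (supp f (hl f fl)) => //= y /dq /vE.
have : psat (Qa a) (All (foldr (@Imp (option K)) neqs l)) v.
  move=> b db; apply/impP => lb; apply/neqsP => nys; apply: nb; exists b; split=> //.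
    by move=> bys; apply: (nys b bys) => /=; rewrite vE.
  by move=> f fl; apply/fE => //; exact: lb.
(* Members of [ys] outside the stage were replaced by its zero, so the realization in [N] has to
   avoid zero as well. *)
rewrite e; have [b [db nbys lb]] := inf l (pzero (Qa a) :: ys) hl.
move=> /(_ b db) /impP hb; have : psat N neqs (extend v b).
  by apply: hb => f fl; apply/fE => //; exact: lb.
move=> /neqsP; apply=> y yys /= by_; apply: nbys; rewrite by_ /v.
by case: pselect => dy /=; [right|left].
Qed.

Lemma realize (d : set K) (p : set (form (option K))) c : small L d -> d `<=` dom N ->
  (forall f, p f -> sem_supp d f) -> inj_le p [set: L] -> infinite_type N p ->
  exists x, [/\ dom N x, ~ dom (Qa c) x & forall f, p f -> psat N f (extend id x)].
Proof.
move=> sd dN supp lep inf.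
pose X : set K := (fun f => pK (tg 0) (code pK tg f)) @` p.
have [c1 c1P] := K_bound hL hpow hK (fun f => pK (tg 0) (code pK tg f)) lep.
have [c2 c2P] := @stage_bound K d id (small_K_le sd) dN.
have [a [cof gX ca _]] := guess_stage X id (Order.max c (Order.max c1 c2)).
move: ca; rewrite !Order.TotalTheory.gt_max => /andP [ca /andP [c1a c2a]].
have pE : ptype pK tg (guess a) = p.
  apply: funext => f; apply: propext; rewrite /ptype -gX; split=> [[[g pg]]|pf].
    by move=> /pKI [_ /(code_inj pKI tgI) <-].
  by split; [exists f|apply: Order.POrderTheory.lt_trans c1a; exact: c1P].
have dq : d `<=` dom (Qa a).
  by move=> x /c2P; apply: Qa_mono; exact: Order.POrderTheory.ltW.
have [Ea _ Ta] := hS a.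
(* A cut to be listed must be active, which needs an element of the guess with tag 1; this guess
   contains only elements with tag 0. So step [a] takes up the type. *)
have nk : ~ exists s', Ext L P0 a h s' /\ Killed pK tg (Qa a) s' (guess a).
  move=> [s' [_ [Au [Bv [x [_ _ _ _ [e _ [y]]]]]]]]; rewrite e => -[u _].
  by rewrite -gX => -[[f _ /pKI [/tgI]]].
have [||x [dx nx px]] := Ta nk.
- by exists d; split=> //; rewrite pE.
- by rewrite pE; exact: (elem_infinite dq).
exists x; split.
- exact: (h_N a).1.
- by move=> xc; apply: nx; apply: Qa_mono xc; exact: Order.POrderTheory.ltW.
move=> f pf; have pfx : psat (h a).1 f (extend id x) by apply: px; rewrite pE.
pose v (i : option K) := if i is Some y then if pselect (d y) then y else x else x.
have vE y : d y -> v (Some y) = y by rewrite /v; case: pselect.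
have va i : dom (h a).1 (v i).
  case: i => [y|//] /=; rewrite /v; case: pselect => dy //=.
  by apply: (Qa_h a).1; exact: dq.
have [_ e] := h_N a.
have : psat (h a).1 f v by apply: (supp f pf) pfx => // y dy; rewrite vE.
by rewrite e //; apply: (supp f pf) => // y dy; rewrite vE.
Qed.

Lemma list_St (ys : seq K) : exists l : seq (St wN), forall x : St wN, List.In (el x) ys -> List.In x l.
Proof.
elim: ys => [|y ys [l lP]]; first by exists [::].
have [dy|ndy] := pselect (dom N y); last first.
  by exists l => x [e|/lP//]; case: ndy; rewrite e; exact: el_dom.
exists (mk wN dy :: l) => x [e|/lP]; last by right.
by left; apply: el_inj; rewrite mkE.
Qed.

(** An unrealized type is infinite: every point [y] is excluded by some member of [G], so adding
    finitely many members excludes any finite list. But infinite types over small sets are realized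
    by [realize]. *)
Lemma N_saturated : set_saturated L (St wN).
Proof.
move=> A sA G defG fip; apply: contrapT => nreal.
have inf l ys : (forall X, List.In X l -> G X) -> exists2 b, cap l b & ~ List.In b ys.
  move=> hl; apply: contrapT => nb.
  have /choice [X XP] (y : St wN) : exists X, G X /\ ~ X y.
    apply: contrapT => nX; apply: nreal; exists y => X GX.
    by apply: contrapT => nXy; apply: nX; exists X.
  have [|b bP] := fip (l ++ map X ys).
    move=> Y; rewrite In_cat => -[/hl//|].
    by elim: (ys) => //= y s IH [<-|/IH//]; exact: (XP y).1.
  apply: nb; exists b => [Y Yl|bys]; first by apply: bP; rewrite In_cat; left.
  apply: (XP b).2; apply: bP; rewrite In_cat; right.
  by elim: (ys) bys => //= y s IH [->|/IH]; [left|right].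
pose Fm (p0 : form (nat + {x | A x})) : form (option K) := fsubst p0 (fun i =>
  match i with inl 0 => Var None | inl _ => Zero | inr q => Var (Some (el (sval q))) end).
pose p : set (form (option K)) := fun f => exists2 p0, exists2 X, G X &
   (forall r, X (r 0) <-> holds p0 (@assign (St wN) A r)) & f = Fm p0.
have el0 : el (zero : St wN) = pzero N by exact: (el_eval (w := wN) (fun i : void => of_void _ i) Zero).
have FmP p0 (X : set (St wN)) b : (forall r, X (r 0) <-> holds p0 (@assign (St wN) A r)) ->
    psat N (Fm p0) (extend id (el b)) <-> X b.
  move=> Xp; rewrite (Xp (fun n => if n is 0%N then b else zero)) psatP psat_fsubst.
  by split=> H; move: H; rewrite (_ : (fun _ => _) = fun i =>
    el (@assign (St wN) A (fun n => if n is 0%N then b else zero) i)) //;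
    apply: funext => -[[|n]|q] /=; rewrite ?el0.
have sd : small L (@el _ _ wN @` A) by exact: small_image.
have [||||x [dx _ px]] := @realize (@el _ _ wN @` A) p (pzero N) sd.
- by move=> _ [x _ <-]; exact: el_dom.
- move=> _ [p0 _ ->] P v v' e0 ev; rewrite !psat_fsubst.
  rewrite (_ : (fun x => peval P v _) = 
    (fun x => peval P v' (match x with inl 0%N => Var None | inl _ => Zero
      | inr q => Var (Some (el (sval q))) end))) //.
  by apply: funext => -[[|n]|q] //=; apply: ev; exists (sval q) => //; exact: proj2_sig.
- have leA : inj_le [set: {x | A x}] [set: L].
    have [i [_ iI]] := small_K_le sd; exists (fun q => i (el (sval q))); split=> // q q' _ _ e.
    have /el_inj e' : el (sval q) = el (sval q').
      by apply: iI => //; [exists (sval q)|exists (sval q')] => //; exact: proj2_sig.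
    case: q q' e e' => [x Ax] [y Ay] /= _ e; case: _ / e Ay => Ay.
    by congr exist; exact: Prop_irrelevance.
  apply: inj_le_trans (form_le hL hpow (sum_le hL hpow (nat_le hL) leA)).
  by apply: (@inj_le_surj _ _ Bot _ _ Fm) => f [p0 _ ->]; exists p0.
- move=> l ys hl.
  have [l' [hl' ll']] : exists l' : seq (set (St wN)), (forall X, List.In X l' -> G X) /\
      forall f, List.In f l -> exists2 X, List.In X l' & forall b, X b -> psat N f (extend id (el b)).
    elim: l hl => [|f l IH] hl; first by exists [::].
    have [|l' [hl' ll']] := IH; first by move=> g gl; apply: hl; right.
    have [p0 [X GX Xp] fE] := hl f (or_introl erefl).
    exists (X :: l'); split=> [Y [<-|/hl']//|g [<-|/ll' [Y Yl Yg]]].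
      by exists X; [left|move=> b Xb; rewrite fE; apply/(FmP p0 X)].
    by exists Y => //; right.
  have [ys' ysP] := list_St ys; have [b cb nb] := inf l' ys' hl'.
  exists (el b); split; [exact: el_dom|by move=> /ysP|].
  by move=> f /ll' [X Xl]; apply; exact: cb.
apply: nreal; exists (mk wN dx) => X GX; have [p0 p0P] := defG X GX.
apply/(FmP p0 X) => //; rewrite mkE; apply: px.
by exists p0 => //; exists X.
Qed.

Lemma N_not_le : ~ inj_le (dom N) [set: L].
Proof.
move=> leN; have [c cP] := @stage_bound K (dom N) id leN (fun x dx => dx).
have [|||||x [dx nx _]] := @realize set0 set0 c; last by apply: nx; exact: cP.
- exact: small_set0.
- by [].
- by [].
- by have [n _] := nat_inj_L hL; exists (fun=> n 0%N).
- move=> l ys hl; have [b db nb] := Q_infinite hK PA0 Tdown TS ys.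
  by exists b; split=> // f /hl.
Qed.

Lemma N_card : ([set: St wN] #= [set: K])%card.
Proof.
have [[wo card] _ _] := hK; apply/card_eqPle; split.
  by apply/(inj_leP (pzero N)); exists (@el _ _ wN); split=> // x y _ _; exact: el_inj.
apply/(inj_leP zero); have [[g [gN gI]]|[a ea]] := collapse wo card (dom N).
  exists (fun x => mk wN (gN x I)); split=> // x y _ _ /(congr1 (@el _ _ wN)).
  by rewrite !mkE; exact: gI.
by exfalso; apply: N_not_le; exact: inj_le_trans ea (below_le hL hK a).
Qed.

Lemma numeral_lt (M : structure) (hM : model_of_PA M) n k : (n < k)%N ->
  less (numeral M n) (numeral M k).
Proof.
elim: k => // k IH; rewrite ltnS leq_eqVlt => /orP [/eqP ->|/IH h1].
  exact: lt_succ.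
by apply: (lt_trans hM h1); exact: lt_succ.
Qed.

Lemma numeral_lt_nonstandard (M : structure) (hM : model_of_PA M) (a : M) n :
  ~ standard a -> less (numeral M n) a.
Proof.
move=> na; case: (le_total hM a (numeral M n)) => // -[/(lt_numeral hM) [p _ e]|e].
  by case: na; exists p.
by case: na; exists n.
Qed.

(** At most [|L|] elements would all appear by some stage. The formula [x < a] is an infinite type,
    witnessed by the numerals, and so has a realization outside that stage. *)
Lemma interval_not_le (a : St wN) : ~ standard a -> ~ inj_le [set x : St wN | less x a] [set: L].
Proof.
move=> na lea.
have [c cP] := @stage_bound _ _ (@el _ _ wN) lea (fun x _ => el_dom x).
pose f : form (option K) := Less (Var None) (Var (Some (el a))).
have [|||||x [dx nx px]] := @realize [set el a] [set f] c.
- exact: small_set1.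
- by move=> _ ->; exact: el_dom.
- by move=> _ -> P v v' e0 ev /=; rewrite e0 ev.
- exact: inj_le_set1.
- move=> l ys hl; apply: contrapT => nb.
  have /finite_setPn := In_finite ys; apply.
  apply/(inj_leP (pzero N)); exists (fun n => el (numeral (St wN) n)); split=> [n _|n k _ _ /el_inj e].
    apply: contrapT => ny; apply: nb; exists (el (numeral (St wN) n)); split=> //; first exact: el_dom.
    move=> g /hl ->; apply: (proj1 (el_less (numeral (St wN) n) a)).
    by apply: numeral_lt_nonstandard => //; exact: hN.
  case: (ltngtP n k) => // /(numeral_lt hN); rewrite e => /(lt_irr hN) //.
apply: nx; rewrite -(mkE wN dx); apply: cP; apply/el_less; rewrite mkE.
exact: (px f erefl).
Qed.

Lemma Qa_le c : inj_le (dom (Qa c)) [set: L].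
Proof. by apply: (Q_le hL hpow leP0 (@aS c)); exact: below_le. Qed.

Lemma el_le c : inj_le [set x : St wN | dom (Qa c) (el x)] [set: L].
Proof.
apply: inj_le_trans (Qa_le c); exists (@el _ _ wN); split=> // x y _ _; exact: el_inj.
Qed.

Lemma option_le (X : Type) (S : set X) : inj_le S [set: L] ->
  inj_le [set o : option (X * X) | forall u v, o = Some (u, v) -> S u /\ S v] [set: L].
Proof.
move=> leS; have [i [_ iI]] := inj_le_setX hL hpow leS leS.
have [p pI] := L_pairing hL hpow; have [n nI] := nat_inj_L hL.
exists (fun o => if o is Some x then p (n 1%N) (i x) else p (n 0%N) (n 0%N)); split=> //.
move=> [[u v]|] [[u' v']|] //= So So' /pI [/nI //= _ /iI ->] //.
  exact: So.
exact: So'.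
Qed.

(** The stages at which the elements of [e] appear form a small set, which is not cofinal in [c]. *)
Lemma small_below_cof c (e : set K) : has_cofinality L c ->
  (forall x, dom (Qa c) x -> exists2 b, b < c & dom (Qa b) x) ->
  small L e -> e `<=` dom (Qa c) -> exists2 b, b < c & e `<=` dom (Qa b).
Proof.
move=> [_ cof] lim se ec.
have /choice [g gP] x : exists b, e x -> b < c /\ dom (Qa b) x.
  have [ex|nx] := pselect (e x); last by exists x.
  by have [b bc dx] := lim x (ec _ ex); exists b.
have ncof : ~ cofinal_in c (g @` e).
  move=> /cof /(inj_leP c) leL; exact: (small_image se leL).
have [b bc bP] : exists2 b, b < c & forall x, e x -> g x <= b.
  apply: contrapT => nb; apply: ncof; split=> [_ [x ex <-]|b bc]; first exact: (gP x ex).1.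
  apply: contrapT => nx; apply: nb; exists b => // x ex; rewrite Order.TotalTheory.leNgt; apply/negP => bg.
  by apply: nx; exists (g x); [exists x|exact: Order.POrderTheory.ltW].
by exists b => // x ex; apply: Qa_mono (bP x ex) _ (gP x ex).2.
Qed.

Lemma inj_le_set3 (x y z : St wN) : inj_le [set x; y; z] [set: L].
Proof. by apply: (inj_le_setU hL hpow); [apply: (inj_le_setU hL hpow)|]; exact: inj_le_set1. Qed.

(** * Refuting an automorphism *)

Section Automorphism.
Variables (f g : St wN -> St wN) (a b : St wN).
Hypothesis fmono : forall x y, less x y <-> less (f x) (f y).
Hypothesis fK : forall y, f (g y) = y.
Hypothesis na : ~ standard a.
Hypothesis powb : forall n, le (power a n) b.
Hypothesis fb : f b = a.

Lemma f_inj : injective f.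
Proof.
move=> x y e; apply: contrapT => /(neq_lt hN) [] /fmono; rewrite e; exact: (lt_irr hN).
Qed.

Lemma two_le : le (add one one) a.
Proof.
apply: lt_le; have := numeral_lt_nonstandard hN 2 na.
by rewrite /= (padd0l hN).
Qed.

(* The interval [0, a) of N has more than |L| elements, so one of the a blocks
   of Y avoids the preimage of any given stage. *)
Lemma avoid_stage c m y : divisible_upto m b -> big a (coded m b y) -> exists s t y',
  [/\ big a (coded m b y'), coded m b y' `<=` coded m b y,
    forall x, coded m b y' x -> le s x /\ less x t &
    forall z, le s z -> le z t -> ~ dom (Qa c) (el (f z))].
Proof.
move=> mb bY; have hM := hN.
have dY : Def setT (fun r => coded m b y (r 0%N)) by rewrite /coded /member /dvd /modulus; dfn.
have [|U [Umono Ubig]] := blocks hM two_le dY _ bY (b := b); first by move=> x [].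
have Ule s t : less s t -> less t a -> le (U (add s one)) (U t).
  move=> st ta; have /(lt_leS hM) [h1|->] := st; last by right.
  by apply: lt_le; apply: Umono => //; apply: lt_le.
have [t ta tP] : exists2 t, less t a &
    forall z, le (U t) z -> le z (U (add t one)) -> ~ dom (Qa c) (el (f z)).
  apply: contrapT => nt; apply: (interval_not_le na).
  have /choice [r rP] t : exists z, less t a ->
      [/\ le (U t) z, le z (U (add t one)) & dom (Qa c) (el (f z))].
    have [ta|nta] := pselect (less t a); last by exists zero.
    apply: contrapT => nz; apply: nt; exists t => // z h1 h2 h3.
    by apply: nz; exists z.
  have [i [_ iI]] := Qa_le c; have [p pI] := L_pairing hL hpow; have [n nI] := nat_inj_L hL.
  (* If every block met the preimage of the stage, [t] could be recovered from a point [r t] of its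
     closed block. Adjacent blocks share an endpoint, and the flag tells whether [r t] is the right
     endpoint. *)
  exists (fun t => p (i (el (f (r t)))) (if pselect (less (r t) (U (add t one))) is left _ then n 0%N else n 1%N)).
  split=> // s t sa ta /pI [/iI e].
  have [s1 s2 s3] := rP s sa; have [t1 t2 t3] := rP t ta.
  have {}e : r s = r t by apply: f_inj; apply: (@el_inj _ _ wN); exact: e.
  have main s' t' : less s' t' -> less t' a -> r s' = r t' -> le (U t') (r t') ->
      ~ less (r s') (U (add s' one)).
    move=> st ta' e' h1; apply/(leNlt hM); apply: (le_trans hM (Ule _ _ st ta')).
    by rewrite e'.
  have main2 s' t' : less s' t' -> less t' a -> U (add s' one) <> U (add t' one).
    move=> st ta' e'; apply: (@lt_irr _ hM (U (add s' one))); rewrite {2}e'.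
    by apply: Umono; [apply: lt_add => //; exact: le_refl|apply/(lt_leS hM)].
  case: pselect => h1; case: pselect => h2; last 1 first.
  - move=> _; apply: contrapT => /(neq_lt hM) [st|ts].
      apply: (main2 s t st ta).
      by case: s2 => [//|<-]; case: t2 => [//|<-].
    apply: (main2 t s ts sa).
    by case: s2 => [//|<-]; case: t2 => [//|<-].
  - move=> _; apply: contrapT => /(neq_lt hM) [st|ts].
      exact: (main s t st ta e t1).
    exact: (main t s ts sa (esym e) s1).
  - by move=> /nI.
  - by move=> /nI.
have dZ : Def setT (fun r => coded m b y (r 0%N) /\ le (U t) (r 0%N) /\ less (r 0%N) (U (add t one))).
  by rewrite /coded /member /dvd /modulus; dfn.
have [y' y'P] := @coding _ hM setT
  (fun x => coded m b y x /\ le (U t) x /\ less x (U (add t one))) m b dZ mb.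
have YE x : coded m b y' x <-> coded m b y x /\ le (U t) x /\ less x (U (add t one)).
  split=> [[xb]|hx]; first by rewrite y'P.
  have [[xb _] _] := hx; by split=> //; rewrite y'P.
exists (U t), (U (add t one)), y'; split=> //.
- by apply: big_sub (Ubig t ta) => x hx; apply/YE.
- by move=> x /YE [].
- by move=> x /YE [].
Qed.

(** Stage [c] has at most [|L|] elements, small subsets and possible intervals, so chosen answers in
    [N] to all questions about them appear by a common stage [d]. The last clause is [avoid_stage],
    with the stage to be avoided being [c] itself. *)
Lemma closure_bound m : divisible_upto m b -> forall c, exists d : K, [/\ c < d,
  forall x : St wN, dom (Qa c) (el x) -> dom (Qa d) (el (f x)) /\ dom (Qa d) (el (g x)),
  forall x y : St wN, dom (Qa c) (el x) -> dom (Qa c) (el y) -> pK (tg 1) (pK (el x) (el y)) < d,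
  forall (e e0 : set (St wN)) o, small L e -> small L e0 ->
    (forall x, (e `|` e0) x -> dom (Qa c) (el x)) ->
    (forall u v, o = Some (u, v) -> dom (Qa c) (el u) /\ dom (Qa c) (el v)) ->
    (exists y, refinement a b m e e0 o y) -> exists2 y, dom (Qa d) (el y) & refinement a b m e e0 o y &
  forall y : St wN, dom (Qa c) (el y) -> big a (coded m b y) -> exists s t y' : St wN,
    [/\ dom (Qa d) (el s), dom (Qa d) (el t), dom (Qa d) (el y') &
    [/\ big a (coded m b y'), coded m b y' `<=` coded m b y,
      forall x, coded m b y' x -> le s x /\ less x t &
      forall z, le s z -> le z t -> ~ dom (Qa c) (el (f z))]]].
Proof.
move=> mb c; have lec := el_le c.
have [d0 d0P] := K_gt c.
have [d1 d1P] := stage_bound lec (fun x _ => el_dom (f x)).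
have [d2 d2P] := stage_bound lec (fun x _ => el_dom (g x)).
have [d3 d3P] := K_bound hL hpow hK (fun xy : St wN * St wN => pK (tg 1) (pK (el xy.1) (el xy.2)))
  (inj_le_setX hL hpow lec lec).
have les := small_sets_le hL hpow lec; have leo := option_le lec.
have /choice [Y YP] (i : (set (St wN) * set (St wN)) * option (St wN * St wN)) :
    exists y, (exists y, refinement a b m i.1.1 i.1.2 i.2 y) -> refinement a b m i.1.1 i.1.2 i.2 y.
  have [[y ty]|ny] := pselect (exists y, refinement a b m i.1.1 i.1.2 i.2 y); first by exists y.
  by exists zero.
have [d4 d4P] := stage_bound (inj_le_setX hL hpow (inj_le_setX hL hpow les les) leo)
  (fun i _ => el_dom (Y i)).
have /choice [Z ZP] (y : St wN) : exists sty : St wN * St wN * St wN, big a (coded m b y) ->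
    [/\ big a (coded m b sty.2), coded m b sty.2 `<=` coded m b y,
      forall x, coded m b sty.2 x -> le sty.1.1 x /\ less x sty.1.2 &
      forall z, le sty.1.1 z -> le z sty.1.2 -> ~ dom (Qa c) (el (f z))].
  have [bY|nb] := pselect (big a (coded m b y)); last by exists (zero, zero, zero).
  by have [s [t [y' H]]] := avoid_stage c mb bY; exists (s, t, y').
have [d5 d5P] := stage_bound lec (fun y _ => el_dom (Z y).1.1).
have [d6 d6P] := stage_bound lec (fun y _ => el_dom (Z y).1.2).
have [d7 d7P] := stage_bound lec (fun y _ => el_dom (Z y).2).
have [d [h0 h1 h2 [h3 h4] [h5 h6 h7]]] : exists d : K, [/\ d0 <= d, d1 <= d, d2 <= d, d3 <= d /\ d4 <= d &
    [/\ d5 <= d, d6 <= d & d7 <= d]].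
  pose dd i := nth d0 [:: d0; d1; d2; d3; d4; d5; d6; d7] i.
  have [d dP] := K_bound hL hpow hK dd (nat_le hL).
  by exists d; split; [| | |split|split]; apply: Order.POrderTheory.ltW;
    [exact: (dP 0%N)|exact: (dP 1%N)|exact: (dP 2)|exact: (dP 3)|exact: (dP 4)|exact: (dP 5)|exact: (dP 6)|exact: (dP 7)].
exists d; split.
- exact: Order.POrderTheory.lt_le_trans h0.
- by move=> x xc; split; [apply: Qa_mono h1 _ (d1P _ xc)|apply: Qa_mono h2 _ (d2P _ xc)].
- by move=> x y xc yc; apply: Order.POrderTheory.lt_le_trans h3; apply: (d3P (x, y)).
- move=> e e0 o se se0 ec oc ex; exists (Y ((e, e0), o)); last exact: YP.
  apply: Qa_mono h4 _ (d4P _ _); split=> //=; split; split=> // x ex'; apply: ec; by [left|right].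
- move=> y yc bY; exists (Z y).1.1, (Z y).1.2, (Z y).2; split; last exact: ZP.
  + exact: Qa_mono h5 _ (d5P _ yc).
  + exact: Qa_mono h6 _ (d6P _ yc).
  + exact: Qa_mono h7 _ (d7P _ yc).
Qed.

(* At a stage c of cofinality L where the diamond guesses f, which is closed under the
   functions of [closure_bound], the conditions of [kill_filter] are met inside stage
   c. Hence step c fills a cut whose image under f stays unfilled in N. *)
Lemma no_automorphism : False.
Proof.
have [m mb] := divisible_upto_ex hN b.
have [B BP] := choice (closure_bound mb).
pose X : set K := fun k => exists x : St wN, k = pK (tg 1) (pK (el x) (el (f x))).
have [c0 c0P] := @stage_bound (St wN) [set a; b; m] (@el _ _ wN)
  (inj_le_set3 a b m) (fun x _ => el_dom x).
have [c [cof gX c0c cB]] := guess_stage X B c0.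
have q0 x : [set a; b; m] x -> dom (Qa c) (el x).
  by move=> /c0P; apply: Qa_mono; exact: Order.POrderTheory.ltW.
have [b0 b0c] := cof_below cof.
have BQ x d : d < c -> dom (Qa (B d)) x -> dom (Qa c) x.
  by move=> /cB dc; apply: Qa_mono; exact: Order.POrderTheory.ltW.
have lim x : dom (Qa c) x -> exists2 d, d < c & dom (Qa d) x.
  move=> [P [->|[d dc ->]] dx]; first by exists b0 => //; exists P0 => //; left.
  have [dB _ _ _ _] := BP d; exists (B d); first exact: cB.
  by exists (h d).1 => //; right; exists d.
have slim e := small_below_cof cof lim (e := e).
pose w := wQ c; pose E := Qa_N c; pose i := inj (w := w) wN E.
have iP (x : St wN) : dom (Qa c) (el x) -> exists y, i y = x.
  by move=> dx; exists (mk w dx); apply: el_inj; rewrite injE mkE.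
have [a' aE] := iP a (q0 a (or_introl (or_introl erefl))).
have [b' bE] := iP b (q0 b (or_introl (or_intror erefl))).
have [m' mE] := iP m (q0 m (or_intror erefl)).
have fq x : exists y, i y = f (i x).
  apply: iP; have [d dc dx] := lim _ (el_dom x).
  have [_ /(_ (i x)) + _ _ _] := BP d; rewrite injE => /(_ dx) [dfx _]; exact: (BQ _ d).
have gq x : exists y, i y = g (i x).
  apply: iP; have [d dc dx] := lim _ (el_dom x).
  have [_ /(_ (i x)) + _ _ _] := BP d; rewrite injE => /(_ dx) [_ dgx]; exact: (BQ _ d).
have [f' f'P] := choice fq.
have iI : injective i by exact: inj_inj.
have iL x y : less x y <-> less (i x) (i y) by exact: inj_less.
have iLe x y : le x y <-> le (i x) (i y) by exact: inj_le_el.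
(* The problem is moved up to [N], where saturation solves it. Its parameters and the endpoints in
   [o] lie in some stage [k] below [c], so a solution lies in stage [B k] and is moved back down to
   stage [c]. *)
have N1 d d0 o : refinable L a' b' m' d d0 o -> exists y, refinement a' b' m' d d0 o y.
  move=> hyp; have [sd _ d0d _ _] := hyp; have := refinable_up wN E hyp.
  rewrite -/i aE bE mE => hyp'.
  have ex := refinement_ex hL hpow hN N_saturated two_le mb hyp'.
  pose eo : set (St w) := fun x => exists u v, o = Some (u, v) /\ [set u; v] x.
  have seo : small L eo.
    rewrite /eo; case: (o) => [[u v]|].
      apply: (@small_sub _ _ _ _ [set u; v]); first by move=> x [u' [v' [[<- <-]]]].
      by apply: small_finite => //; exact: finite_set2.
    by apply: (@small_sub _ _ _ _ set0); [move=> x [u [v []]]|exact: small_set0].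
  have [||k kc ek] := slim (@el _ _ w @` (d `|` eo)).
  - by apply: small_image; exact: small_setU.
  - by move=> _ [x _ <-]; exact: el_dom.
  have [_ _ _ + _] := BP k.
  move=> /(_ (@up _ _ _ w wN E d) (@up _ _ _ w wN E d0) (omap (fun p => (i p.1, i p.2)) o)) [|||||y dy Ty].
  - exact: small_image.
  - by apply: small_image; apply: small_sub sd.
  - move=> x [[z dz <-]|[z dz <-]]; rewrite injE; apply: ek; exists z => //; left => //.
    exact: d0d.
  - move=> u v; case oE: o => [[u' v']|//] [<- <-]; rewrite !injE; split; apply: ek.
      by exists u' => //; right; exists u', v'; split=> //; left.
    by exists v' => //; right; exists u', v'; split=> //; right.
  - exact: ex.
  have [y' yE] := iP y (BQ _ _ kc dy); exists y'.
  by apply: (refinement_down (w' := wN) (PQ := E)); [exact: hN|rewrite -/i aE bE mE yE].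
have N2 d y : small L d -> big a' (coded m' b' y) -> exists s t y',
    [/\ big a' (coded m' b' y'), coded m' b' y' `<=` coded m' b' y,
      forall x, coded m' b' y' x -> le s x /\ less x t &
      forall z, le s z -> le z t -> ~ dcl d (f' z)].
  move=> sd; rewrite (inj_big wN E) -/i aE bE mE => bY.
  have [||k kc ek] := slim (@el _ _ w @` (d `|` [set y])).
  - by apply: small_image; apply: small_setU => //; exact: small_set1.
  - by move=> _ [x _ <-]; exact: el_dom.
  have dy : dom (Qa k) (el (i y)) by rewrite injE; apply: ek; exists y => //; right.
  have [_ _ _ _ /(_ _ dy bY)] := BP k.
  move=> [s [t [y' [ds dt dy' [bY' sub st out]]]]].
  have [s0 sE] := iP s (BQ _ _ kc ds); have [t0 tE] := iP t (BQ _ _ kc dt).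
  have [y0 yE] := iP y' (BQ _ _ kc dy'); exists s0, t0, y0; split.
  - by rewrite (inj_big wN E) -/i aE bE mE yE.
  - by rewrite (inj_coded_sub wN E) -/i bE mE yE.
  - move=> x; rewrite (inj_coded wN E) -/i bE mE yE => /st.
    by rewrite -sE -tE -iLe -iL.
  - move=> z /iLe; rewrite sE => sz /iLe; rewrite tE => zt dz.
    apply: (out _ sz zt); rewrite -f'P injE.
    (* Since [d] lies in stage [k], an elementary submodel, everything definable from [d] lies there
       too; but the images of [[s, t]] avoid stage [k]. *)
    have ekc : elem (Qa k) (Qa c) by exact: elem_trans (Qa_h k) (h_Qa kc).
    have [|z' [zE _]] := dcl_down (w := wQ k) (w' := w) (PQ := ekc) (d := [set x | d (inj w ekc x)]) (z := f' z).
      apply: dfun_sub dz => x dx.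
      have dxk : dom (Qa k) (el x) by apply: ek; exists x => //; left.
      have xE : inj w ekc (mk (wQ k) dxk) = x by apply: el_inj; rewrite injE mkE.
      by exists (mk (wQ k) dxk) => //=; rewrite xE.
    by rewrite -zE injE; exact: el_dom.
have f'mono x y : less x y <-> less (f' x) (f' y) by rewrite !iL !f'P.
have f'surj y : exists x, f' x = y.
  by have [x xE] := gq y; exists x; apply: iI; rewrite f'P xE fK.
have f'b : f' b' = a' by apply: iI; rewrite f'P bE aE.
have a2' : le (add one one) a' by rewrite iLe [i _]inj_two -/i aE; exact: two_le.
have powb' n : le (power a' n) b' by rewrite iLe /i inj_pow -/i aE bE.
have IH d : d < c -> Step L P0 guess pK tg d h (h d) by [].
have [F [Au [Bv [PF FA FB AB [FAB FD]]]]] := kill_filter hL hpow (@hQ c) (St_le hL hpow hK leP0 IH w)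
  (cuts_le hL hK w) (cuts_good hL hpow hK PA0 IH (wq := w)) a2' powb' f'mono f'surj f'b N1 N2.
have [P' [x [w' ePQ leP' gc [dx _ sat gAB]]]] := filter_step hL hpow hK PA0 leP0 IH PF FD.
pose A' := @el _ _ w @` (f' @` Au); pose B' := @el _ _ w @` (f' @` Bv).
have hrel u y : guess c (pK (tg 1) (pK (el (u : St w)) y)) <-> y = el (f' u).
  rewrite -gX; split=> [[[z /pKI [_ /pKI [e1 ->]]] _]|->].
    have -> : z = i u by apply: el_inj; rewrite injE.
    by rewrite -f'P injE.
  split; first by exists (i u); rewrite -f'P !injE.
  (* The guess sees only codes below [c]. Both components lie in one earlier stage [k], whose pairs
     have codes below [B k]. *)
  have [k kc ek] : exists2 k, k < c & dom (Qa k) (el u) /\ dom (Qa k) (el (f' u)).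
    have [||k kc ek] := slim [set el u; el (f' u)].
    - by apply: small_finite => //; exact: finite_set2.
    - by move=> _ [->|->]; exact: el_dom.
    by exists k => //; split; apply: ek; [left|right].
  have [_ _ /(_ (i u) (i (f' u))) + _ _] := BP k; rewrite !injE => /(_ ek.1 ek.2) lt.
  by apply: Order.POrderTheory.lt_trans lt _; exact: cB.
have goodAB : goodP L P' A' B'.
  apply: gAB => //; move=> _ _ [u Au_ <-] [v Bv_ <-]; apply: (f'mono _ _).1; exact: AB.
have [_ Ks _] := hS c.
have /Ks : exists s', Ext L P0 c h s' /\ Killed pK tg (Qa c) s' (guess c).
  exists (P', (A', B')); split; first by split.
  exists (@el _ _ w @` Au), (@el _ _ w @` Bv), x; split=> //.
  - by move=> _ [u _ <-]; exact: el_dom.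
  - by move=> _ [u _ <-]; exact: el_dom.
  - split=> _ [u uA <-].
      have := sat unit (fun=> u) (Neg (Less (Var None) (Var (Some tt)))); apply.
      apply: filterS (FA u uA) => t /= ut; exact/(leNlt (@hQ c)).
    exact: (sat unit (fun=> u) (Less (Var None) (Var (Some tt))) (FB u uA)).
  - have im (S : set (St w)) : @el _ _ w @` (f' @` S) =
        (fun y => exists2 u, (@el _ _ w @` S) u & guess c (pK (tg 1) (pK u y))).
      apply: funext => y; apply: propext; split=> [[_ [u Su <-] <-]|[_ [u Su <-] /hrel ->]].
        by exists (el u); [exists u|apply/hrel].
      by exists (f' u) => //; exists u.
    split; [exact: im|exact: im|].
    have [u [v [Au_ _ _]]] := FAB set0 (small_set0 hL (T := St w)).
    by exists (el u); exists u.
move=> [Au' [Bv' [x' [Aq Bq dx' [xA xB] [eA eB act]]]]].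
have [_ _ [wn gn]] := Q_good hL hpow hK PA0 Tdown TS (I : setT c) act.
have {wn} gn : good L (fun x : St wN => (h c).2.1 (el x)) (fun x => (h c).2.2 (el x)).
  by rewrite (Prop_irrelevance wN wn).
have dxN : dom N x' by exact: (h_N c).1.
have sx : small L [set f (mk wN dxN)] by exact: small_set1.
(* The element [x'] actually added at step [c] fills the source cut, so its image lies between the
   two sides of the listed cut. Goodness in [N], applied to the one-element set of that image,
   places it outside some [[u, v]]. *)
have [_ /(_ _ sx) [u [v [uA vB out]]]] := gn.
have /out := dcl_self (erefl : [set f (mk wN dxN)] (f (mk wN dxN))).
move: uA vB; rewrite eA eB => -[u0 Au0 hu] [v0 Bv0 hv].
have du := Aq _ Au0; have dv := Bq _ Bv0.
have {}hu : u = f (i (mk w du)).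
  by apply: el_inj; rewrite -f'P injE; apply/hrel; rewrite mkE.
have {}hv : v = f (i (mk w dv)).
  by apply: el_inj; rewrite -f'P injE; apply/hrel; rewrite mkE.
case=> [|]; rewrite ?hu ?hv -fmono el_less !injE !mkE.
  have dux : dom (h c).1 u0 by exact: (Qa_h c).1.
  by rewrite -(elem_less (h_N c)) //; exact: xA.
have dvx : dom (h c).1 v0 by exact: (Qa_h c).1.
rewrite -(elem_less (h_N c)) // => vx.
have wc := (fam_wf w0 TS (or_intror (ex_intro2 _ _ c I erefl)) : wfp (h c).1).
have hc : model_of_PA (St wc) by apply: elem_PA (@hQ c); exact: Qa_h.
apply: (@lt_irr _ hc (mk wc dvx)); apply: (lt_trans hc (y := mk wc dx')); apply/el_less; rewrite !mkE //.
exact: xB.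
Qed.

End Automorphism.

End Limit.

(* The prime model of Th(M): the ultrapower by a principal ultrafilter of the
   functions definable without parameters. *)
Lemma prime_model_ex (dL : Order.disp_t) (L : orderType dL)
    (dK : Order.disp_t) (K : orderType dK) (hL : is_infinite_cardinal L)
    (hpow : ([set: short_seq L] #= [set: L])%card) (hK : is_succ_cardinal L K)
    (M : structure) (hM : model_of_PA M) :
  exists (P0 : prestructure K) (w0 : wfp P0), [/\ model_of_PA (St w0),
    inj_le (dom P0) [set: L] & Th M `<=` Th (St w0)].
Proof.
have [n _] := nat_inj_L hL; have [i iI] := L_inj_K hL hK.
have le0 : inj_le (@set0 M) [set: L] by exists (fun=> n 0); split.
have [k [_ kI]] := Dfn_le hL hpow le0.
have dc h : Dfn set0 h -> Dfn (M := M) set0 (fun=> h zero).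
  by move=> dh; apply: (dcl_app dh); exact: dfun_zero.
pose psi (h : M -> M) := i (k (fun=> h zero)).
have psiP h h' : Dfn set0 h -> Dfn set0 h' ->
    (psi h = psi h' <-> principal_filter zero [set t | h t = h' t]).
  move=> /dc dh /dc dh'; rewrite principal_filterP /psi /=; split=> [/iI /kI|->//].
  by move=> /(_ dh dh') /(congr1 (fun g => g zero)).
pose w0 := ultrapower_wf psiP.
have losP (V : Type) (p : form V) (v : V -> St w0) : exists u : V -> M, holds p v <-> holds p u.
  have /choice [H HP] j : exists h, Dfn set0 h /\ psi h = el (v j).
    by have [h dh hE] := el_dom (v j); exists h.
  exists (fun j => H j zero); rewrite psatP.
  rewrite (_ : (fun j => el (v j)) = (fun j => psi (H j))); last first.
    by apply: funext => j; have [_ ->] := HP j.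
  rewrite (los hM (principal_filter_ultra zero) psiP); last by move=> j; have [] := HP j.
  by rewrite principal_filterP.
exists (ultrapower set0 (principal_filter zero) psi), w0; split.
- by move=> p /hM pM v; have [u ->] := losP _ p v.
- have /choice [H HP] z : exists h, dom (ultrapower set0 (principal_filter zero) psi) z -> Dfn set0 h /\ psi h = z.
    have [[h dh hE]|nz] := pselect (dom (ultrapower set0 (principal_filter zero) psi) z); first by exists h.
    by exists (fun=> zero).
  exists (fun z => k (fun=> H z zero)); split=> // z z' /HP [_ zE] /HP [_ zE'] e.
  by rewrite -zE -zE' /psi e.
- move=> p pM; have [u e] := losP _ p (@of_void (St w0)); apply/e.
  by rewrite (_ : u = @of_void M) //; apply: funext => -[].
Qed.

Lemma not_E4 (N : structure) (hN : model_of_PA N) (a b : N) :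
  ~ standard a -> ~ standard b -> ~ E4 a b ->
  (forall n, le (power a n) b) \/ (forall n, le (power b n) a).
Proof.
move=> na nb nE.
have ge1 (x : N) : ~ standard x -> le one x.
  move=> nx; have := numeral_lt_nonstandard hN 1 nx; rewrite /= (padd0l hN); exact: lt_le.
have [h|/existsNP [n /(ltNle hN) bn]] := pselect (forall n, le (power a n) b); first by left.
have [h|/existsNP [m /(ltNle hN) am]] := pselect (forall n, le (power b n) a); first by right.
case: nE; split=> //; exists (n + m)%N; split.
  by apply: (lt_le_trans hN am); apply: pow_le (ge1 _ nb) (leq_addl _ _).
by apply: (lt_le_trans hN bn); apply: pow_le (ge1 _ na) (leq_addr _ _).
Qed.

Theorem theorem3p10
  (dL : Order.disp_t) (L : orderType dL)
  (dK : Order.disp_t) (K : orderType dK)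
  (hL : is_infinite_cardinal L)
  (hpow : ([set: short_seq L] #= [set: L])%card)
  (hK : is_succ_cardinal L K)
  (hdiamond : diamond [set a : K | has_cofinality L a]%classic)
  (M : structure) (hM : model_of_PA M) :
  exists N : structure,
    [/\ (Th M `<=` Th N)%classic,
        saturated L N,
        ([set: N] #= [set: K])%card &
        forall a b : N, E5 a b -> E4 a b].
Proof.
have [P0 [w0 [PA0 leP0 Th0]]] := prime_model_ex hL hpow hK hM.
have [guess [_ guessP]] := hdiamond.
have [pK pKI] := K_pairing hL hpow hK.
have [n nI] := nat_inj_L hL; have [i iI] := L_inj_K hL hK.
have tgI : injective (i \o n) by move=> x y /iI /nI.
have [h hS] := chain_ex hL hpow hK PA0 leP0 guess pK (i \o n).
pose w := wN hK w0 hS; have hw : model_of_PA (St w) by exact: hN.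
have E0 : elem P0 (N P0 h) by apply: (Q_elem hK w0 (fun _ _ _ _ => I) (fun b _ => hS b)); left.
exists (St w); split.
- move=> p /Th0 /psatP; rewrite E0.2; last by case.
  move=> pN; apply/psatP; rewrite (_ : (fun j => el (@of_void (St w) j)) = (fun j => el (@of_void (St w0) j))) //.
  by apply: funext => -[].
- apply: saturated_of_sets; exact: N_saturated.
- exact: N_card.
- move=> a b [na nb [f [[g gf fg] fmono] fa]]; apply: contrapT => nE.
  have [pow|pow] := not_E4 hw na nb nE.
    apply: (no_automorphism hL hpow PA0 leP0 pKI tgI guessP (hS := hS) (f := g) (g := f) (a := a) (b := b)) => //.
      by move=> x y; rewrite (fmono (g x)) !fg.
    by rewrite -fa gf.
  exact: (no_automorphism hL hpow PA0 leP0 pKI tgI guessP (hS := hS) (f := f) (g := g) (a := b) (b := a)).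
Qed.
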